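(* Let $a,b,c:\mathbb R\to\mathbb R$ be smooth functions satisfying hypothesis (H), let $m$ be a smooth compactly supported symbol on $\mathbb R^2$, and set $\Phi(\xi,\eta)=-a(\xi)+b(\xi-\eta)+c(\eta)$, $\mu(\xi,\eta)=m(\xi-\eta,\eta)$. For $X\in\mathbb R$ let $\psi(\xi,\eta,\sigma)=a(\xi)+\sigma\Phi(\xi,\eta)+X\xi$. Assume that $\partial_\eta\Phi$ does not vanish on $\operatorname{Supp}\mu$ (no space resonances, i.e. $\Delta=\emptyset$), that $\partial_\xi^2\psi(\xi,\eta,\sigma)=a''(\xi)+\sigma\partial_\xi^2\Phi(\xi,\eta)$ does not vanish for $(\xi,\eta)\in\operatorname{Supp}\mu$, $\sigma\in[0,1]$, and that $f,g\in\mathcal S(\mathbb R)$. Fix $M>0$ and $N\in\mathbb N$. Let $U_M$ be the function which on $0<t<M$ solves $i\partial_tU_M+a(D)U_M=T_m(v,w)$ (with $v,w$ as below) and for $t>M$ solves $i\partial_tU_M+a(D)U_M=0$, with $U_M(0)=0$. Then, as $t\to\infty$, $$u(t)=U_M(t)+O\left(\frac{1}{M^N\sqrt t}\right).$$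
   Context: Hypothesis (H): the second derivatives $a'',b'',c''$ are bounded away from zero. $T_m(f,g)(x)=\int_{\mathbb R^2}e^{ix(\xi+\eta)}\widehat f(\xi)\widehat g(\eta)m(\xi,\eta)\,d\xi\,d\eta$; $e^{ita(D)}$ is the Fourier multiplier with symbol $e^{ita(\xi)}$. The functions $v,w$ solve $i\partial_tv+b(D)v=0$, $i\partial_tw+c(D)w=0$ with $v(0)=f$, $w(0)=g$, and $u$ solves $i\partial_tu+a(D)u=T_m(v,w)$ for all $t$, $u(0)=0$. (Thus $U_M(t)=e^{ita(D)}F$ with $F=-i\int_0^Me^{-isa(D)}T_m(e^{isb(D)}f,e^{isc(D)}g)\,ds$.) *)

(* Defs.v *)
From Stdlib Require Import Reals List.
From Coquelicot Require Import Coquelicot.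
Open Scope R_scope.

Definition expi (th : R) : C := (cos th, sin th).

Definition IntR (h : R -> C) : C :=
  RInt_gen (V := C_R_CompleteNormedModule) h
    (Rbar_locally m_infty) (Rbar_locally p_infty).

Definition FT (h : R -> C) (xi : R) : C :=
  IntR (fun x => Cmult (expi (- (x * xi))) (h x)).

(* Fourier multiplier with symbol p, given the Fourier transform Fh of the
   input:  (p(D) h)(x) = (1/2pi) \int e^{i x xi} p(xi) \hat h(xi) dxi *)
Definition multF (p : R -> C) (Fh : R -> C) (x : R) : C :=
  Cmult (RtoC (/ (2 * PI)))
    (IntR (fun xi => Cmult (expi (x * xi)) (Cmult (p xi) (Fh xi)))).

Definition mult (p : R -> C) (h : R -> C) : R -> C := multF p (FT h).

Definition eitaD (a : R -> R) (t : R) (h : R -> C) : R -> C :=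
  mult (fun xi => expi (t * a xi)) h.

(* Bilinear operator T_m, taking as inputs the Fourier transforms Ff, Fg
   of its two arguments:
   T_m(f,g)(x) = \int\int e^{ix(xi+eta)} \hat f(xi) \hat g(eta) m(xi,eta) *)
Definition TmF (m : R -> R -> C) (Ff Fg : R -> C) (x : R) : C :=
  IntR (fun xi => IntR (fun eta =>
    Cmult (expi (x * (xi + eta))) (Cmult (Cmult (Ff xi) (Fg eta)) (m xi eta)))).

(* T_m(e^{isb(D)} f, e^{isc(D)} g): the Fourier transforms of
   v(s) = e^{isb(D)}f and w(s) = e^{isc(D)}g are e^{isb} \hat f, e^{isc} \hat g *)
Definition Tm_vw (m : R -> R -> C) (b c : R -> R) (f g : R -> C) (s : R) : R -> C :=
  TmF m (fun xi => Cmult (expi (s * b xi)) (FT f xi))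
        (fun eta => Cmult (expi (s * c eta)) (FT g eta)).

Definition Fint (a b c : R -> R) (m : R -> R -> C) (f g : R -> C) (T : R) (x : R) : C :=
  Cmult (0, -1)
    (RInt (V := C_R_CompleteNormedModule)
       (fun s => eitaD a (- s) (Tm_vw m b c f g s) x) 0 T).

(* Duhamel solution u of  i u_t + a(D) u = T_m(v,w), u(0) = 0 *)
Definition u_sol (a b c : R -> R) (m : R -> R -> C) (f g : R -> C) (t : R) : R -> C :=
  eitaD a t (Fint a b c m f g t).

(* U_M: forced on (0,M), free for t > M, U_M(0) = 0 *)
Definition U_M (a b c : R -> R) (m : R -> R -> C) (f g : R -> C) (M t : R) : R -> C :=
  eitaD a t (Fint a b c m f g (Rmin t M)).

Definition smooth1 (h : R -> R) : Prop := forall k x, ex_derive_n h k x.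

Fixpoint pderiv (l : list bool) (h : R -> R -> R) : R -> R -> R :=
  match l with
  | nil => h
  | true :: l' => fun x y => Derive (fun x' => pderiv l' h x' y) x
  | false :: l' => fun x y => Derive (fun y' => pderiv l' h x y') y
  end.

Definition smooth2 (h : R -> R -> R) : Prop :=
  forall l : list bool,
    (forall x y, ex_derive (fun x' => pderiv l h x' y) x /\
                 ex_derive (fun y' => pderiv l h x y') y) /\
    (forall x y, continuous (fun p : R * R => pderiv l h (fst p) (snd p)) (x, y)).

Definition smooth_compact_symbol (m : R -> R -> C) : Prop :=
  smooth2 (fun x y => Re (m x y)) /\ smooth2 (fun x y => Im (m x y)) /\
  exists R0, forall x y, R0 < Rabs x \/ R0 < Rabs y -> m x y = 0%C.

Definition schwartz_real (h : R -> R) : Prop :=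
  smooth1 h /\
  forall j k : nat, exists C0, forall x, Rabs x ^ j * Rabs (Derive_n h k x) <= C0.

Definition schwartz (h : R -> C) : Prop :=
  schwartz_real (fun x => Re (h x)) /\ schwartz_real (fun x => Im (h x)).

Definition second_deriv_away_from_zero (h : R -> R) : Prop :=
  exists d, 0 < d /\ forall x, d <= Rabs (Derive_n h 2 x).

Definition Phi (a b c : R -> R) (xi eta : R) : R := - a xi + b (xi - eta) + c eta.

Definition mu (m : R -> R -> C) (xi eta : R) : C := m (xi - eta) eta.

Definition psi (a b c : R -> R) (X xi eta sigma : R) : R :=
  a xi + sigma * Phi a b c xi eta + X * xi.

Definition in_supp (h : R -> R -> C) (xi eta : R) : Prop :=
  forall eps, 0 < eps -> exists x y,
    Rabs (x - xi) < eps /\ Rabs (y - eta) < eps /\ h x y <> 0%C.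

(* Main.v *)
Require Import Defs.
From Stdlib Require Import Reals.
From Coquelicot Require Import Coquelicot.
From Stdlib Require Import Lra ClassicalEpsilon FunctionalExtensionality.
Open Scope R_scope.

(* Write [A z e = FT f z * FT g e * m z e]. Fourier inversion turns the Duhamel integral
   into [u - U_M = -i int_M^t J(s) ds], where [J(s)] is the integral over [(z, e)] of [A]
   against the exponential of [i] times
     [x (z + e) + t a (z + e) + s (- a (z + e) + b z + c e)].
   - The operator [d/de - d/dz] kills functions of [z + e], so it differentiates this phase
     to [s (c' e - b' z)], which does not vanish on the support of [m]: each integration by
     parts gains a factor [1 / s].
   - The second derivative of the phase in [z] is [(t - s) a'' (z + e) + s b'' z]. By (H),
     [a''] and [b''] have constant signs, and these agree because of the assumption on
     [psi] at one point of the support; so it is everywhere at least [t d] in absolute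
     value, and van der Corput's lemma gains [1 / sqrt t].
   Hence [s^N (1 + s^2) |J(s)| <= C / sqrt t], and integrating over [s >= M] gives the
   bound, uniformly in [M > 0]. *)

(** The integrations by parts precede van der Corput's lemma because they divide only by
    [c' e - b' z], where [t], [x] and [s] do not occur: the amplitudes they produce are fixed smooth
    functions supported where [m] is, and every constant is uniform in [t], [x] and [s]. Van der
    Corput's lemma then sees an amplitude only through the integral of its [z]-derivative.

    With [sigma = s / t], the second derivative of the phase is [t] times that of [psi]. The
    assumption on [psi] covers only the support of the symbol, whereas van der Corput's lemma runs
    over a whole interval in [z]; so it serves only to compare the signs of [a''] and [b''], and the
    lower bound itself comes from (H).

    Fourier inversion enters because each multiplier acts through the transform of a function of
    [x], while its argument is known as an integral over frequencies. It is applied to [T_m(v, w)]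
    at each time and to the integrated [F]. As [m] has compact support, it suffices to invert
    compactly supported functions with three continuous derivatives. *)

(** * Continuity of real functions on a uniform space *)

Section RealContinuity.
Context {T : UniformSpace}.
Implicit Types (f g : T -> R) (p : T).

Lemma cont_const (k : R) p : continuous (fun _ : T => k) p.
Proof. apply continuous_const. Qed.

Lemma cont_plus f g p :
  continuous f p -> continuous g p -> continuous (fun q => f q + g q) p.
Proof. apply (continuous_plus (V := R_NormedModule)). Qed.

Lemma cont_opp f p : continuous f p -> continuous (fun q => - f q) p.
Proof. apply (continuous_opp (V := R_NormedModule)). Qed.

Lemma cont_minus f g p :
  continuous f p -> continuous g p -> continuous (fun q => f q - g q) p.
Proof. apply (continuous_minus (V := R_NormedModule)). Qed.

Lemma cont_mult f g p :
  continuous f p -> continuous g p -> continuous (fun q => f q * g q) p.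
Proof. apply (continuous_mult (K := R_AbsRing)). Qed.

Lemma cont_comp f (h : R -> R) p :
  continuous f p -> continuous h (f p) -> continuous (fun q => h (f q)) p.
Proof. apply continuous_comp. Qed.

Lemma cont_cos f p : continuous f p -> continuous (fun q => cos (f q)) p.
Proof. intros H; apply cont_comp; [exact H | apply continuous_cos]. Qed.

Lemma cont_sin f p : continuous f p -> continuous (fun q => sin (f q)) p.
Proof. intros H; apply cont_comp; [exact H | apply continuous_sin]. Qed.

Lemma cont_exp f p : continuous f p -> continuous (fun q => exp (f q)) p.
Proof. intros H; apply cont_comp; [exact H | apply continuous_exp]. Qed.

Lemma cont_inv f p : continuous f p -> f p <> 0 -> continuous (fun q => / f q) p.
Proof. intros H H0; apply cont_comp; [exact H | now apply continuous_Rinv]. Qed.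

Lemma cont_pow f (n : nat) p : continuous f p -> continuous (fun q => f q ^ n) p.
Proof.
  intros H; induction n as [|n IH]; simpl.
  - apply cont_const.
  - now apply cont_mult.
Qed.

End RealContinuity.

Lemma cont_fst {T U : UniformSpace} (f : T -> R) (p : T * U) :
  continuous f (fst p) -> continuous (fun q : T * U => f (fst q)) p.
Proof. intros H; apply continuous_comp; [apply continuous_fst | exact H]. Qed.

Lemma cont_snd {T U : UniformSpace} (f : U -> R) (p : T * U) :
  continuous f (snd p) -> continuous (fun q : T * U => f (snd q)) p.
Proof. intros H; apply continuous_comp; [apply continuous_snd | exact H]. Qed.

Lemma continuous_pair {T U V : UniformSpace} (f : T -> U) (g : T -> V) (p : T) :
  continuous f p -> continuous g p -> continuous (fun q => (f q, g q)) p.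
Proof.
  intros Hf Hg.
  apply (continuous_comp_2 f g (fun u v => (u, v))); auto.
  apply (continuous_ext (fun z : U * V => z)).
  - now intros [u v].
  - apply continuous_id.
Qed.

Lemma continuous_continuity_2d (f : R -> R -> R) (x y : R) :
  continuous (fun p : R * R => f (fst p) (snd p)) (x, y) -> continuity_2d_pt f x y.
Proof. intros H; apply continuity_2d_pt_filterlim; exact H. Qed.

(** The cases such as [Rmult ?x] serve goals that have been eta-contracted, where no [fun] is left
    to match. *)
Ltac cont_step :=
  match goal with
  | |- forall _, _ => intro
  | H : forall p, continuous ?f p |- continuous ?f _ => apply H
  | H : continuous ?f ?p |- continuous ?f ?p => exact H
  | |- continuous (fun _ => ?k) _ => apply cont_const
  | |- continuous (fun _ => _ + _) _ => apply cont_plus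
  | |- continuous (fun _ => _ - _) _ => apply cont_minus
  | |- continuous (fun _ => - _) _ => apply cont_opp
  | |- continuous (fun _ => _ * _) _ => apply cont_mult
  | |- continuous (Rmult ?x) _ => apply (cont_mult (fun _ => x) (fun q => q))
  | |- continuous (Rplus ?x) _ => apply (cont_plus (fun _ => x) (fun q => q))
  | |- continuous (Rminus ?x) _ => apply (cont_minus (fun _ => x) (fun q => q))
  | |- continuous (fun _ => _ ^ _) _ => apply cont_pow
  | |- continuous (fun _ => cos _) _ => apply cont_cos
  | |- continuous (fun _ => sin _) _ => apply cont_sin
  | |- continuous (fun _ => exp _) _ => apply cont_exp
  | |- continuous (fun q => (_, _)) _ => apply continuous_pair
  | |- continuous (fun q => q) _ => apply continuous_id
  | |- continuous fst _ => apply continuous_fst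
  | |- continuous snd _ => apply continuous_snd
  | |- continuous (fun q => fst q) _ => apply continuous_fst
  | |- continuous (fun q => snd q) _ => apply continuous_snd
  | |- continuous (fun q => fst (fst q)) _ =>
      apply (continuous_comp fst fst); [apply continuous_fst | apply continuous_fst]
  | |- continuous (fun q => snd (fst q)) _ =>
      apply (continuous_comp fst snd); [apply continuous_fst | apply continuous_snd]
  | H : forall p, continuous ?f p |- continuous (fun q => ?f (@?g q)) _ =>
      apply (continuous_comp g f); [ | apply H]
  end.
Ltac cont := repeat cont_step.

(** * Parameter integrals of real functions *)

(** Each [y] has a radius on which [F] stays within [eps / 2] of [F (p0, y)]. Compactness gives one
    [d] such that every [y] lies in the ball of a centre [t] whose radius is at least [d]; both
    values in the conclusion are then compared with [F (p0, t)]. *)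
Lemma tube {T : UniformSpace} (F : T * R -> R) (a b : R) (p0 : T) :
  (forall q, continuous F q) ->
  forall eps : posreal,
    locally p0 (fun p => forall y, a <= y <= b -> Rabs (F (p, y) - F (p0, y)) < eps).
Proof.
  intros HF eps.
  assert (Hd : forall y, exists d : posreal, forall q,
            ball (p0, y) d q -> Rabs (F q - F (p0, y)) < eps / 2).
  { intros y.
    assert (He : 0 < eps / 2) by (destruct eps; simpl; lra).
    destruct (proj1 (filterlim_locally _ _) (HF (p0, y)) (mkposreal _ He)) as [d Hd].
    exists d; intros q Hq; exact (Hd q Hq). }
  set (dl := fun y => proj1_sig (constructive_indefinite_description _ (Hd y))).
  assert (Hdl : forall y q, ball (p0, y) (dl y) q -> Rabs (F q - F (p0, y)) < eps / 2).
  { intros y; unfold dl.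
    now destruct (constructive_indefinite_description _ (Hd y)). }
  destruct (compactness_value_1d a b dl) as [d Hcd].
  exists d; intros p Hp y Hy.
  (* [compactness_value_1d] delivers the centre [t] only under a double negation. *)
  apply NNPP; intros Hn; apply (Hcd y Hy); intros [t [_ [Ht1 Ht2]]]; apply Hn.
  assert (Hyt : ball t (dl t) y) by exact Ht1.
  assert (H1 := Hdl t (p, y) (conj (ball_le _ _ _ Ht2 _ Hp) Hyt)).
  assert (H2 := Hdl t (p0, y) (conj (ball_center _ _) Hyt)).
  replace (F (p, y) - F (p0, y)) with
    ((F (p, y) - F (p0, t)) - (F (p0, y) - F (p0, t))) by ring.
  eapply Rle_lt_trans; [apply Rabs_triang |]. rewrite Rabs_Ropp.
  rewrite <- (Rplus_half_diag eps). apply Rplus_lt_compat; assumption.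
Qed.

Lemma ex_RInt_cont (f : R -> R) (a b : R) :
  (forall x, continuous f x) -> ex_RInt f a b.
Proof. intros H; apply (ex_RInt_continuous (V := R_CompleteNormedModule)); auto. Qed.

Lemma cont_slice {T U : UniformSpace} {V : UniformSpace} (F : T * U -> V) (p : T) :
  (forall q, continuous F q) -> forall y, continuous (fun y => F (p, y)) y.
Proof.
  intros HF y. apply (continuous_comp (fun y => (p, y)) F); [|apply HF].
  apply continuous_pair; [apply continuous_const | apply continuous_id].
Qed.

Lemma cont_RInt_param {T : UniformSpace} (F : T * R -> R) (a b : R) :
  (forall q, continuous F q) ->
  forall p, continuous (fun p => RInt (fun y => F (p, y)) a b) p.
Proof.
  intros HF.
  assert (Hle : forall a b, a <= b ->
            forall p, continuous (fun p => RInt (fun y => F (p, y)) a b) p).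
  { clear a b; intros a b Hab p0.
    apply filterlim_locally; intros eps.
    (* The [+ 1] keeps the denominator positive when [a = b]. *)
    assert (He : 0 < eps / (b - a + 1)).
    { apply Rdiv_lt_0_compat; [apply eps | lra]. }
    generalize (tube F a b p0 HF (mkposreal _ He)).
    apply filter_imp; intros p Hp; simpl in Hp.
    change (Rabs (RInt (fun y => F (p, y)) a b - RInt (fun y => F (p0, y)) a b) < eps).
    assert (E1 := ex_RInt_cont _ a b (cont_slice F p HF)).
    assert (E2 := ex_RInt_cont _ a b (cont_slice F p0 HF)).
    assert (H := norm_RInt_le_const (V := R_NormedModule)
      (fun y => minus (F (p, y)) (F (p0, y))) a b _ (eps / (b - a + 1)) Hab
      (fun y Hy => Rlt_le _ _ (Hp y Hy))
      (is_RInt_minus _ _ _ _ _ _ (RInt_correct _ _ _ E1) (RInt_correct _ _ _ E2))).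
    change (Rabs (RInt (fun y => F (p, y)) a b - RInt (fun y => F (p0, y)) a b)
              <= (b - a) * (eps / (b - a + 1))) in H.
    eapply Rle_lt_trans; [exact H|].
    apply Rmult_lt_reg_r with (b - a + 1); [lra|].
    field_simplify; [|lra]. destruct eps as [e He']; simpl in *; nra. }
  intros p. destruct (Rle_dec a b) as [Hab|Hab]; [now apply Hle|].
  apply (continuous_ext (fun p => - RInt (fun y => F (p, y)) b a)).
  - intros q. apply (opp_RInt_swap (V := R_CompleteNormedModule)).
    apply ex_RInt_cont, cont_slice, HF.
  - apply cont_opp, Hle; lra.
Qed.

Lemma is_derive_RInt_param_cont (F F' : R -> R -> R) (a b x : R) :
  (forall q, continuous (fun q : R * R => F (fst q) (snd q)) q) ->
  (forall q, continuous (fun q : R * R => F' (fst q) (snd q)) q) ->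
  (forall x y, is_derive (fun x => F x y) x (F' x y)) ->
  is_derive (fun x => RInt (F x) a b) x (RInt (F' x) a b).
Proof.
  intros HF HF' Hd.
  rewrite (RInt_ext (V := R_CompleteNormedModule) (F' x) (fun t => Derive (fun u => F u t) x)).
  2: { intros t _; symmetry; apply is_derive_unique, Hd. }
  apply is_derive_RInt_param.
  - apply filter_forall; intros x0 t _; eexists; apply Hd.
  - intros t _. apply (continuity_2d_pt_ext F').
    + intros; symmetry; apply is_derive_unique, Hd.
    + apply continuous_continuity_2d, HF'.
  - apply filter_forall; intros y; apply ex_RInt_cont.
    apply (cont_slice (fun q : R * R => F (fst q) (snd q)) y HF).
Qed.

Lemma is_derive_RInt_cont (f : R -> R) (a b : R) :
  (forall x, continuous f x) -> is_derive (fun b => RInt f a b) b (f b).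
Proof.
  intros Hf. apply (is_derive_RInt (V := R_NormedModule)) with a; [|apply Hf].
  apply filter_forall; intros x; apply (RInt_correct (V := R_CompleteNormedModule)).
  now apply ex_RInt_cont.
Qed.

Lemma cont_swap {V : UniformSpace} (F : R -> R -> V) :
  (forall q, continuous (fun q : R * R => F (fst q) (snd q)) q) ->
  forall q, continuous (fun q : R * R => F (snd q) (fst q)) q.
Proof.
  intros HF q.
  apply (continuous_comp (fun q : R * R => (snd q, fst q))
           (fun q : R * R => F (fst q) (snd q))); [|apply HF].
  apply continuous_pair; [apply continuous_snd | apply continuous_fst].
Qed.

(* A bound of integration is a parameter like the others after rescaling to [0, 1]. *)
Lemma cont_RInt_bound (F : R -> R -> R) (c : R) :
  (forall q, continuous (fun q : R * R => F (fst q) (snd q)) q) ->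
  forall q, continuous (fun q : R * R => RInt (F (snd q)) c (fst q)) q.
Proof.
  intros HF q.
  apply (continuous_ext (fun q : R * R =>
    RInt (fun y => (fst q - c) * F (snd q) ((fst q - c) * y + c)) 0 1)).
  - intros [T x]; simpl.
    transitivity (RInt (F x) ((T - c) * 0 + c) ((T - c) * 1 + c)); [|f_equal; ring].
    apply (RInt_comp_lin (V := R_CompleteNormedModule)).
    apply ex_RInt_cont, (cont_slice (fun q : R * R => F (fst q) (snd q)) x HF).
  - apply (cont_RInt_param (fun z : (R * R) * R =>
      (fst (fst z) - c) * F (snd (fst z)) ((fst (fst z) - c) * snd z + c))).
    intros z; apply cont_mult; [cont|].
    apply (continuous_comp (fun z : (R * R) * R =>
       (snd (fst z), (fst (fst z) - c) * snd z + c))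
       (fun q : R * R => F (fst q) (snd q))); [cont | apply HF].
Qed.

(** The difference of the two sides, as a function [h] of the upper limit in [y], vanishes at [c]
    and has derivative 0. Both derivatives are the integral of [F x T] over [x]: by differentiation
    under the integral on the left, by the fundamental theorem on the right. *)
Lemma RInt_Fubini (F : R -> R -> R) (a b c d : R) :
  (forall q, continuous (fun q : R * R => F (fst q) (snd q)) q) ->
  RInt (fun x => RInt (F x) c d) a b = RInt (fun y => RInt (fun x => F x y) a b) c d.
Proof.
  intros HF.
  set (h := fun T => RInt (fun x => RInt (F x) c T) a b
                     - RInt (fun y => RInt (fun x => F x y) a b) c T).
  assert (Hd : forall T, is_derive h T 0).
  { intros T. unfold h.
    replace 0 with (RInt (fun x => F x T) a b - RInt (fun x => F x T) a b) by ring.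
    apply (is_derive_minus (V := R_NormedModule)).
    - apply (is_derive_RInt_param_cont (fun T x => RInt (F x) c T) (fun T x => F x T)).
      + now apply cont_RInt_bound.
      + now apply cont_swap.
      + intros u y. apply is_derive_RInt_cont.
        apply (cont_slice (fun q : R * R => F (fst q) (snd q)) y HF).
    - apply (is_derive_RInt_cont (fun y => RInt (fun x => F x y) a b)).
      apply (cont_RInt_param (fun q : R * R => F (snd q) (fst q))).
      now apply cont_swap. }
  assert (H0 : h c = 0).
  { unfold h. rewrite (RInt_point c).
    rewrite (RInt_ext _ (fun _ => 0)).
    2: { intros x _; apply (RInt_point (V := R_CompleteNormedModule)). }
    rewrite RInt_const. unfold zero, scal; simpl; unfold mult; simpl. ring. }
  assert (Hb := bounded_variation h (fun _ => 0) 0 c d).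
  assert (h d = 0).
  { rewrite H0 in Hb. rewrite Rmult_0_l, Rminus_0_r in Hb.
    assert (Rabs (h d) <= 0) by (apply Hb; intros; split; [apply Hd | rewrite Rabs_R0; lra]).
    destruct (Req_dec (h d) 0) as [E|E]; [exact E|].
    apply Rabs_pos_lt in E; lra. }
  unfold h in *. lra.
Qed.

(** * Calculus of complex-valued functions, by components *)

(** Quantifying over all points lets the tactic [ccont] recurse on the shape of the function alone;
    the components reduce complex statements to real ones. *)
Definition Ccont {T : UniformSpace} (h : T -> C) : Prop :=
  (forall p, continuous (fun q => Re (h q)) p) /\
  (forall p, continuous (fun q => Im (h q)) p).

Definition Cder (F : R -> C) (x : R) (l : C) : Prop :=
  is_derive (fun y => Re (F y)) x (Re l) /\ is_derive (fun y => Im (F y)) x (Im l).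

(** [C] is taken as a normed space over [R], the structure used in [IntR] and [Fint], so that the
    integral in [Fint] folds to a [CInt]. *)
Definition CInt (h : R -> C) (a b : R) : C :=
  RInt (V := C_R_CompleteNormedModule) h a b.

Lemma Ceq (z w : C) : Re z = Re w -> Im z = Im w -> z = w.
Proof. destruct z, w; simpl; intros; subst; reflexivity. Qed.

Lemma Ccont_const {T : UniformSpace} (k : C) : Ccont (fun _ : T => k).
Proof. split; intros; apply cont_const. Qed.

Lemma Ccont_plus {T : UniformSpace} (f g : T -> C) :
  Ccont f -> Ccont g -> Ccont (fun q => Cplus (f q) (g q)).
Proof. intros [H1 H2] [H3 H4]; split; intros; simpl; apply cont_plus; auto. Qed.

Lemma Ccont_minus {T : UniformSpace} (f g : T -> C) :
  Ccont f -> Ccont g -> Ccont (fun q => Cminus (f q) (g q)).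
Proof.
  intros [H1 H2] [H3 H4]; split; intros; simpl; apply cont_plus; auto;
  apply cont_opp; auto.
Qed.

Lemma Ccont_mult {T : UniformSpace} (f g : T -> C) :
  Ccont f -> Ccont g -> Ccont (fun q => Cmult (f q) (g q)).
Proof.
  intros [H1 H2] [H3 H4]; split; intros; simpl;
  [apply cont_minus | apply cont_plus]; apply cont_mult; auto.
Qed.

Lemma Ccont_RtoC {T : UniformSpace} (f : T -> R) :
  (forall p, continuous f p) -> Ccont (fun q => RtoC (f q)).
Proof. intros H; split; intros; simpl; [apply H | apply cont_const]. Qed.

Lemma Ccont_expi {T : UniformSpace} (f : T -> R) :
  (forall p, continuous f p) -> Ccont (fun q => expi (f q)).
Proof. intros H; split; intros; simpl; [apply cont_cos | apply cont_sin]; apply H. Qed.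

Lemma Ccont_comp {T U : UniformSpace} (r : T -> U) (h : U -> C) :
  (forall p, continuous r p) -> Ccont h -> Ccont (fun q => h (r q)).
Proof.
  intros Hr [H1 H2]; split; intros p.
  - apply (continuous_comp r (fun q => Re (h q))); auto.
  - apply (continuous_comp r (fun q => Im (h q))); auto.
Qed.

Lemma Ccont_comp_2 (F : R -> R -> C) {T : UniformSpace} (r s : T -> R) :
  Ccont (fun q : R * R => F (fst q) (snd q)) ->
  (forall p, continuous r p) -> (forall p, continuous s p) ->
  Ccont (fun q => F (r q) (s q)).
Proof.
  intros HF Hr Hs.
  apply (Ccont_comp (fun q => (r q, s q)) (fun q : R * R => F (fst q) (snd q)));
  [intros p; apply continuous_pair; auto | exact HF].
Qed.

Lemma Ccont_Cmod {T : UniformSpace} (f : T -> C) (p : T) :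
  Ccont f -> continuous (fun q => Cmod (f q)) p.
Proof.
  intros [H1 H2]. unfold Cmod.
  apply (cont_comp (fun q => (fst (f q)) ^ 2 + (snd (f q)) ^ 2) sqrt).
  - apply cont_plus; apply cont_pow; [apply H1 | apply H2].
  - apply continuous_sqrt.
Qed.

Lemma Ccont_ext {T : UniformSpace} (f g : T -> C) :
  (forall q, f q = g q) -> Ccont f -> Ccont g.
Proof.
  intros E [H1 H2]; split; intros p.
  - apply (continuous_ext (fun q => Re (f q))); [intros; now rewrite E | auto].
  - apply (continuous_ext (fun q => Im (f q))); [intros; now rewrite E | auto].
Qed.

Ltac ccont_step :=
  match goal with
  | H : Ccont ?f |- Ccont ?f => exact H
  | |- Ccont (fun _ => ?k) => apply Ccont_const
  | |- Ccont (fun _ => Cplus _ _) => apply Ccont_plus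
  | |- Ccont (fun _ => Cminus _ _) => apply Ccont_minus
  | |- Ccont (fun _ => Cmult _ _) => apply Ccont_mult
  | |- Ccont (fun _ => RtoC _) => apply Ccont_RtoC
  | |- Ccont RtoC => apply (Ccont_RtoC (fun x : R => x))
  | |- Ccont (fun _ => expi _) => apply Ccont_expi
  | |- Ccont expi => apply (Ccont_expi (fun x : R => x))
  | H : Ccont ?f |- Ccont (fun q => ?f (@?r q)) => apply (Ccont_comp r f)
  | H : Ccont (fun q => ?F (fst q) (snd q)) |- Ccont (fun q => ?F (@?r q) (@?s q)) =>
      apply (Ccont_comp_2 F r s)
  | |- _ => cont_step
  end.
Ltac ccont := repeat ccont_step.

Lemma Cder_const (k : C) (x : R) : Cder (fun _ => k) x 0%C.
Proof. split; simpl; apply (is_derive_const (V := R_NormedModule)). Qed.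

Lemma Cder_plus F G x l m :
  Cder F x l -> Cder G x m -> Cder (fun y => Cplus (F y) (G y)) x (Cplus l m).
Proof.
  intros [H1 H2] [H3 H4]; split; simpl;
  apply (is_derive_plus (V := R_NormedModule)); auto.
Qed.

Lemma Cder_minus F G x l m :
  Cder F x l -> Cder G x m -> Cder (fun y => Cminus (F y) (G y)) x (Cminus l m).
Proof.
  intros [H1 H2] [H3 H4]; split; simpl;
  apply (is_derive_minus (V := R_NormedModule)); auto.
Qed.

Lemma is_derive_Rmult (f g : R -> R) (x l m : R) :
  is_derive f x l -> is_derive g x m ->
  is_derive (fun y => f y * g y) x (l * g x + f x * m).
Proof. intros H1 H2; apply (is_derive_mult f g x l m H1 H2). intros; apply Rmult_comm. Qed.

Lemma Cder_mult F G x l m :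
  Cder F x l -> Cder G x m ->
  Cder (fun y => Cmult (F y) (G y)) x (Cplus (Cmult l (G x)) (Cmult (F x) m)).
Proof.
  intros [H1 H2] [H3 H4]; split; simpl.
  - replace (_ + _) with
      ((Re l * Re (G x) + Re (F x) * Re m) - (Im l * Im (G x) + Im (F x) * Im m))
      by (unfold Re, Im; ring).
    apply (is_derive_minus (V := R_NormedModule)); apply is_derive_Rmult; auto.
  - replace (_ + _) with
      ((Re l * Im (G x) + Re (F x) * Im m) + (Im l * Re (G x) + Im (F x) * Re m))
      by (unfold Re, Im; ring).
    apply (is_derive_plus (V := R_NormedModule)); apply is_derive_Rmult; auto.
Qed.

Lemma Cder_RtoC f x l : is_derive f x l -> Cder (fun y => RtoC (f y)) x (RtoC l).
Proof.
  intros H; split; simpl; [exact H | apply (is_derive_const (V := R_NormedModule))].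
Qed.

Lemma Cder_expi f x l :
  is_derive f x l -> Cder (fun y => expi (f y)) x (Cmult (Cmult Ci (RtoC l)) (expi (f x))).
Proof.
  intros H; split; simpl.
  - replace (_ - _) with (l * - sin (f x)) by ring.
    apply (is_derive_comp cos f x); [apply is_derive_cos | exact H].
  - replace (_ + _) with (l * cos (f x)) by ring.
    apply (is_derive_comp sin f x); [apply is_derive_sin | exact H].
Qed.

Lemma Cder_eq F x l m : l = m -> Cder F x l -> Cder F x m.
Proof. now intros <-. Qed.

Lemma Cder_ext F G x l : (forall y, F y = G y) -> Cder F x l -> Cder G x l.
Proof.
  intros E [H1 H2]; split.
  - apply (is_derive_ext (fun y => Re (F y))); [intros; now rewrite E | auto].
  - apply (is_derive_ext (fun y => Im (F y))); [intros; now rewrite E | auto].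
Qed.

Lemma Cder_comp F (f : R -> R) x l m :
  Cder F (f x) l -> is_derive f x m -> Cder (fun y => F (f y)) x (Cmult (RtoC m) l).
Proof.
  intros [H1 H2] H; split; simpl.
  - replace (_ - _) with (m * Re l) by (unfold Re; ring).
    apply (is_derive_comp (fun y => Re (F y)) f x); auto.
  - replace (_ + _) with (m * Im l) by (unfold Im; ring).
    apply (is_derive_comp (fun y => Im (F y)) f x); auto.
Qed.

Lemma Cder_cont F F' : (forall x, Cder F x (F' x)) -> Ccont F.
Proof.
  intros H; split; intros x; destruct (H x) as [H1 H2].
  - apply (ex_derive_continuous (V := R_NormedModule)); now exists (Re (F' x)).
  - apply (ex_derive_continuous (V := R_NormedModule)); now exists (Im (F' x)).
Qed.

Lemma is_RInt_C (h : R -> C) (a b : R) (l : C) :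
  is_RInt (fun x => Re (h x)) a b (Re l) -> is_RInt (fun x => Im (h x)) a b (Im l) ->
  is_RInt (V := C_R_NormedModule) h a b l.
Proof.
  intros H1 H2. rewrite (surjective_pairing l).
  apply (is_RInt_fct_extend_pair (U := R_NormedModule) (V := R_NormedModule) h a b _ _ H1 H2).
Qed.

Lemma is_CInt h a b : Ccont h -> is_RInt (V := C_R_NormedModule) h a b (CInt h a b).
Proof.
  intros [H1 H2]. apply (RInt_correct (V := C_R_CompleteNormedModule)).
  exists (RInt (fun x => Re (h x)) a b, RInt (fun x => Im (h x)) a b).
  apply is_RInt_C; simpl; apply (RInt_correct (V := R_CompleteNormedModule));
  now apply ex_RInt_cont.
Qed.

Lemma CInt_unique h a b l : is_RInt (V := C_R_NormedModule) h a b l -> CInt h a b = l.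
Proof. apply (is_RInt_unique (V := C_R_CompleteNormedModule)). Qed.

Lemma CInt_pair h a b :
  Ccont h -> CInt h a b = (RInt (fun x => Re (h x)) a b, RInt (fun x => Im (h x)) a b).
Proof.
  intros [H1 H2]. apply CInt_unique.
  apply is_RInt_C; simpl; apply (RInt_correct (V := R_CompleteNormedModule));
  now apply ex_RInt_cont.
Qed.

Lemma CInt_ext h k a b : (forall x, h x = k x) -> CInt h a b = CInt k a b.
Proof. intros E; apply (RInt_ext (V := C_R_CompleteNormedModule)); auto. Qed.

Lemma CInt_ext_in h k a b :
  a <= b -> (forall x, a <= x <= b -> h x = k x) -> CInt h a b = CInt k a b.
Proof.
  intros Hab E; apply (RInt_ext (V := C_R_CompleteNormedModule)).
  intros x Hx; rewrite Rmin_left, Rmax_right in Hx; auto; apply E; lra.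
Qed.

Lemma CInt_FTC F f a b :
  (forall x, Cder F x (f x)) -> Ccont f -> CInt f a b = Cminus (F b) (F a).
Proof.
  intros Hd [H1 H2]. apply CInt_unique.
  apply is_RInt_C; simpl.
  - apply (is_RInt_derive (V := R_CompleteNormedModule) (fun x => Re (F x)));
    intros; [apply Hd | apply H1].
  - apply (is_RInt_derive (V := R_CompleteNormedModule) (fun x => Im (F x)));
    intros; [apply Hd | apply H2].
Qed.

Lemma CInt_plus h k a b :
  Ccont h -> Ccont k ->
  CInt (fun x => Cplus (h x) (k x)) a b = Cplus (CInt h a b) (CInt k a b).
Proof.
  intros Hh Hk. apply CInt_unique.
  apply (is_RInt_plus (V := C_R_NormedModule)); now apply is_CInt.
Qed.

Lemma CInt_minus h k a b :
  Ccont h -> Ccont k ->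
  CInt (fun x => Cminus (h x) (k x)) a b = Cminus (CInt h a b) (CInt k a b).
Proof.
  intros Hh Hk. apply CInt_unique.
  apply (is_RInt_minus (V := C_R_NormedModule)); now apply is_CInt.
Qed.

Lemma CInt_mult_l z h a b :
  Ccont h -> CInt (fun x => Cmult z (h x)) a b = Cmult z (CInt h a b).
Proof.
  intros Hh. rewrite CInt_pair by ccont. rewrite (CInt_pair h) by exact Hh.
  destruct Hh as [H1 H2]. destruct z as [u v]. apply Ceq; simpl.
  - apply (is_RInt_unique (V := R_CompleteNormedModule)).
    apply (is_RInt_minus (V := R_NormedModule));
    apply (is_RInt_scal (V := R_NormedModule));
    apply (RInt_correct (V := R_CompleteNormedModule)); now apply ex_RInt_cont.
  - apply (is_RInt_unique (V := R_CompleteNormedModule)).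
    apply (is_RInt_plus (V := R_NormedModule));
    apply (is_RInt_scal (V := R_NormedModule));
    apply (RInt_correct (V := R_CompleteNormedModule)); now apply ex_RInt_cont.
Qed.

Lemma CInt_zero a b : CInt (fun _ => 0%C) a b = 0%C.
Proof.
  rewrite (CInt_FTC (fun _ => 0%C)); [apply Ceq; simpl; ring | | ccont].
  intros; apply Cder_const.
Qed.

Lemma CInt_Chasles h a b c :
  Ccont h -> Cplus (CInt h a b) (CInt h b c) = CInt h a c.
Proof.
  intros H. apply (RInt_Chasles (V := C_R_CompleteNormedModule)); eexists; now apply is_CInt.
Qed.

Lemma CInt_point h a : CInt h a a = 0%C.
Proof. apply (RInt_point (V := C_R_CompleteNormedModule)). Qed.

Lemma CInt_bound h g a b :
  a <= b -> Ccont h -> (forall x, continuous g x) ->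
  (forall x, a <= x <= b -> Cmod (h x) <= g x) -> Cmod (CInt h a b) <= RInt g a b.
Proof.
  intros Hab Hh Hg Hle. rewrite Cmod_norm.
  apply (norm_RInt_le (V := C_R_NormedModule) h g a b); auto.
  - intros x Hx. rewrite <- Cmod_norm. auto.
  - now apply is_CInt.
  - apply (RInt_correct (V := R_CompleteNormedModule)); now apply ex_RInt_cont.
Qed.

Lemma CInt_bound_const h M a b :
  a <= b -> Ccont h -> (forall x, a <= x <= b -> Cmod (h x) <= M) ->
  Cmod (CInt h a b) <= (b - a) * M.
Proof.
  intros Hab Hh Hle.
  eapply Rle_trans; [apply (CInt_bound h (fun _ => M)); auto; cont|].
  rewrite RInt_const. unfold scal; simpl; unfold mult; simpl. lra.
Qed.

Lemma CInt_comp_lin h u v a b :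
  Ccont h ->
  CInt (fun y => Cmult (RtoC u) (h (u * y + v))) a b = CInt h (u * a + v) (u * b + v).
Proof.
  intros H. apply CInt_unique.
  apply (is_RInt_ext (V := C_R_NormedModule)
    (fun y => scal (V := C_R_NormedModule) u (h (u * y + v)))).
  - intros x _. apply scal_R_Cmult.
  - apply (is_RInt_comp_lin (V := C_R_NormedModule)). now apply is_CInt.
Qed.

Lemma CInt_shift h v a b :
  Ccont h -> CInt (fun y => h (y + v)) a b = CInt h (a + v) (b + v).
Proof.
  intros H. replace (a + v) with (1 * a + v) by ring. replace (b + v) with (1 * b + v) by ring.
  rewrite <- CInt_comp_lin by exact H. apply CInt_ext; intros x.
  rewrite Cmult_1_l. f_equal; ring.
Qed.

Lemma Ccont_CInt_param {T : UniformSpace} (F : T * R -> C) a b :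
  Ccont F -> Ccont (fun p => CInt (fun y => F (p, y)) a b).
Proof.
  intros [H1 H2].
  apply (Ccont_ext (fun p => (RInt (fun y => Re (F (p, y))) a b,
                              RInt (fun y => Im (F (p, y))) a b))).
  - intros p; symmetry; apply CInt_pair.
    split; apply cont_slice with (F := fun q => _ (F q)); assumption.
  - split; intros p; simpl.
    + apply (cont_RInt_param (fun q => Re (F q))); auto.
    + apply (cont_RInt_param (fun q => Im (F q))); auto.
Qed.

Lemma Ccont_slice {T : UniformSpace} (F : T * R -> C) p :
  Ccont F -> Ccont (fun y => F (p, y)).
Proof. intros [H1 H2]; split; apply cont_slice with (F := fun q => _ (F q)); auto. Qed.

Lemma Cder_CInt_param (F F' : R -> R -> C) a b x :
  Ccont (fun q : R * R => F (fst q) (snd q)) ->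
  Ccont (fun q : R * R => F' (fst q) (snd q)) ->
  (forall x y, Cder (fun x => F x y) x (F' x y)) ->
  Cder (fun x => CInt (F x) a b) x (CInt (F' x) a b).
Proof.
  intros HF HF' Hd.
  assert (E : forall x, CInt (F x) a b =
            (RInt (fun y => Re (F x y)) a b, RInt (fun y => Im (F x y)) a b)).
  { intros; apply CInt_pair. apply (Ccont_slice (fun q : R * R => F (fst q) (snd q)) x0 HF). }
  assert (E' : CInt (F' x) a b =
            (RInt (fun y => Re (F' x y)) a b, RInt (fun y => Im (F' x y)) a b)).
  { apply CInt_pair. apply (Ccont_slice (fun q : R * R => F' (fst q) (snd q)) x HF'). }
  rewrite E'. eapply Cder_ext; [intros; symmetry; apply E|].
  split; simpl.
  - apply (is_derive_RInt_param_cont (fun x y => Re (F x y)) (fun x y => Re (F' x y)));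
    [apply HF | apply HF' | intros; apply Hd].
  - apply (is_derive_RInt_param_cont (fun x y => Im (F x y)) (fun x y => Im (F' x y)));
    [apply HF | apply HF' | intros; apply Hd].
Qed.

Lemma CInt_Fubini (F : R -> R -> C) a b c d :
  Ccont (fun q : R * R => F (fst q) (snd q)) ->
  CInt (fun x => CInt (F x) c d) a b = CInt (fun y => CInt (fun x => F x y) a b) c d.
Proof.
  intros HF.
  assert (S1 : forall x, Ccont (F x)).
  { intros x; apply (Ccont_slice (fun q : R * R => F (fst q) (snd q)) x HF). }
  assert (HF2 : Ccont (fun q : R * R => F (snd q) (fst q))) by ccont.
  assert (S2 : forall y, Ccont (fun x => F x y)).
  { intros y; apply (Ccont_slice (fun q : R * R => F (snd q) (fst q)) y HF2). }
  rewrite (CInt_pair (fun x => CInt (F x) c d)),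
          (CInt_pair (fun y => CInt (fun x => F x y) a b)).
  - apply (f_equal2 pair).
    + transitivity (RInt (fun x => RInt (fun y => Re (F x y)) c d) a b).
      { apply (RInt_ext (V := R_CompleteNormedModule)); intros; now rewrite CInt_pair. }
      transitivity (RInt (fun y => RInt (fun x => Re (F x y)) a b) c d).
      { apply (RInt_Fubini (fun x y => Re (F x y))), HF. }
      apply (RInt_ext (V := R_CompleteNormedModule)); intros; now rewrite CInt_pair.
    + transitivity (RInt (fun x => RInt (fun y => Im (F x y)) c d) a b).
      { apply (RInt_ext (V := R_CompleteNormedModule)); intros; now rewrite CInt_pair. }
      transitivity (RInt (fun y => RInt (fun x => Im (F x y)) a b) c d).
      { apply (RInt_Fubini (fun x y => Im (F x y))), HF. }
      apply (RInt_ext (V := R_CompleteNormedModule)); intros; now rewrite CInt_pair.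
  - apply (Ccont_CInt_param (fun q : R * R => F (snd q) (fst q))), HF2.
  - apply (Ccont_CInt_param (fun q : R * R => F (fst q) (snd q))), HF.
Qed.

Lemma Cmod_expi th : Cmod (expi th) = 1.
Proof.
  unfold Cmod, expi; simpl. transitivity (sqrt 1); [f_equal | apply sqrt_1].
  transitivity (Rsqr (sin th) + Rsqr (cos th)); [unfold Rsqr; ring | apply sin2_cos2].
Qed.

Lemma expi_plus a b : expi (a + b) = Cmult (expi a) (expi b).
Proof. apply Ceq; simpl; [rewrite cos_plus | rewrite sin_plus]; ring. Qed.

Lemma expi_0 : expi 0 = 1%C.
Proof. unfold expi; now rewrite cos_0, sin_0. Qed.

Lemma Cmod_Ci : Cmod Ci = 1.
Proof. unfold Cmod, Ci; simpl. transitivity (sqrt 1); [f_equal; ring | apply sqrt_1]. Qed.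

Lemma Cmod_le_Re_Im z : Cmod z <= Rabs (Re z) + Rabs (Im z).
Proof.
  replace z with (Cplus (RtoC (Re z)) (Cmult Ci (RtoC (Im z)))) at 1
    by (apply Ceq; simpl; ring).
  eapply Rle_trans; [apply Cmod_triangle|].
  rewrite Cmod_mult, Cmod_Ci, !Cmod_R; lra.
Qed.

(** A mean value inequality for complex values, where no intermediate point need exist: the
    increment is the integral of the derivative. Asking the bound on the ball around [x] through [y]
    spares the callers a case on the order of [x] and [y]. *)
Lemma Cmod_CInt_increment F f x y M :
  (forall t, Cder F t (f t)) -> Ccont f ->
  (forall t, Rabs (t - x) <= Rabs (y - x) -> Cmod (f t) <= M) ->
  Cmod (Cminus (F y) (F x)) <= M * Rabs (y - x).
Proof.
  intros Hd Hf Hb. destruct (Rle_dec x y) as [Hxy|Hxy].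
  - rewrite <- (CInt_FTC F f) by assumption.
    rewrite (Rabs_pos_eq (y - x)) in * by lra. rewrite Rmult_comm.
    apply CInt_bound_const; auto.
    intros t Ht; apply Hb. rewrite Rabs_pos_eq; lra.
  - replace (Cminus (F y) (F x)) with (Copp (Cminus (F x) (F y))) by ring.
    rewrite Cmod_opp. rewrite <- (CInt_FTC F f) by assumption.
    rewrite (Rabs_left (y - x)) in * by lra. rewrite Rmult_comm.
    replace (- (y - x)) with (x - y) by ring.
    apply CInt_bound_const; auto; [lra|].
    intros t Ht; apply Hb. rewrite Rabs_left1; lra.
Qed.

(** * Improper integrals and the Fourier transform *)

(** The two endpoints recede independently, as in the product filter behind [IntR]; a symmetric
    limit would be weaker. *)
Definition IntR_lim (h : R -> C) (l : C) : Prop :=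
  forall eps, 0 < eps -> exists B, 0 <= B /\
    forall a b, a <= - B -> B <= b -> Cmod (Cminus (CInt h a b) l) < eps.

Lemma Re_le_Cmod z : Rabs (Re z) <= Cmod z.
Proof. eapply Rle_trans; [apply Rmax_l | apply (Rmax_Cmod z)]. Qed.

Lemma Im_le_Cmod z : Rabs (Im z) <= Cmod z.
Proof. eapply Rle_trans; [apply Rmax_r | apply (Rmax_Cmod z)]. Qed.

Lemma IntR_unique h l : Ccont h -> IntR_lim h l -> IntR h = l.
Proof.
  intros Hh Hl. unfold IntR.
  apply (is_RInt_gen_unique (V := C_R_CompleteNormedModule)).
  apply filterlimi_locally; intros eps.
  destruct (Hl eps (cond_pos eps)) as [B [HB0 HB]].
  exists (fun a => a < - B) (fun b => B < b).
  - now exists (- B).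
  - now exists B.
  - intros a b Ha Hb; simpl. exists (CInt h a b); split; [now apply is_CInt|].
    assert (H : Cmod (Cminus (CInt h a b) l) < eps) by (apply HB; lra).
    split.
    + eapply Rle_lt_trans; [apply (Re_le_Cmod (Cminus (CInt h a b) l)) | exact H].
    + eapply Rle_lt_trans; [apply (Im_le_Cmod (Cminus (CInt h a b) l)) | exact H].
Qed.

Lemma CInt_vanish (h : R -> C) a b :
  a <= b -> (forall x, a <= x <= b -> h x = 0%C) -> CInt h a b = 0%C.
Proof.
  intros Hab H. rewrite <- (CInt_zero a b). exact (CInt_ext_in h (fun _ => 0%C) a b Hab H).
Qed.

Lemma CInt_support (h : R -> C) B a b a' b' :
  Ccont h -> (forall x, B <= Rabs x -> h x = 0%C) ->
  a <= - B -> B <= b -> a' <= - B -> B <= b' -> CInt h a b = CInt h a' b'.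
Proof.
  intros Hh H0 Ha Hb Ha' Hb'.
  assert (Z1 : forall u v, u <= v -> v <= - B -> CInt h u v = 0%C).
  { intros u v Huv Hv; apply CInt_vanish; auto; intros x Hx; apply H0.
    destruct (Rle_dec 0 x); [rewrite Rabs_pos_eq | rewrite Rabs_left1]; lra. }
  assert (Z2 : forall u v, u <= v -> B <= u -> CInt h u v = 0%C).
  { intros u v Huv Hv; apply CInt_vanish; auto; intros x Hx; apply H0.
    destruct (Rle_dec 0 x); [rewrite Rabs_pos_eq | rewrite Rabs_left1]; lra. }
  rewrite <- (CInt_Chasles h a a' b) by exact Hh.
  rewrite <- (CInt_Chasles h a' b' b) by exact Hh.
  assert (E1 : CInt h a a' = 0%C).
  { destruct (Rle_dec a a') as [H|H]; [now apply Z1|].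
    assert (E := CInt_Chasles h a a' a Hh). rewrite (Z1 a' a), CInt_point in E by lra.
    rewrite <- E; ring. }
  assert (E2 : CInt h b' b = 0%C).
  { destruct (Rle_dec b' b) as [H|H]; [now apply Z2|].
    assert (E := CInt_Chasles h b b' b Hh). rewrite (Z2 b b'), CInt_point in E by lra.
    rewrite <- E; ring. }
  rewrite E1, E2; ring.
Qed.

Lemma IntR_compact (h : R -> C) B :
  0 <= B -> Ccont h -> (forall x, B <= Rabs x -> h x = 0%C) -> IntR h = CInt h (- B) B.
Proof.
  intros HB Hh H0. apply IntR_unique; [exact Hh|].
  intros eps Heps; exists B; split; [exact HB|]; intros a b Ha Hb.
  rewrite (CInt_support h B a b (- B) B); auto; try lra.
  replace (Cminus _ _) with (RtoC 0) by ring. now rewrite Cmod_0.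
Qed.

(** * Tails of integrals dominated by [1 / (1 + x^2)] *)

Lemma is_derive_atan_pow x : is_derive atan x (/ (1 + x ^ 2)).
Proof. apply is_derive_Reals, derivable_pt_lim_atan. Qed.

Lemma one_sqr_pos x : 0 < 1 + x ^ 2.
Proof. generalize (pow2_ge_0 x); lra. Qed.

Lemma cont_inv_1_sqr x : continuous (fun x => / (1 + x ^ 2)) x.
Proof. apply cont_inv; [cont | generalize (one_sqr_pos x); lra]. Qed.

Lemma RInt_inv_1_sqr M a b :
  RInt (fun x => M * / (1 + x ^ 2)) a b = M * (atan b - atan a).
Proof.
  apply is_RInt_unique.
  apply (is_RInt_scal (V := R_NormedModule)).
  apply (is_RInt_derive (V := R_CompleteNormedModule)).
  - intros; apply is_derive_atan_pow.
  - intros; apply cont_inv_1_sqr.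
Qed.

Lemma CInt_decay_bound h M a b :
  a <= b -> Ccont h -> (forall x, Cmod (h x) <= M * / (1 + x ^ 2)) ->
  Cmod (CInt h a b) <= M * (atan b - atan a).
Proof.
  intros Hab Hh Hb. rewrite <- RInt_inv_1_sqr. apply CInt_bound; auto.
  intros; apply cont_mult; [cont | apply cont_inv_1_sqr].
Qed.

Lemma atan_le y : 0 <= y -> atan y <= y.
Proof.
  intros Hy.
  assert (H := bounded_variation atan (fun t => / (1 + t ^ 2)) 1 0 y).
  rewrite atan_0, !Rminus_0_r, (Rabs_pos_eq y) in H by exact Hy.
  eapply Rle_trans; [apply Rle_abs|]. rewrite <- (Rmult_1_l y) at 2. apply H.
  intros t _; split; [apply is_derive_atan_pow|].
  rewrite Rabs_pos_eq; [|left; apply Rinv_0_lt_compat, one_sqr_pos].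
  rewrite <- Rinv_1. apply Rinv_le_contravar; [lra|]. generalize (pow2_ge_0 t); lra.
Qed.

(** From [atan b = PI / 2 - atan (/ b)] and [atan y <= y]: the mass of [1 / (1 + x^2)] beyond [B] is
    at most [/ B]. *)
Lemma atan_tail B b : 0 < B -> B <= b -> PI / 2 - / B <= atan b.
Proof.
  intros HB Hb. assert (H := atan_inv b ltac:(lra)).
  assert (0 < / b) by (apply Rinv_0_lt_compat; lra).
  assert (/ b <= / B) by (apply Rinv_le_contravar; lra).
  generalize (atan_le (/ b)); lra.
Qed.

Lemma atan_tail_neg B a : 0 < B -> a <= - B -> atan a <= - PI / 2 + / B.
Proof.
  intros HB Ha. generalize (atan_tail B (- a) HB ltac:(lra)). rewrite atan_opp. lra.
Qed.

Lemma IntR_lim_bound h l M :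
  0 <= M -> (forall a b, a <= b -> Cmod (CInt h a b) <= M) -> IntR_lim h l -> Cmod l <= M.
Proof.
  intros HM Hb Hl. apply le_epsilon; intros eps Heps.
  destruct (Hl eps Heps) as [B [HB0 HB]].
  specialize (HB (- B) B ltac:(lra) ltac:(lra)).
  specialize (Hb (- B) B ltac:(lra)).
  replace l with (Cminus (CInt h (- B) B) (Cminus (CInt h (- B) B) l)) by ring.
  eapply Rle_trans; [apply Cmod_triangle|]. rewrite Cmod_opp. lra.
Qed.

(** Cauchy's criterion: once both endpoints are beyond [B], moving them changes the integral by two
    pieces of tail, each at most [M / B]. The constant [PI] is the mass of [1 / (1 + x^2)] on the
    line. *)
Lemma IntR_lim_exists h M :
  Ccont h -> (forall x, Cmod (h x) <= M * / (1 + x ^ 2)) ->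
  IntR_lim h (IntR h) /\ Cmod (IntR h) <= M * PI.
Proof.
  intros Hh Hb.
  assert (HM : 0 <= M).
  { generalize (Hb 0) (Cmod_ge_0 (h 0)). replace (1 + 0 ^ 2) with 1 by ring.
    rewrite Rinv_1. lra. }
  set (F := filter_prod (Rbar_locally m_infty) (Rbar_locally p_infty)).
  assert (Hc : exists l : C_R_CompleteNormedModule,
             filterlim (fun ab : R * R => CInt h (fst ab) (snd ab)) F (locally l)).
  { apply (filterlim_locally_cauchy (U := C_R_CompleteNormedModule)). intros eps.
    (* Chosen so that [4 * (M + 1) < B * eps], hence two tails of size [M / B] stay below [eps]. *)
    set (B := 4 * (M + 1) / eps + 1).
    assert (HB : 1 <= B).
    { unfold B. assert (0 <= 4 * (M + 1) / eps); [|lra].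
      apply Rmult_le_pos; [lra | left; apply Rinv_0_lt_compat, eps]. }
    assert (HMB : M * (/ B + / B) < eps).
    { assert (Hx : 4 * (M + 1) < B * eps).
      { unfold B. destruct eps as [e He]; simpl.
        replace ((4 * (M + 1) / e + 1) * e) with (4 * (M + 1) + e) by (field; lra). lra. }
      apply Rmult_lt_reg_l with B; [lra|].
      replace (B * (M * (/ B + / B))) with (2 * M) by (field; lra). lra. }
    exists (fun ab => fst ab < - B /\ B < snd ab); split.
    - exists (fun a => a < - B) (fun b => B < b);
      [now exists (- B) | now exists B | now intros].
    - intros [a b] [a' b'] [Ha Hb'] [Ha' Hb'']; simpl in *.
      assert (K : Cmod (Cminus (CInt h a' b') (CInt h a b)) < eps).
      { replace (Cminus (CInt h a' b') (CInt h a b)) with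
          (Cplus (CInt h a' a) (CInt h b b')).
        2: { rewrite <- (CInt_Chasles h a' a b') by exact Hh.
             rewrite <- (CInt_Chasles h a b b') by exact Hh. ring. }
        assert (G : forall u v, (u <= - B /\ v <= - B) \/ (B <= u /\ B <= v) ->
                  Cmod (CInt h u v) <= M * / B).
        { assert (G1 : forall u v, u <= v -> (u <= - B /\ v <= - B) \/ (B <= u /\ B <= v) ->
                  Cmod (CInt h u v) <= M * / B).
          { intros u v Huv Hor. eapply Rle_trans; [now apply CInt_decay_bound|].
            apply Rmult_le_compat_l; [exact HM|].
            destruct Hor as [[H1 H2]|[H1 H2]].
            - generalize (atan_tail_neg B v ltac:(lra) H2) (atan_bound u); lra.
            - generalize (atan_tail B u ltac:(lra) H1) (atan_bound v); lra. }
          intros u v Hor. destruct (Rle_dec u v) as [Huv|Huv]; [now apply G1|].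
          replace (CInt h u v) with (Copp (CInt h v u)).
          - rewrite Cmod_opp. apply G1; [lra|]. destruct Hor as [[]|[]]; [left|right]; lra.
          - assert (E := CInt_Chasles h u v u Hh). rewrite CInt_point in E.
            replace (CInt h v u) with (Cminus (Cplus (CInt h u v) (CInt h v u)) (CInt h u v))
              by ring. rewrite E. ring. }
        eapply Rle_lt_trans; [apply Cmod_triangle|].
        eapply Rle_lt_trans; [|exact HMB]. rewrite Rmult_plus_distr_l.
        apply Rplus_le_compat; apply G; lra. }
      split.
      + eapply Rle_lt_trans; [apply (Re_le_Cmod (Cminus (CInt h a' b') (CInt h a b))) | exact K].
      + eapply Rle_lt_trans; [apply (Im_le_Cmod (Cminus (CInt h a' b') (CInt h a b))) | exact K]. }
  destruct Hc as [l Hl].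
  assert (HL : IntR_lim h l).
  (* Neighbourhoods of [l] are componentwise: [eps / 2] for each component bounds the modulus by
     [eps]. *)
  { intros eps Heps. assert (He2 : 0 < eps / 2) by lra.
    destruct (proj1 (filterlim_locally _ _) Hl (mkposreal _ He2)) as [Q S HQ HS HQS].
    destruct HQ as [N HN]; destruct HS as [P HP].
    exists (Rabs N + Rabs P + 1). split.
    { generalize (Rabs_pos N) (Rabs_pos P); lra. }
    intros a b Ha Hb'.
    assert (H1 : a < N).
    { generalize (Rle_abs (- N)) (Rabs_pos P); rewrite Rabs_Ropp; lra. }
    assert (H2 : P < b) by (generalize (Rle_abs P) (Rabs_pos N); lra).
    destruct (HQS a b (HN a H1) (HP b H2)) as [B1 B2].
    change (Rabs (Re (Cminus (CInt h a b) l)) < eps / 2) in B1.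
    change (Rabs (Im (Cminus (CInt h a b) l)) < eps / 2) in B2.
    eapply Rle_lt_trans; [apply Cmod_le_Re_Im|]. lra. }
  rewrite (IntR_unique h l Hh HL). split; [exact HL|].
  apply IntR_lim_bound with h; [|intros a b Hab| exact HL].
  - apply Rmult_le_pos; [exact HM | left; apply PI_RGT_0].
  - eapply Rle_trans; [now apply CInt_decay_bound|].
    apply Rmult_le_compat_l; [exact HM|].
    generalize (atan_bound a) (atan_bound b); lra.
Qed.

Lemma IntR_lim_plus h k l m :
  Ccont h -> Ccont k -> IntR_lim h l -> IntR_lim k m ->
  IntR_lim (fun x => Cplus (h x) (k x)) (Cplus l m).
Proof.
  intros Hh Hk Hl Hm eps Heps.
  destruct (Hl (eps / 2) ltac:(lra)) as [B [HB HB']].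
  destruct (Hm (eps / 2) ltac:(lra)) as [D [HD HD']].
  exists (B + D); split; [lra|]; intros a b Ha Hb.
  rewrite CInt_plus by assumption.
  replace (Cminus _ _) with (Cplus (Cminus (CInt h a b) l) (Cminus (CInt k a b) m)) by ring.
  eapply Rle_lt_trans; [apply Cmod_triangle|].
  specialize (HB' a b ltac:(lra) ltac:(lra)). specialize (HD' a b ltac:(lra) ltac:(lra)). lra.
Qed.

Lemma IntR_lim_mult_l z h l :
  Ccont h -> IntR_lim h l -> IntR_lim (fun x => Cmult z (h x)) (Cmult z l).
Proof.
  intros Hh Hl eps Heps. assert (Hz := Cmod_ge_0 z).
  assert (He : 0 < eps / (Cmod z + 1)) by (apply Rdiv_lt_0_compat; lra).
  destruct (Hl _ He) as [B [HB HB']].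
  exists B; split; [lra|]; intros a b Ha Hb.
  rewrite CInt_mult_l by assumption.
  replace (Cminus _ _) with (Cmult z (Cminus (CInt h a b) l)) by ring.
  rewrite Cmod_mult. specialize (HB' a b Ha Hb).
  assert (Hx := Cmod_ge_0 (Cminus (CInt h a b) l)).
  apply Rle_lt_trans with (Cmod z * (eps / (Cmod z + 1))).
  - apply Rmult_le_compat_l; lra.
  - apply Rmult_lt_reg_r with (Cmod z + 1); [lra|]. field_simplify; [|lra]. nra.
Qed.

(** * Smoothness of the Fourier transform *)

(** Smoothness of [FT phi] rests on the moments of [phi], so only decay is asked. The class is
    closed under multiplication by [x], which is what a derivative of [FT phi] does to [phi] up to a
    constant. *)
Definition rapid (phi : R -> C) : Prop :=
  Ccont phi /\ forall j, exists M, forall x, Rabs x ^ j * Cmod (phi x) <= M.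

Lemma rapid_mul_x phi : rapid phi -> rapid (fun x => Cmult (RtoC x) (phi x)).
Proof.
  intros [H1 H2]; split; [ccont|]. intros j. destruct (H2 (S j)) as [M HM].
  exists M; intros x. rewrite Cmod_mult, Cmod_R. specialize (HM x); simpl in HM. lra.
Qed.

Lemma rapid_bound phi : rapid phi -> exists M, forall x, Cmod (phi x) <= M * / (1 + x ^ 2).
Proof.
  intros [_ H]. destruct (H 0%nat) as [M0 H0]; destruct (H 2%nat) as [M2 H2].
  exists (M0 + M2); intros x. specialize (H0 x); specialize (H2 x).
  rewrite pow2_abs in H2. simpl in H0.
  apply Rmult_le_reg_r with (1 + x ^ 2); [apply one_sqr_pos|].
  field_simplify; [lra | generalize (one_sqr_pos x); lra].
Qed.

Lemma FT_lim phi xi :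
  rapid phi -> IntR_lim (fun x => Cmult (expi (- (x * xi))) (phi x)) (FT phi xi).
Proof.
  intros Hr. destruct (rapid_bound phi Hr) as [M HM]. destruct Hr as [Hc _].
  apply (IntR_lim_exists _ M).
  - ccont.
  - intros x. rewrite Cmod_mult, Cmod_expi, Rmult_1_l. apply HM.
Qed.

Lemma expi_taylor1 y : Cmod (Cminus (expi y) 1) <= Rabs y.
Proof.
  rewrite <- expi_0. replace (Rabs y) with (1 * Rabs (y - 0)) by (rewrite Rminus_0_r; ring).
  apply (Cmod_CInt_increment expi (fun t => Cmult (Cmult Ci (RtoC 1)) (expi t))).
  - intros t; apply (Cder_expi (fun y => y)). apply (is_derive_id (K := R_AbsRing)).
  - ccont.
  - intros t _. rewrite !Cmod_mult, Cmod_Ci, Cmod_R, Cmod_expi, Rabs_R1. lra.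
Qed.

(** The function [G] has derivative [i (expi t - 1)], of modulus at most [|y|] when [|t| <= |y|].
    The factor 1/2 of the sharp remainder is given up. *)
Lemma expi_taylor2 y : Cmod (Cminus (Cminus (expi y) 1) (Cmult Ci (RtoC y))) <= y ^ 2.
Proof.
  set (G := fun t => Cminus (expi t) (Cmult Ci (RtoC t))).
  replace (Cminus (Cminus (expi y) 1) (Cmult Ci (RtoC y))) with (Cminus (G y) (G 0)).
  2: { unfold G. rewrite expi_0. ring. }
  replace (y ^ 2) with (Rabs y * Rabs (y - 0))
    by (rewrite Rminus_0_r, <- Rabs_mult; rewrite Rabs_pos_eq; [ring | nra]).
  apply (Cmod_CInt_increment G (fun t => Cmult Ci (Cminus (expi t) 1))).
  - intros t. unfold G.
    eapply Cder_eq; [|apply Cder_minus; [apply (Cder_expi (fun y => y)) | apply Cder_mult]].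
    4: apply (Cder_RtoC (fun y => y)).
    3: apply Cder_const.
    2, 3: apply (is_derive_id (K := R_AbsRing)).
    change (@one R_AbsRing) with 1. cbv beta; ring.
  - ccont.
  - intros t Ht. rewrite Cmod_mult, Cmod_Ci, Rmult_1_l.
    eapply Rle_trans; [apply expi_taylor1|]. rewrite !Rminus_0_r in Ht. exact Ht.
Qed.

Lemma is_derive_quadratic (f : R -> R) x l M :
  (forall h, Rabs (f (x + h) - f x - h * l) <= M * h ^ 2) -> is_derive f x l.
Proof.
  intros H. apply is_derive_Reals. intros eps Heps.
  assert (HM : 0 <= M).
  { specialize (H 1). generalize (Rabs_pos (f (x + 1) - f x - 1 * l)); lra. }
  assert (Hd : 0 < eps / (M + 1)) by (apply Rdiv_lt_0_compat; lra).
  exists (mkposreal _ Hd); intros h Hh Hhd; simpl in Hhd.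
  assert (Hp := Rabs_pos_lt h Hh).
  replace ((f (x + h) - f x) / h - l) with ((f (x + h) - f x - h * l) / h) by (field; auto).
  rewrite Rabs_div by exact Hh.
  apply Rmult_lt_reg_r with (Rabs h); [exact Hp|].
  unfold Rdiv at 1; rewrite Rmult_assoc, Rinv_l, Rmult_1_r by lra.
  eapply Rle_lt_trans; [apply H|]. rewrite <- (pow2_abs h).
  replace (M * Rabs h ^ 2) with ((M * Rabs h) * Rabs h) by ring.
  apply Rmult_lt_compat_r; [exact Hp|].
  apply Rle_lt_trans with (M * (eps / (M + 1))).
  - apply Rmult_le_compat_l; lra.
  - apply Rmult_lt_reg_r with (M + 1); [lra|]. field_simplify; [|lra]. nra.
Qed.

Lemma Cder_quadratic (F : R -> C) x l M :
  (forall h, Cmod (Cminus (Cminus (F (x + h)) (F x)) (Cmult (RtoC h) l)) <= M * h ^ 2) ->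
  Cder F x l.
Proof.
  intros H; split; apply (is_derive_quadratic _ _ _ M); intros h.
  - eapply Rle_trans; [|apply H].
    eapply Rle_trans; [|apply Re_le_Cmod]. apply Req_le; f_equal; unfold Re; simpl; ring.
  - eapply Rle_trans; [|apply H].
    eapply Rle_trans; [|apply Im_le_Cmod]. apply Req_le; f_equal; unfold Re, Im; simpl; ring.
Qed.

(** The second-order Taylor bound on the kernel dominates the integrand of the remainder by
    [h^2 x^2 |phi x|], which is integrable. The remainder of [FT phi] is thus quadratic in [h], and
    no limit has to be exchanged with an integral. *)
Lemma FT_derive phi xi :
  rapid phi ->
  Cder (FT phi) xi (Cmult (Copp Ci) (FT (fun x => Cmult (RtoC x) (phi x)) xi)).
Proof.
  intros Hr. assert (Hr1 := rapid_mul_x _ Hr).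
  destruct (rapid_bound _ (rapid_mul_x _ Hr1)) as [M HM].
  apply (Cder_quadratic _ _ _ (M * PI)); intros h.
  assert (Hc := proj1 Hr).
  (* The integrand of [FT phi (xi + h) - FT phi xi - h l], where [l] is the claimed derivative. *)
  set (k := fun x => Cplus
     (Cplus (Cmult (expi (- (x * (xi + h)))) (phi x))
            (Cmult (Copp 1) (Cmult (expi (- (x * xi))) (phi x))))
     (Cmult (Cmult (RtoC h) Ci) (Cmult (expi (- (x * xi))) (Cmult (RtoC x) (phi x))))).
  assert (Hk : Ccont k) by (unfold k; ccont).
  assert (HL : IntR_lim k (Cplus (Cplus (FT phi (xi + h)) (Cmult (Copp 1) (FT phi xi)))
      (Cmult (Cmult (RtoC h) Ci) (FT (fun x => Cmult (RtoC x) (phi x)) xi)))).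
  { unfold k. apply IntR_lim_plus; [ccont | ccont | |].
    - apply IntR_lim_plus; [ccont | ccont | now apply FT_lim |].
      apply IntR_lim_mult_l; [ccont | now apply FT_lim].
    - apply IntR_lim_mult_l; [ccont |].
      now apply (FT_lim (fun x => Cmult (RtoC x) (phi x))). }
  replace (Cminus _ _) with (IntR k).
  2: { rewrite (IntR_unique _ _ Hk HL). ring. }
  replace (M * PI * h ^ 2) with ((h ^ 2 * M) * PI) by ring.
  apply (IntR_lim_exists k (h ^ 2 * M) Hk).
  intros x. specialize (HM x).
  replace (k x) with (Cmult (Cmult (expi (- (x * xi))) (phi x))
    (Cminus (Cminus (expi (- (x * h))) 1) (Cmult Ci (RtoC (- (x * h)))))).
  2: { unfold k. replace (- (x * (xi + h))) with (- (x * xi) + - (x * h)) by ring.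
       rewrite expi_plus, RtoC_opp, RtoC_mult. ring. }
  rewrite !Cmod_mult, Cmod_expi, Rmult_1_l.
  eapply Rle_trans.
  { apply Rmult_le_compat_l; [apply Cmod_ge_0 | apply expi_taylor2]. }
  rewrite !Cmod_mult, Cmod_R in HM.
  replace (Cmod (phi x) * (- (x * h)) ^ 2) with (h ^ 2 * (Rabs x ^ 2 * Cmod (phi x)))
    by (rewrite pow2_abs; ring).
  rewrite Rmult_assoc. apply Rmult_le_compat_l; [apply pow2_ge_0|]. lra.
Qed.

(** Smoothness is proved by exhibiting all derivatives at once as a sequence; this needs no
    computation with [Derive_n]. *)
Lemma smooth1_seq (g : nat -> R -> R) :
  (forall n x, is_derive (g n) x (g (S n) x)) -> smooth1 (g 0%nat).
Proof.
  intros H.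
  assert (E : forall k x, Derive_n (g 0%nat) k x = g k x).
  { induction k as [|k IH]; intros x; [reflexivity|]. simpl.
    rewrite (Derive_ext _ (g k)) by exact IH. apply is_derive_unique, H. }
  intros [|k] x; simpl; [exact I|].
  apply (ex_derive_ext (g k)); [intros; symmetry; apply E | eexists; apply H].
Qed.

Definition Csmooth (F : R -> C) : Prop :=
  smooth1 (fun x => Re (F x)) /\ smooth1 (fun x => Im (F x)).

Lemma Csmooth_seq (G : nat -> R -> C) :
  (forall n x, Cder (G n) x (G (S n) x)) -> Csmooth (G 0%nat).
Proof.
  intros H; split.
  - apply (smooth1_seq (fun n x => Re (G n x))); intros; apply H.
  - apply (smooth1_seq (fun n x => Im (G n x))); intros; apply H.
Qed.

Lemma Csmooth_FT phi : rapid phi -> Csmooth (FT phi).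
Proof.
  intros Hr.
  (* The [n]-th derivative of [FT phi] is [(- i)^n] times the transform of [x^n phi]; [w n] and
     [ph n] are these two factors. *)
  set (ph := fix ph (n : nat) : R -> C :=
         match n with O => phi | S n => fun x => Cmult (RtoC x) (ph n x) end).
  set (w := fix w (n : nat) : C := match n with O => 1%C | S n => Cmult (Copp Ci) (w n) end).
  assert (Hph : forall n, rapid (ph n)).
  { induction n as [|n IH]; [exact Hr | now apply rapid_mul_x]. }
  assert (HS : Csmooth (fun xi => Cmult (w 0%nat) (FT (ph 0%nat) xi))).
  { apply (Csmooth_seq (fun n xi => Cmult (w n) (FT (ph n) xi))). intros n x.
    eapply Cder_eq; [|apply Cder_mult; [apply Cder_const | now apply FT_derive]].
    simpl. ring. }
  destruct HS as [H1 H2]; split; intros k x.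
  - apply (ex_derive_n_ext (fun xi => Re (Cmult (w 0%nat) (FT (ph 0%nat) xi)))); [|apply H1].
    intros t; simpl; unfold Re; ring.
  - apply (ex_derive_n_ext (fun xi => Im (Cmult (w 0%nat) (FT (ph 0%nat) xi)))); [|apply H2].
    intros t; simpl; unfold Im; ring.
Qed.

Lemma smooth1_cont h : smooth1 h -> forall x, continuous h x.
Proof.
  intros H x. apply (ex_derive_continuous (V := R_NormedModule)). exact (H 1%nat x).
Qed.

Lemma schwartz_rapid f : schwartz f -> rapid f.
Proof.
  intros [[S1 B1] [S2 B2]]; split.
  - split; now apply smooth1_cont.
  - intros j. destruct (B1 j 0%nat) as [M1 H1]; destruct (B2 j 0%nat) as [M2 H2].
    exists (M1 + M2); intros x. specialize (H1 x); specialize (H2 x); simpl in H1, H2.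
    assert (Hp : 0 <= Rabs x ^ j) by (apply pow_le, Rabs_pos).
    eapply Rle_trans; [apply Rmult_le_compat_l; [exact Hp | apply Cmod_le_Re_Im]|]. lra.
Qed.

(** * Fourier inversion for compactly supported functions *)

Lemma Cder_unique F x l m : Cder F x l -> Cder F x m -> l = m.
Proof.
  intros [H1 H2] [H3 H4]; apply Ceq.
  - rewrite <- (is_derive_unique _ _ _ H1); now apply is_derive_unique.
  - rewrite <- (is_derive_unique _ _ _ H2); now apply is_derive_unique.
Qed.

Lemma locally_Rabs_gt L x : L < Rabs x -> locally x (fun y => L < Rabs y).
Proof.
  intros H. assert (Hd : 0 < Rabs x - L) by lra.
  exists (mkposreal _ Hd).
  assert (Q : forall y : R, Rabs (y - x) < Rabs x - L -> L < Rabs y); [|exact Q].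
  intros y Hy. generalize (Rabs_triang_inv x (x - y)).
  replace (x - (x - y)) with y by ring. rewrite (Rabs_minus_sym x y). lra.
Qed.

Lemma Cder_vanish (F F' : R -> C) L :
  (forall x, Cder F x (F' x)) -> (forall x, L < Rabs x -> F x = 0%C) ->
  forall x, L < Rabs x -> F' x = 0%C.
Proof.
  intros Hd H0 x Hx. apply (Cder_unique F x); [apply Hd|].
  assert (Hl := locally_Rabs_gt L x Hx).
  split; simpl.
  - apply (is_derive_ext_loc (fun _ => 0)); [|apply (is_derive_const (V := R_NormedModule))].
    revert Hl; apply filter_imp; intros y Hy; now rewrite H0.
  - apply (is_derive_ext_loc (fun _ => 0)); [|apply (is_derive_const (V := R_NormedModule))].
    revert Hl; apply filter_imp; intros y Hy; now rewrite H0.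
Qed.

Lemma RInt_ge_0_cont g a b :
  a <= b -> (forall x, continuous g x) -> (forall x, 0 <= g x) -> 0 <= RInt g a b.
Proof. intros; apply RInt_ge_0; auto; now apply ex_RInt_cont. Qed.

Lemma Cmod_le_RInt_der (F f : R -> C) a b u :
  (forall x, Cder F x (f x)) -> Ccont f -> F a = 0%C -> a <= u <= b ->
  Cmod (F u) <= RInt (fun x => Cmod (f x)) a b.
Proof.
  intros Hd Hf Ha Hu.
  assert (Hc : forall x, continuous (fun x => Cmod (f x)) x) by (intros; now apply Ccont_Cmod).
  replace (F u) with (CInt f a u) by (rewrite (CInt_FTC F f) by assumption; rewrite Ha; ring).
  eapply Rle_trans; [apply (CInt_bound f (fun x => Cmod (f x))); auto; intros; lra|].
  rewrite <- (RInt_Chasles (V := R_CompleteNormedModule) _ a u b) by now apply ex_RInt_cont.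
  assert (H := RInt_ge_0_cont (fun x => Cmod (f x)) u b ltac:(lra) Hc (fun x => Cmod_ge_0 _)).
  set (g := fun x => Cmod (f x)) in *.
  change (RInt g a u <= RInt g a u + RInt g u b).
  rewrite <- (Rplus_0_r (RInt g a u)) at 1. apply Rplus_le_compat_l, H.
Qed.

Section InversionAtZero.
Variables (K K1 K2 K3 : R -> C) (L : R).
Hypothesis HL : 0 < L.
Hypotheses (D0 : forall x, Cder K x (K1 x)) (D1 : forall x, Cder K1 x (K2 x))
           (D2 : forall x, Cder K2 x (K3 x)) (C3 : Ccont K3).
Hypotheses (Z0 : forall x, L <= Rabs x -> K x = 0%C) (Z1 : forall x, L <= Rabs x -> K1 x = 0%C)
           (Z2 : forall x, L <= Rabs x -> K2 x = 0%C).

Let C2 : Ccont K2. Proof. now apply Cder_cont with K3. Qed.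
Let C1 : Ccont K1. Proof. now apply Cder_cont with K2. Qed.
Let C0 : Ccont K. Proof. now apply Cder_cont with K1. Qed.

(** Up to the sign of [x], the Fourier transform of [G]; inversion at zero says that [osc K] has
    integral [2 PI K(0)]. *)
Let osc (G : R -> C) (x : R) : C := CInt (fun u => Cmult (expi (x * u)) (G u)) (- L) L.

Lemma edge : L <= Rabs L /\ L <= Rabs (- L).
Proof. rewrite Rabs_Ropp, Rabs_pos_eq; lra. Qed.

Lemma osc_ibp G G' x :
  (forall u, Cder G u (G' u)) -> Ccont G' -> (forall u, L <= Rabs u -> G u = 0%C) ->
  Cmult (Cmult Ci (RtoC x)) (osc G x) = Copp (osc G' x).
Proof.
  intros Hd Hc Hz. assert (HG := Cder_cont _ _ Hd).
  assert (E : Cplus (Cmult (Cmult Ci (RtoC x)) (osc G x)) (osc G' x) = 0%C).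
  { unfold osc. rewrite <- CInt_mult_l by ccont. rewrite <- CInt_plus by ccont.
    rewrite (CInt_FTC (fun u => Cmult (expi (x * u)) (G u))).
    - destruct edge. rewrite (Hz L), (Hz (- L)) by assumption. ring.
    - intros u. eapply Cder_eq; [|apply Cder_mult; [apply Cder_expi | apply Hd]].
      2: { auto_derive; [trivial | reflexivity]. }
      cbv beta. rewrite Rmult_1_r. ring.
    - ccont. }
  rewrite <- (Cplus_0_r (Copp _)), <- E. ring.
Qed.

Lemma osc_bound G x : Ccont G -> Cmod (osc G x) <= RInt (fun u => Cmod (G u)) (- L) L.
Proof.
  intros HG. apply CInt_bound; [lra | ccont | |].
  - intros; now apply Ccont_Cmod.
  - intros u _. rewrite Cmod_mult, Cmod_expi. lra.
Qed.

Let A (G : R -> C) : R := RInt (fun u => Cmod (G u)) (- L) L.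

(** One integration by parts pays for the factor [|x|] and two more for [x^2], hence three
    derivatives of [K]. The factor [|x|] is there to absorb the error [1 - exp (- e x) <= e x] of
    the Abel cutoff. *)
Lemma osc_decay x : Rabs x * Cmod (osc K x) <= (A K1 + A K3) * / (1 + x ^ 2).
Proof.
  assert (E1 : Rabs x * Cmod (osc K x) = Cmod (osc K1 x)).
  { rewrite <- (Cmod_opp (osc K1 x)), <- (osc_ibp K K1) by auto.
    rewrite !Cmod_mult, Cmod_Ci, Cmod_R. ring. }
  assert (E2 : Rabs x * Cmod (osc K1 x) = Cmod (osc K2 x)).
  { rewrite <- (Cmod_opp (osc K2 x)), <- (osc_ibp K1 K2) by auto.
    rewrite !Cmod_mult, Cmod_Ci, Cmod_R. ring. }
  assert (E3 : Rabs x * Cmod (osc K2 x) = Cmod (osc K3 x)).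
  { rewrite <- (Cmod_opp (osc K3 x)), <- (osc_ibp K2 K3) by auto.
    rewrite !Cmod_mult, Cmod_Ci, Cmod_R. ring. }
  assert (B1 := osc_bound K1 x C1). assert (B3 := osc_bound K3 x C3).
  assert (Hx := one_sqr_pos x).
  apply Rmult_le_reg_r with (1 + x ^ 2); [exact Hx|].
  rewrite (Rmult_assoc (A K1 + A K3)), Rinv_l, Rmult_1_r by lra.
  rewrite E1. rewrite <- E2 in E3. rewrite <- (pow2_abs x).
  replace (Cmod (osc K1 x) * (1 + Rabs x ^ 2)) with
    (Cmod (osc K1 x) + Rabs x * (Rabs x * Cmod (osc K1 x))) by ring.
  rewrite E3. unfold A. lra.
Qed.

Lemma Ccont_osc G : Ccont G -> Ccont (osc G).
Proof.
  intros HG. apply (Ccont_CInt_param (fun q : R * R => Cmult (expi (fst q * snd q)) (G (snd q)))).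
  ccont.
Qed.

(* [W e k u] is [1 / (e - i k u)]. *)
Let W (e k u : R) : C := (e * / (e ^ 2 + u ^ 2), k * u * / (e ^ 2 + u ^ 2)).

Lemma W_den_pos e u : 0 < e -> 0 < e ^ 2 + u ^ 2.
Proof. intros; generalize (pow2_ge_0 u); nra. Qed.

Lemma cont_W_den e u : 0 < e -> continuous (fun u => / (e ^ 2 + u ^ 2)) u.
Proof. intros He; apply cont_inv; [cont | generalize (W_den_pos e u He); lra]. Qed.

Lemma Ccont_W e k : 0 < e -> Ccont (W e k).
Proof.
  intros He; split; intros p; simpl; apply cont_mult; try (now apply cont_W_den); cont.
Qed.

Lemma W_spec e k u : 0 < e -> k ^ 2 = 1 -> Cmult (W e k u) (e, - (k * u)) = 1%C.
Proof.
  intros He Hk. generalize (W_den_pos e u He); intros Hp. apply Ceq; simpl.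
  - replace (_ - _) with ((e ^ 2 + k ^ 2 * u ^ 2) * / (e ^ 2 + u ^ 2)) by (simpl; ring).
    rewrite Hk, Rmult_1_l. simpl in *. field. lra.
  - ring.
Qed.

Lemma Cmod_W e k u : 0 < e -> k ^ 2 = 1 -> Cmod (W e k u) <= / e.
Proof.
  intros He Hk. apply Rmult_le_reg_r with e; [exact He|]. rewrite Rinv_l by lra.
  rewrite <- Cmod_1, <- (W_spec e k u He Hk) at 1. rewrite Cmod_mult.
  apply Rmult_le_compat_l; [apply Cmod_ge_0|].
  eapply Rle_trans; [|apply Re_le_Cmod]. apply Rle_abs.
Qed.

Lemma exp_osc_integral e k u B : 0 < e -> k ^ 2 = 1 ->
  CInt (fun x => Cmult (RtoC (exp (- (e * x)))) (expi (k * x * u))) 0 B =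
  Cmult (W e k u) (Cminus 1 (Cmult (RtoC (exp (- (e * B)))) (expi (k * B * u)))).
Proof.
  intros He Hk.
  rewrite (CInt_FTC (fun x => Cmult (Copp (W e k u))
                       (Cmult (RtoC (exp (- (e * x)))) (expi (k * x * u))))).
  - rewrite !Rmult_0_r, Rmult_0_l, Ropp_0, exp_0, expi_0. ring.
  - intros x.
    eapply Cder_eq; [|apply Cder_mult; [apply Cder_const | apply Cder_mult;
       [apply Cder_RtoC | apply Cder_expi]]].
    2: { auto_derive; [trivial | reflexivity]. }
    2: { auto_derive; [trivial | reflexivity]. }
    cbv beta. assert (S := W_spec e k u He Hk).
    transitivity (Cmult (Cmult (W e k u) (e, - (k * u)))
      (Cmult (RtoC (exp (- (e * x)))) (expi (k * x * u)))); [|rewrite S; ring].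
    replace ((e, - (k * u)) : C) with (Cminus (RtoC e) (Cmult Ci (RtoC (k * u))))
      by (apply Ceq; simpl; ring).
    replace (- (e * 1) * exp (- (e * x))) with ((- e) * exp (- (e * x))) by ring.
    replace (k * 1 * u) with (k * u) by ring.
    rewrite !RtoC_mult, RtoC_opp. ring.
  - ccont.
Qed.

(* Abel summation: with the cutoff [exp (- e x)], the kernel of the inversion integral becomes
   [W e 1 u + W e (-1) u = 2 e / (e^2 + u^2)], whose mass is computed by [atan]. *)
Lemma half_line e k B : 0 < e -> k ^ 2 = 1 -> 0 < B ->
  Cmod (Cminus (CInt (fun x => osc K (k * x)) 0 B)
               (CInt (fun u => Cmult (W e k u) (K u)) (- L) L))
    <= e * (A K1 + A K3) * PI + A K * / (e ^ 2 * B).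
Proof.
  intros He Hk HB.
  assert (Hosc := Ccont_osc K C0). assert (HW := Ccont_W e k He).
  (* [I1] is the error made by the cutoff, [I2] the contribution of the end point [B]. *)
  set (I1 := CInt (fun x => Cmult (RtoC (1 - exp (- (e * x)))) (osc K (k * x))) 0 B).
  set (I2 := CInt (fun u => Cmult (W e k u)
      (Cmult (Cmult (RtoC (exp (- (e * B)))) (expi (k * B * u))) (K u))) (- L) L).
  assert (E : Cminus (CInt (fun x => osc K (k * x)) 0 B)
               (CInt (fun u => Cmult (W e k u) (K u)) (- L) L) = Cminus I1 I2).
  { assert (E1 : CInt (fun x => Cmult (RtoC (exp (- (e * x)))) (osc K (k * x))) 0 B =
        Cminus (CInt (fun u => Cmult (W e k u) (K u)) (- L) L) I2).
    { unfold I2. rewrite <- CInt_minus by ccont.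
      transitivity (CInt (fun x => CInt (fun u =>
         Cmult (RtoC (exp (- (e * x)))) (Cmult (expi (k * x * u)) (K u))) (- L) L) 0 B).
      { apply CInt_ext; intros x. symmetry. unfold osc. apply CInt_mult_l. ccont. }
      rewrite (CInt_Fubini (fun x u =>
         Cmult (RtoC (exp (- (e * x)))) (Cmult (expi (k * x * u)) (K u)))) by ccont.
      apply CInt_ext; intros u.
      transitivity (CInt (fun x => Cmult (K u)
         (Cmult (RtoC (exp (- (e * x)))) (expi (k * x * u)))) 0 B).
      { apply CInt_ext; intros; ring. }
      rewrite CInt_mult_l by ccont. rewrite exp_osc_integral by assumption. ring. }
    assert (E2 : Cplus I1 (CInt (fun x => Cmult (RtoC (exp (- (e * x)))) (osc K (k * x))) 0 B)
               = CInt (fun x => osc K (k * x)) 0 B).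
    { unfold I1. rewrite <- CInt_plus by ccont.
      apply CInt_ext; intros x. rewrite RtoC_minus. ring. }
    rewrite <- E2, E1. ring. }
  rewrite E. eapply Rle_trans; [apply Cmod_triangle|]. rewrite Cmod_opp.
  apply Rplus_le_compat.
  - eapply Rle_trans.
    { apply (CInt_bound _ (fun x => (e * (A K1 + A K3)) * / (1 + x ^ 2))); [lra | ccont | |].
      - intros; apply cont_mult; [cont | apply cont_inv_1_sqr].
      - intros x Hx. rewrite Cmod_mult, Cmod_R.
        assert (Hkx : Rabs (k * x) = x).
        { rewrite Rabs_mult, (Rabs_pos_eq x) by lra.
          assert (Rabs k ^ 2 = 1) by (rewrite pow2_abs; exact Hk).
          assert (Rabs k = 1) by (generalize (Rabs_pos k); nra). nra. }
        assert (Hd := osc_decay (k * x)). rewrite Hkx in Hd.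
        replace ((k * x) ^ 2) with (x ^ 2) in Hd
          by (rewrite Rpow_mult_distr, Hk; ring).
        assert (Hexp : Rabs (1 - exp (- (e * x))) <= e * x).
        { assert (0 <= e * x) by nra.
          generalize (exp_ineq1_le (- (e * x))); intros.
          assert (exp (- (e * x)) <= 1).
          { rewrite exp_Ropp, <- Rinv_1. apply Rinv_le_contravar; [lra|].
            generalize (exp_ineq1_le (e * x)); lra. }
          rewrite Rabs_pos_eq; lra. }
        apply Rle_trans with (e * x * Cmod (osc K (k * x))).
        + apply Rmult_le_compat_r; [apply Cmod_ge_0 | exact Hexp].
        + rewrite !Rmult_assoc. apply Rmult_le_compat_l; [lra | exact Hd]. }
    rewrite RInt_inv_1_sqr, atan_0, Rminus_0_r. apply Rmult_le_compat_l.
    + apply Rmult_le_pos; [lra|]. apply Rplus_le_le_0_compat;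
      apply RInt_ge_0_cont; try lra; intros; try apply Cmod_ge_0; now apply Ccont_Cmod.
    + generalize (atan_bound B) PI_RGT_0; lra.
  - eapply Rle_trans.
    { apply (CInt_bound _ (fun u => / (e ^ 2 * B) * Cmod (K u))); [lra | ccont | |].
      - intros; apply cont_mult; [cont | now apply Ccont_Cmod].
      - intros u _. rewrite !Cmod_mult, Cmod_expi, Cmod_R, Rmult_1_r.
        rewrite <- Rmult_assoc. apply Rmult_le_compat_r; [apply Cmod_ge_0|].
        assert (HeB : 0 < e * B) by nra.
        (* The crude bound [exp (- y) <= / y] suffices, since [B] will be at least [/ e ^ 3]. *)
        assert (Hexp : Rabs (exp (- (e * B))) <= / (e * B)).
        { rewrite Rabs_pos_eq by (left; apply exp_pos). rewrite exp_Ropp.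
          apply Rinv_le_contravar; [exact HeB|].
          generalize (exp_ineq1_le (e * B)); lra. }
        replace (/ (e ^ 2 * B)) with (/ e * / (e * B)) by (field; lra).
        apply Rmult_le_compat; [apply Cmod_ge_0 | apply Rabs_pos | now apply Cmod_W | exact Hexp]. }
    apply Req_le. rewrite (Rmult_comm (A K)). apply is_RInt_unique.
    apply (is_RInt_scal (V := R_NormedModule)).
    apply (RInt_correct (V := R_CompleteNormedModule)), ex_RInt_cont.
    intros; now apply Ccont_Cmod.
Qed.

Let taylor_rem u := Cminus (Cminus (K u) (K 0)) (Cmult (RtoC u) (K1 0)).

Lemma taylor_bound u : Rabs u <= L -> Cmod (taylor_rem u) <= A K3 * u ^ 2.
Proof.
  intros Hu.
  set (G := fun t => Cminus (K t) (Cmult (RtoC t) (K1 0))).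
  assert (HK2 : forall t, Rabs t <= L -> Cmod (K2 t) <= A K3).
  { intros t Ht. apply Cmod_le_RInt_der; auto.
    - apply Z2. apply edge.
    - apply Rabs_le_between; exact Ht. }
  assert (HK1 : forall t, Rabs t <= L -> Cmod (Cminus (K1 t) (K1 0)) <= A K3 * Rabs t).
  { intros t Ht. rewrite <- (Rminus_0_r t) at 2.
    apply (Cmod_CInt_increment K1 K2); auto.
    intros s Hs. apply HK2. rewrite !Rminus_0_r in Hs. lra. }
  replace (taylor_rem u) with (Cminus (G u) (G 0)) by (unfold G, taylor_rem; ring).
  replace (A K3 * u ^ 2) with ((A K3 * Rabs u) * Rabs (u - 0))
    by (rewrite Rminus_0_r, <- (pow2_abs u); ring).
  assert (HA : 0 <= A K3).
  { apply RInt_ge_0_cont; [lra | intros; now apply Ccont_Cmod | intros; apply Cmod_ge_0]. }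
  apply (Cmod_CInt_increment G (fun t => Cminus (K1 t) (K1 0))).
  - intros t. unfold G. eapply Cder_eq; [|apply Cder_minus; [apply D0 |
      apply Cder_mult; [apply (Cder_RtoC (fun y => y)) | apply Cder_const]]].
    2: apply (is_derive_id (K := R_AbsRing)).
    change (@one R_AbsRing) with 1. cbv beta. ring.
  - ccont.
  - intros t Ht. rewrite !Rminus_0_r in Ht.
    eapply Rle_trans; [apply HK1; lra|]. apply Rmult_le_compat_l; assumption.
Qed.

(** The kernel is the Poisson kernel, [2 PI] times an approximate identity. The Taylor polynomial of
    [K] at 0 is split off: the constant term yields [4 atan (L / e)], close to [2 PI]; the linear
    term is odd and integrates to 0; in the remainder [u^2] cancels the denominator and leaves
    [O(e)]. *)
Lemma poisson_limit e : 0 < e ->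
  Cmod (Cminus (CInt (fun u => Cmult (RtoC (2 * e * / (e ^ 2 + u ^ 2))) (K u)) (- L) L)
               (Cmult (RtoC (2 * PI)) (K 0)))
    <= e * (4 * L * A K3 + 4 * / L * Cmod (K 0)).
Proof.
  intros He.
  assert (Hden := fun u => cont_W_den e u He).
  assert (Hden' : forall u, continuous (fun u => 2 * e * / (e ^ 2 + u ^ 2)) u).
  { intros; apply cont_mult; [cont | apply Hden]. }
  assert (Ct : Ccont taylor_rem) by (unfold taylor_rem; ccont).
  assert (E0 : CInt (fun u => RtoC (2 * e * / (e ^ 2 + u ^ 2))) (- L) L
               = RtoC (4 * atan (L / e))).
  { rewrite (CInt_FTC (fun u => RtoC (2 * atan (u / e)))).
    - replace (- L / e) with (- (L / e)) by (field; lra). rewrite atan_opp.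
      rewrite <- RtoC_minus. f_equal. ring.
    - intros u. apply Cder_RtoC.
      replace (2 * e * / (e ^ 2 + u ^ 2)) with (2 * (/ e * / (1 + (u / e) ^ 2))).
      2: { generalize (W_den_pos e u He); intros. field. split; [simpl in *; lra | lra]. }
      apply (is_derive_scal (fun u => atan (u / e))).
      apply (is_derive_comp atan (fun u => u / e)); [apply is_derive_atan_pow|].
      auto_derive; [trivial | field; lra].
    - ccont. }
  assert (E1 : CInt (fun u => RtoC (u * (2 * e * / (e ^ 2 + u ^ 2)))) (- L) L = 0%C).
  { rewrite (CInt_FTC (fun u => RtoC (e * ln (e ^ 2 + u ^ 2)))).
    - replace ((- L) ^ 2) with (L ^ 2) by ring. ring.
    - intros u. apply Cder_RtoC. generalize (W_den_pos e u He); intros.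
      auto_derive; [simpl in *; lra | simpl in *; field; lra].
    - apply Ccont_RtoC; intros; apply cont_mult; [cont | apply Hden']. }
  assert (E : CInt (fun u => Cmult (RtoC (2 * e * / (e ^ 2 + u ^ 2))) (K u)) (- L) L =
    Cplus (Cmult (K 0) (RtoC (4 * atan (L / e))))
      (CInt (fun u => Cmult (RtoC (2 * e * / (e ^ 2 + u ^ 2))) (taylor_rem u)) (- L) L)).
  { transitivity (CInt (fun u => Cplus (Cplus
       (Cmult (K 0) (RtoC (2 * e * / (e ^ 2 + u ^ 2))))
       (Cmult (K1 0) (RtoC (u * (2 * e * / (e ^ 2 + u ^ 2))))))
       (Cmult (RtoC (2 * e * / (e ^ 2 + u ^ 2))) (taylor_rem u))) (- L) L).
    { apply CInt_ext; intros u. unfold taylor_rem. rewrite (RtoC_mult u). ring. }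
    assert (S0 : Ccont (fun u => RtoC (2 * e * / (e ^ 2 + u ^ 2)))) by now apply Ccont_RtoC.
    assert (S1 : Ccont (fun u => RtoC (u * (2 * e * / (e ^ 2 + u ^ 2))))).
    { apply Ccont_RtoC; intros; apply cont_mult; [cont | apply Hden']. }
    rewrite CInt_plus by ccont.
    rewrite CInt_plus by ccont.
    rewrite CInt_mult_l, E0 by assumption. rewrite CInt_mult_l, E1 by assumption. ring. }
  rewrite E.
  replace (Cminus _ _) with (Cplus
    (CInt (fun u => Cmult (RtoC (2 * e * / (e ^ 2 + u ^ 2))) (taylor_rem u)) (- L) L)
    (Cmult (RtoC (4 * atan (L / e) - 2 * PI)) (K 0))) by (rewrite RtoC_minus; ring).
  eapply Rle_trans; [apply Cmod_triangle|]. rewrite Rmult_plus_distr_l.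
  assert (HA : 0 <= A K3).
  { apply RInt_ge_0_cont; [lra | intros; now apply Ccont_Cmod | intros; apply Cmod_ge_0]. }
  apply Rplus_le_compat.
  - replace (e * (4 * L * A K3)) with ((L - - L) * (2 * e * A K3)) by ring.
    apply CInt_bound_const; [lra | ccont |].
    intros u Hu. rewrite Cmod_mult, Cmod_R.
    assert (Hp := W_den_pos e u He).
    assert (Hi : 0 < / (e ^ 2 + u ^ 2)) by now apply Rinv_0_lt_compat.
    rewrite Rabs_pos_eq by (left; repeat apply Rmult_lt_0_compat; lra).
    assert (Hu2 : u ^ 2 * / (e ^ 2 + u ^ 2) <= 1).
    { apply Rmult_le_reg_r with (e ^ 2 + u ^ 2); [exact Hp|].
      rewrite Rmult_assoc, Rinv_l by lra. generalize (pow2_ge_0 e); lra. }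
    apply Rle_trans with (2 * e * / (e ^ 2 + u ^ 2) * (A K3 * u ^ 2)).
    + apply Rmult_le_compat_l; [left; repeat apply Rmult_lt_0_compat; lra|].
      apply taylor_bound. apply Rabs_le_between; exact Hu.
    + replace (2 * e * / (e ^ 2 + u ^ 2) * (A K3 * u ^ 2)) with
        (2 * e * A K3 * (u ^ 2 * / (e ^ 2 + u ^ 2))) by ring.
      rewrite <- (Rmult_1_r (2 * e * A K3)) at 2.
      apply Rmult_le_compat_l; [nra | exact Hu2].
  - rewrite Cmod_mult, Cmod_R. rewrite <- Rmult_assoc.
    apply Rmult_le_compat_r; [apply Cmod_ge_0|].
    assert (HLe : 0 < L / e) by now apply Rdiv_lt_0_compat.
    (* [4 atan (L / e)] falls short of [2 PI] by at most [4 e / L]. *)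
    assert (T1 := atan_tail (L / e) (L / e) HLe ltac:(lra)).
    assert (T2 := atan_bound (L / e)).
    replace (/ (L / e)) with (e * / L) in T1 by (field; lra).
    rewrite Rabs_left1; lra.
Qed.

Lemma inversion_at_zero : IntR_lim (osc K) (Cmult (RtoC (2 * PI)) (K 0)).
Proof.
  intros eps Heps.
  (* The sum of the coefficients of [e] in three errors: one for each half-line and one for the
     Poisson kernel. *)
  set (M := 2 * ((A K1 + A K3) * PI + A K) + (4 * L * A K3 + 4 * / L * Cmod (K 0))).
  assert (HA : forall G, Ccont G -> 0 <= A G).
  { intros G HG; apply RInt_ge_0_cont;
    [lra | intros; now apply Ccont_Cmod | intros; apply Cmod_ge_0]. }
  assert (HM : 0 <= M).
  { assert (H0 := HA K C0). assert (H1 := HA K1 C1). assert (H3 := HA K3 C3).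
    assert (Hpi := PI_RGT_0). assert (Hk := Cmod_ge_0 (K 0)).
    assert (Hl : 0 < / L) by now apply Rinv_0_lt_compat.
    unfold M. assert (0 <= (A K1 + A K3) * PI) by nra. assert (0 <= / L * Cmod (K 0)) by nra.
    assert (0 <= L * A K3) by nra. lra. }
  set (e := eps / (M + 1)).
  assert (He : 0 < e) by (apply Rdiv_lt_0_compat; lra).
  assert (HMe : e * M < eps).
  { assert (Ee : e * (M + 1) = eps) by (unfold e; field; lra). nra. }
  assert (He3 : 0 < / e ^ 3) by (apply Rinv_0_lt_compat, pow_lt, He).
  assert (Hosc := Ccont_osc K C0).
  (* Beyond this threshold the end-point factor [/ (e ^ 2 * B)] is at most [e]. *)
  exists (/ e ^ 3); split; [lra|]; intros a b Ha Hb.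
  assert (Hinv : forall B, / e ^ 3 <= B -> / (e ^ 2 * B) <= e).
  { intros B HB. replace e with (/ (e ^ 2 * / e ^ 3)) at 2 by (field; lra).
    assert (0 < e ^ 2) by (apply pow_lt, He).
    apply Rinv_le_contravar; [nra|]. apply Rmult_le_compat_l; lra. }
  assert (P1 := half_line e 1 b He ltac:(ring) ltac:(lra)).
  (* The negative half-line is the case [k = -1], reflected onto the interval from 0 to [- a]. *)
  assert (P2 := half_line e (-1) (- a) He ltac:(ring) ltac:(lra)).
  assert (P3 := poisson_limit e He).
  assert (Eb : CInt (fun x => osc K (1 * x)) 0 b = CInt (osc K) 0 b).
  { apply CInt_ext; intros; now rewrite Rmult_1_l. }
  assert (Ea : CInt (fun x => osc K (-1 * x)) 0 (- a) = CInt (osc K) a 0).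
  { assert (E := CInt_comp_lin (osc K) (-1) 0 0 (- a) Hosc).
    replace (-1 * 0 + 0) with 0 in E by ring. replace (-1 * - a + 0) with a in E by ring.
    assert (E' := CInt_Chasles (osc K) a 0 a Hosc). rewrite CInt_point in E'.
    replace (CInt (osc K) a 0) with (Copp (CInt (osc K) 0 a)).
    2: { replace (CInt (osc K) a 0) with
           (Cminus (Cplus (CInt (osc K) a 0) (CInt (osc K) 0 a)) (CInt (osc K) 0 a)) by ring.
         rewrite E'. ring. }
    rewrite <- E, CInt_mult_l by ccont.
    replace (RtoC (-1)) with (Copp 1) by (apply Ceq; simpl; ring).
    rewrite (CInt_ext (fun y => osc K (-1 * y + 0)) (fun y => osc K (-1 * y))); [ring|].
    intros; f_equal; ring. }
  rewrite Eb in P1. rewrite Ea in P2.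
  assert (HWp := Ccont_W e 1 He). assert (HWm := Ccont_W e (-1) He).
  assert (EW : Cplus (CInt (fun u => Cmult (W e 1 u) (K u)) (- L) L)
                     (CInt (fun u => Cmult (W e (-1) u) (K u)) (- L) L) =
       CInt (fun u => Cmult (RtoC (2 * e * / (e ^ 2 + u ^ 2))) (K u)) (- L) L).
  { rewrite <- CInt_plus by ccont. apply CInt_ext; intros u.
    replace (RtoC (2 * e * / (e ^ 2 + u ^ 2))) with (Cplus (W e 1 u) (W e (-1) u))
      by (apply Ceq; simpl; ring). ring. }
  rewrite <- EW in P3.
  rewrite <- (CInt_Chasles (osc K) a 0 b) by exact Hosc.
  match type of P1 with Cmod ?x <= _ => set (z1 := x) in * end.
  match type of P2 with Cmod ?x <= _ => set (z2 := x) in * end.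
  match type of P3 with Cmod ?x <= _ => set (z3 := x) in * end.
  replace (Cminus _ _) with (Cplus (Cplus z1 z2) z3) by (unfold z1, z2, z3; ring).
  assert (T := Cmod_triangle (Cplus z1 z2) z3). assert (T' := Cmod_triangle z1 z2).
  assert (I1 := Hinv b ltac:(lra)). assert (I2 := Hinv (- a) ltac:(lra)).
  assert (HA0 := HA K C0).
  assert (J1 : A K * / (e ^ 2 * b) <= A K * e) by now apply Rmult_le_compat_l.
  assert (J2 : A K * / (e ^ 2 * - a) <= A K * e) by now apply Rmult_le_compat_l.
  apply Rle_lt_trans with (e * M); [|exact HMe].
  unfold M. nra.
Qed.

End InversionAtZero.

(** Multiplying by [expi (- (x * xi))] amounts to translating the frequency by [xi], which turns the
    claim into inversion at zero for [K (v + xi)]. *)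
Lemma Fourier_inversion (K K1 K2 K3 : R -> C) (L xi : R) :
  0 <= L ->
  (forall x, Cder K x (K1 x)) -> (forall x, Cder K1 x (K2 x)) ->
  (forall x, Cder K2 x (K3 x)) -> Ccont K3 -> (forall x, L < Rabs x -> K x = 0%C) ->
  FT (fun x => IntR (fun u => Cmult (expi (x * u)) (K u))) xi = Cmult (RtoC (2 * PI)) (K xi).
Proof.
  intros HL D0 D1 D2 C3 Z0.
  assert (Z1 := Cder_vanish K K1 L D0 Z0). assert (Z2 := Cder_vanish K1 K2 L D1 Z1).
  assert (C0 : Ccont K) by now apply Cder_cont with K1.
  (* Large enough that the translated support lies strictly inside [[- L', L']]. *)
  set (L' := L + Rabs xi + 1).
  assert (Hxi := Rabs_pos xi).
  assert (Hfar : forall v, L' <= Rabs v -> L < Rabs (v + xi)).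
  { intros v Hv. generalize (Rabs_triang_inv v (- xi)). rewrite Rabs_Ropp.
    replace (v - - xi) with (v + xi) by ring. unfold L' in Hv. lra. }
  set (h := fun x => Cmult (expi (- (x * xi))) (IntR (fun u => Cmult (expi (x * u)) (K u)))).
  assert (Eh : forall x, CInt (fun v => Cmult (expi (x * v)) (K (v + xi))) (- L') L' = h x).
  { intros x. unfold h.
    rewrite (IntR_compact (fun u => Cmult (expi (x * u)) (K u)) (L' + Rabs xi)).
    - rewrite <- (CInt_support (fun u => Cmult (expi (x * u)) (K u)) (L + 1) (- L' + xi) (L' + xi)).
      + rewrite <- CInt_shift by ccont. rewrite <- CInt_mult_l by ccont.
        apply CInt_ext; intros v. rewrite Rmult_plus_distr_l, expi_plus.
        assert (E : Cmult (expi (- (x * xi))) (expi (x * xi)) = 1%C).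
        { rewrite <- expi_plus, <- expi_0. f_equal; ring. }
        rewrite <- (Cmult_1_l (Cmult (expi (x * v)) _)), <- E. ring.
      + ccont.
      + intros u Hu. rewrite Z0 by lra. ring.
      + unfold L'. generalize (Rle_abs xi); lra.
      + unfold L'. generalize (Rle_abs (- xi)); rewrite Rabs_Ropp; lra.
      + unfold L'; lra.
      + unfold L'; lra.
    - unfold L'; lra.
    - ccont.
    - intros u Hu. rewrite Z0 by (unfold L' in Hu; lra). ring. }
  assert (Hs : forall F F' : R -> C, (forall x, Cder F x (F' x)) ->
            forall v, Cder (fun v => F (v + xi)) v (F' (v + xi))).
  { intros F F' H v. eapply Cder_eq; [|apply (Cder_comp F (fun v => v + xi)); [apply H|]].
    2: { auto_derive; [trivial | reflexivity]. } ring. }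
  assert (HI := inversion_at_zero (fun v => K (v + xi)) (fun v => K1 (v + xi))
    (fun v => K2 (v + xi)) (fun v => K3 (v + xi)) L' ltac:(unfold L'; lra)
    (Hs _ _ D0) (Hs _ _ D1) (Hs _ _ D2)).
  cbv beta in HI. rewrite Rplus_0_l in HI.
  unfold FT. apply IntR_unique.
  - apply (Ccont_ext (fun x => CInt (fun v => Cmult (expi (x * v)) (K (v + xi))) (- L') L')).
    + exact Eh.
    + apply (Ccont_CInt_param (fun q : R * R =>
        Cmult (expi (fst q * snd q)) (K (snd q + xi)))). ccont.
  - intros eps Heps.
    destruct (HI ltac:(ccont) ltac:(intros; apply Z0; auto) ltac:(intros; apply Z1; auto)
      ltac:(intros; apply Z2; auto) eps Heps) as [B [HB HB']].
    exists B; split; [exact HB|]; intros a b Ha Hb.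
    change (Cmod (Cminus (CInt h a b) (Cmult (RtoC (2 * PI)) (K xi))) < eps).
    rewrite <- (CInt_ext _ _ a b Eh). now apply HB'.
Qed.

(** * Smooth functions of one variable depending continuously on a parameter *)

(** The derivatives are existentially quantified, so that closure under products and integrals is a
    plain induction. The parameter space is arbitrary because times and frequencies enter as
    parameters and are later integrated out by [PC_CInt]. *)
Fixpoint PC {T : UniformSpace} (n : nat) (F : T -> R -> C) : Prop :=
  Ccont (fun q : T * R => F (fst q) (snd q)) /\
  match n with
  | O => True
  | S n => exists F', (forall p x, Cder (F p) x (F' p x)) /\ PC n F'
  end.

Lemma PC_cont {T : UniformSpace} n (F : T -> R -> C) :
  PC n F -> Ccont (fun q : T * R => F (fst q) (snd q)).
Proof. destruct n; intros [H _]; exact H. Qed.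

Lemma PC_pred {T : UniformSpace} n : forall F : T -> R -> C, PC (S n) F -> PC n F.
Proof.
  induction n as [|n IH]; intros F [H [F' [Hd HF']]]; split; auto.
  exists F'; split; auto.
Qed.

Lemma PC_ext {T : UniformSpace} n (F G : T -> R -> C) :
  (forall p x, F p x = G p x) -> PC n F -> PC n G.
Proof.
  intros E H.
  replace G with F by (apply functional_extensionality; intros p;
    apply functional_extensionality; intros x; apply E). exact H.
Qed.

Lemma PC_plus {T : UniformSpace} n : forall F G : T -> R -> C,
  PC n F -> PC n G -> PC n (fun p x => Cplus (F p x) (G p x)).
Proof.
  induction n as [|n IH]; intros F G [HF HF'] [HG HG']; split; try ccont; auto.
  destruct HF' as [F' [DF HF']]; destruct HG' as [G' [DG HG']].
  exists (fun p x => Cplus (F' p x) (G' p x)); split.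
  - intros p x; apply Cder_plus; auto.
  - now apply IH.
Qed.

Lemma PC_mult {T : UniformSpace} n : forall F G : T -> R -> C,
  PC n F -> PC n G -> PC n (fun p x => Cmult (F p x) (G p x)).
Proof.
  induction n as [|n IH]; intros F G PF PG;
  assert (HF := PC_cont _ _ PF); assert (HG := PC_cont _ _ PG); split; try ccont; auto.
  assert (QF := PC_pred _ _ PF); assert (QG := PC_pred _ _ PG).
  destruct PF as [_ [F' [DF HF']]]; destruct PG as [_ [G' [DG HG']]].
  exists (fun p x => Cplus (Cmult (F' p x) (G p x)) (Cmult (F p x) (G' p x))); split.
  - intros p x; apply Cder_mult; auto.
  - apply PC_plus; now apply IH.
Qed.

Lemma PC_const_x {T : UniformSpace} n : forall k : T -> C,
  Ccont k -> PC n (fun p _ => k p).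
Proof.
  induction n as [|n IH]; intros k Hk; split; try ccont; auto.
  exists (fun _ _ => 0%C); split.
  - intros p x; apply Cder_const.
  - apply (IH (fun _ => 0%C)); ccont.
Qed.

Lemma smooth1_Derive h : smooth1 h -> smooth1 (Derive h).
Proof.
  intros H k x.
  assert (E : forall k x, Derive_n (Derive h) k x = Derive_n h (S k) x).
  { clear; induction k as [|k IH]; intros x; [reflexivity|]. simpl.
    apply Derive_ext; exact IH. }
  destruct k as [|k]; [exact I|].
  apply (ex_derive_ext (Derive_n h (S k))); [intros; symmetry; apply E|].
  exact (H (S (S k)) x).
Qed.

Lemma smooth1_is_derive h x : smooth1 h -> is_derive h x (Derive h x).
Proof. intros H; apply Derive_correct; exact (H 1%nat x). Qed.

Lemma PC_smooth {T : UniformSpace} n : forall h, smooth1 h ->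
  PC n (fun (_ : T) x => RtoC (h x)).
Proof.
  induction n as [|n IH]; intros h Hh; assert (Hc := smooth1_cont h Hh); split; auto;
  try (apply Ccont_RtoC; intros p; now apply cont_snd).
  exists (fun _ x => RtoC (Derive h x)); split.
  - intros p x; apply Cder_RtoC. now apply smooth1_is_derive.
  - apply IH. now apply smooth1_Derive.
Qed.

Lemma PC_expi n h : smooth1 h -> PC n (fun (s : R) x => expi (s * h x)).
Proof.
  intros Hh; assert (Hc := smooth1_cont h Hh).
  assert (H0 : Ccont (fun q : R * R => expi (fst q * h (snd q)))).
  { apply Ccont_expi; intros p; apply cont_mult; [cont | now apply cont_snd]. }
  induction n as [|n IH]; split; auto.
  exists (fun s x => Cmult (Cmult Ci (RtoC (s * Derive h x))) (expi (s * h x))); split.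
  - intros s x. apply (Cder_expi (fun x => s * h x)).
    apply (is_derive_scal h x s). now apply smooth1_is_derive.
  - apply PC_mult; [|exact IH].
    apply (PC_ext n (fun s x => Cmult (Cmult Ci (RtoC s)) (RtoC (Derive h x)))).
    + intros; rewrite RtoC_mult; ring.
    + apply PC_mult; [apply (PC_const_x n (fun s : R => Cmult Ci (RtoC s))); ccont|].
      apply PC_smooth. now apply smooth1_Derive.
Qed.

(** It has two uses: the shift writes [z] as [xi - e], and with [k = 0] it merely changes the
    parameter space. *)
Lemma PC_shift {T U : UniformSpace} (r : T -> U) (k : T -> R) :
  (forall p, continuous r p) -> (forall p, continuous k p) ->
  forall n (F : U -> R -> C), PC n F -> PC n (fun q x => F (r q) (x + k q)).
Proof.
  intros Hr Hk n; induction n as [|n IH]; intros F PF; assert (HF := PC_cont _ _ PF);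
  (split; [apply (Ccont_comp (fun q : T * R => (r (fst q), snd q + k (fst q)))
     (fun q : U * R => F (fst q) (snd q))); [|exact HF]; intros p; apply continuous_pair;
     [apply (continuous_comp fst r); [apply continuous_fst | apply Hr] |
      apply cont_plus; [cont | now apply cont_fst]]|]); auto.
  destruct PF as [_ [F' [DF PF']]].
  exists (fun q x => F' (r q) (x + k q)); split.
  - intros p x. eapply Cder_eq; [|apply (Cder_comp (F (r p)) (fun y => y + k p)); [apply DF|]].
    2: { auto_derive; [trivial | reflexivity]. } ring.
  - now apply IH.
Qed.

Lemma PC_CInt {T : UniformSpace} a b n : forall F : T * R -> R -> C,
  PC n F -> PC n (fun p x => CInt (fun y => F (p, y) x) a b).
Proof.
  induction n as [|n IH]; intros F PF; assert (HF := PC_cont _ _ PF);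
  (split; [apply (Ccont_CInt_param (fun z : (T * R) * R => F (fst (fst z), snd z) (snd (fst z))));
     apply (Ccont_comp (fun z : (T * R) * R => ((fst (fst z), snd z), snd (fst z)))
       (fun q : (T * R) * R => F (fst q) (snd q))); [|exact HF];
     intros z; repeat apply continuous_pair; cont |]); auto.
  destruct PF as [_ [F' [DF PF']]].
  exists (fun p x => CInt (fun y => F' (p, y) x) a b); split; [|now apply IH].
  intros p x.
  assert (HF' := PC_cont _ _ PF').
  apply (Cder_CInt_param (fun x y => F (p, y) x) (fun x y => F' (p, y) x)).
  - apply (Ccont_comp (fun q : R * R => ((p, snd q), fst q))
      (fun q : (T * R) * R => F (fst q) (snd q))); [|exact HF].
    intros z; repeat apply continuous_pair; cont; apply continuous_const.
  - apply (Ccont_comp (fun q : R * R => ((p, snd q), fst q))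
      (fun q : (T * R) * R => F' (fst q) (snd q))); [|exact HF'].
    intros z; repeat apply continuous_pair; cont; apply continuous_const.
  - intros; apply DF.
Qed.

Lemma PC_slice {T : UniformSpace} n (F : T -> R -> C) p : PC n F -> Ccont (F p).
Proof.
  intros PF. apply (Ccont_slice (fun q : T * R => F (fst q) (snd q)) p). now apply PC_cont with n.
Qed.

Lemma inversion_PC {T : UniformSpace} (F : T -> R -> C) p L xi :
  0 <= L -> PC 3 F -> (forall x, L < Rabs x -> F p x = 0%C) ->
  FT (fun x => IntR (fun u => Cmult (expi (x * u)) (F p u))) xi
    = Cmult (RtoC (2 * PI)) (F p xi).
Proof.
  intros HL PF HZ.
  destruct PF as [_ [F1 [D0 [_ [F2 [D1 [_ [F3 [D2 PF3]]]]]]]]].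
  apply (Fourier_inversion (F p) (F1 p) (F2 p) (F3 p) L); auto.
  now apply (PC_slice 0).
Qed.

Lemma IntR_ext h k : (forall x, h x = k x) -> IntR h = IntR k.
Proof. intros E. f_equal. now apply functional_extensionality. Qed.

(** The substitution [xi = z + e], from the two input frequencies to the output frequency.
    Exchanging the integrals fixes [e], so that only a translation in [z] remains; the sum ranges
    over [|xi| <= 2 L]. *)
Lemma shear (phi : R -> C) (B : R -> R -> C) L :
  0 <= L -> Ccont phi -> Ccont (fun q : R * R => B (fst q) (snd q)) ->
  (forall z e, L <= Rabs z -> B z e = 0%C) ->
  CInt (fun z => CInt (fun e => Cmult (phi (z + e)) (B z e)) (- L) L) (- L) L =
  CInt (fun xi => Cmult (phi xi) (CInt (fun e => B (xi + - e) e) (- L) L)) (- (2 * L)) (2 * L).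
Proof.
  intros HL Hphi HB HZ.
  assert (HB1 : Ccont (fun q : R * R => B (fst q + - snd q) (snd q))) by ccont.
  transitivity (CInt (fun xi => CInt (fun e => Cmult (phi xi) (B (xi + - e) e)) (- L) L)
                  (- (2 * L)) (2 * L)).
  2: { apply CInt_ext; intros xi. apply CInt_mult_l.
       apply (Ccont_slice (fun q : R * R => B (fst q + - snd q) (snd q)) xi HB1). }
  rewrite (CInt_Fubini (fun z e => Cmult (phi (z + e)) (B z e))) by ccont.
  rewrite (CInt_Fubini (fun xi e => Cmult (phi xi) (B (xi + - e) e))) by ccont.
  apply CInt_ext_in; [lra|]. intros e He.
  assert (Ce : Ccont (fun xi : R => Cmult (phi xi) (B (xi + - e) e))) by ccont.
  assert (Ce' : Ccont (fun z : R => Cmult (phi (z + e)) (B z e))) by ccont.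
  (* The range [3 L] still covers [[- 2 L, 2 L]] after a translation by [|e| <= L]. *)
  rewrite (CInt_support _ L (- L) L (- (3 * L)) (3 * L) Ce'); try lra.
  2: { intros z Hz. rewrite HZ by exact Hz. ring. }
  transitivity (CInt (fun xi => Cmult (phi xi) (B (xi + - e) e)) (- (3 * L) + e) (3 * L + e)).
  { rewrite <- (CInt_shift _ e _ _ Ce). apply CInt_ext; intros z.
    f_equal. f_equal. ring. }
  apply (CInt_support _ (2 * L)); try lra; auto.
  intros xi Hxi. rewrite HZ; [ring|].
  generalize (Rabs_triang_inv xi e). apply Rabs_le_between in He. unfold Rminus. lra.
Qed.

(** * The Duhamel integral as an oscillatory integral *)

Section Duhamel.
Variables (a b c : R -> R) (m : R -> R -> C) (f g : R -> C) (L : R).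
Hypotheses (Sa : smooth1 a) (Sb : smooth1 b) (Sc : smooth1 c) (HL : 0 <= L).

Let A (z e : R) : C := Cmult (Cmult (FT f z) (FT g e)) (m z e).

Hypothesis PA : forall n, PC n (fun e z => A z e).
Hypothesis ZA : forall z e, L <= Rabs z \/ L <= Rabs e -> A z e = 0%C.

Let B (s z e : R) : C := Cmult (Cmult (expi (s * b z)) (expi (s * c e))) (A z e).

(** At fixed [e], a derivative in [xi] only meets the first argument [xi - e]; this is why
    regularity of [A] is asked in [z], with [e] as a parameter. *)
Let PB n : PC n (fun (q : R * R) xi => B (fst q) (xi + - snd q) (snd q)).
Proof.
  unfold B. apply PC_mult; [apply PC_mult|].
  - apply (PC_shift (fun q : R * R => fst q) (fun q => - snd q)
      ltac:(cont) ltac:(cont) n (fun s z => expi (s * b z))). now apply PC_expi.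
  - apply (PC_const_x n (fun q : R * R => expi (fst q * c (snd q)))).
    apply Ccont_expi; intros p. apply cont_mult; [cont|].
    apply cont_snd. now apply smooth1_cont.
  - apply (PC_shift (fun q : R * R => snd q) (fun q => - snd q)
      ltac:(cont) ltac:(cont) n (fun e z => A z e)). apply PA.
Qed.

Let CA : Ccont (fun q : R * R => A (fst q) (snd q)).
Proof.
  apply (Ccont_comp_2 (fun e z => A z e) snd fst); [exact (PC_cont 0 _ (PA 0)) | cont | cont].
Qed.

Let Ca : forall x, continuous a x. Proof. now apply smooth1_cont. Qed.
Let Cb : forall x, continuous b x. Proof. now apply smooth1_cont. Qed.
Let Cc : forall x, continuous c x. Proof. now apply smooth1_cont. Qed.

Let CB s : Ccont (fun q : R * R => B s (fst q) (snd q)).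
Proof.
  unfold B. apply Ccont_mult; [apply Ccont_mult|exact CA].
  - apply Ccont_expi; intros p; apply cont_mult; [cont | now apply cont_fst].
  - apply Ccont_expi; intros p; apply cont_mult; [cont | now apply cont_snd].
Qed.

Let ZB s z e : L <= Rabs z \/ L <= Rabs e -> B s z e = 0%C.
Proof. intros H; unfold B; rewrite ZA by exact H; ring. Qed.

(** Up to the factor [2 PI], the Fourier transform of [T_m(v(s), w(s))]: an integral over the pairs
    of input frequencies with sum [xi]. *)
Let K (s xi : R) : C := CInt (fun e => B s (xi + - e) e) (- L) L.

Let PK n : PC n K.
Proof. apply (PC_CInt (- L) L n (fun (q : R * R) xi => B (fst q) (xi + - snd q) (snd q))), PB. Qed.

Let ZK s xi : 2 * L <= Rabs xi -> K s xi = 0%C.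
Proof.
  intros Hxi. unfold K. apply CInt_vanish; [lra|]. intros e He. apply ZB. left.
  generalize (Rabs_triang_inv xi e). apply Rabs_le_between in He. unfold Rminus. lra.
Qed.

(** The transform [K s] pulled back by the free flow, that is, the Duhamel integrand in
    frequency. *)
Let H (s xi : R) : C := Cmult (expi (- s * a xi)) (K s xi).

Let PH n : PC n H.
Proof.
  unfold H. apply PC_mult; [|apply PK].
  apply (PC_ext n (fun s x => expi ((- s) * a (x + 0)))).
  - intros; now rewrite Rplus_0_r.
  - apply (PC_shift (fun s : R => - s) (fun _ => 0) ltac:(cont) ltac:(cont) n
      (fun s z => expi (s * a z))). now apply PC_expi.
Qed.

Let ZH s xi : 2 * L <= Rabs xi -> H s xi = 0%C.
Proof. intros Hxi; unfold H; rewrite ZK by exact Hxi; ring. Qed.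

Let expi_slice (k : R) : Ccont (fun x : R => expi (k * x)).
Proof. ccont. Qed.

Lemma Tm_vw_eq s x :
  Tm_vw m b c f g s x = IntR (fun xi => Cmult (expi (x * xi)) (K s xi)).
Proof.
  assert (HB := CB s).
  assert (Sl : forall z, Ccont (fun e => B s z e)).
  { intros z. apply (Ccont_slice (fun q : R * R => B s (fst q) (snd q)) z HB). }
  assert (HK := PC_slice 0 K s (PK 0)).
  unfold Tm_vw, TmF.
  transitivity (IntR (fun z => CInt (fun e => Cmult (expi (x * (z + e))) (B s z e)) (- L) L)).
  { apply IntR_ext; intros z. specialize (Sl z).
    rewrite (IntR_ext _ (fun e => Cmult (expi (x * (z + e))) (B s z e))).
    - apply IntR_compact; [exact HL | ccont |].
      intros e He. rewrite ZB by (now right). ring.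
    - intros e. unfold B, A. ring. }
  rewrite (IntR_compact _ L).
  - rewrite (shear (fun y => expi (x * y)) (B s) L HL (expi_slice x) HB).
    + change (CInt (fun xi => Cmult (expi (x * xi)) (K s xi)) (- (2 * L)) (2 * L) =
              IntR (fun xi => Cmult (expi (x * xi)) (K s xi))).
      symmetry. apply IntR_compact; [lra | ccont |].
      intros xi Hxi. rewrite ZK by exact Hxi. ring.
    + intros; apply ZB; now left.
  - exact HL.
  - apply (Ccont_CInt_param (fun q : R * R =>
      Cmult (expi (x * (fst q + snd q))) (B s (fst q) (snd q)))). ccont.
  - intros z Hz. apply CInt_vanish; [lra|]. intros e _. rewrite ZB by (now left). ring.
Qed.

(** The bilinear term is an integral over frequencies, while [eitaD] takes the transform of a
    function of [x]; inversion reconciles the two. The factor [2 PI] is undone by the normalization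
    of [multF]. *)
Lemma FT_Tm_vw s xi : FT (Tm_vw m b c f g s) xi = Cmult (RtoC (2 * PI)) (K s xi).
Proof.
  rewrite <- (inversion_PC K s (2 * L) xi); [|lra | apply PK | intros; apply ZK; lra].
  apply IntR_ext; intros x. f_equal. apply Tm_vw_eq.
Qed.

Lemma two_PI_cancel z : Cmult (RtoC (/ (2 * PI))) (Cmult (RtoC (2 * PI)) z) = z.
Proof.
  rewrite Cmult_assoc, <- RtoC_mult, Rinv_l; [apply Cmult_1_l|].
  generalize PI_RGT_0; lra.
Qed.

Lemma multF_two_PI (p G : R -> C) x :
  Ccont p -> Ccont G -> (forall xi, 2 * L <= Rabs xi -> G xi = 0%C) ->
  multF p (fun xi => Cmult (RtoC (2 * PI)) (G xi)) x =
  CInt (fun xi => Cmult (expi (x * xi)) (Cmult (p xi) (G xi))) (- (2 * L)) (2 * L).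
Proof.
  intros Hp HG HZ. unfold multF.
  rewrite (IntR_compact _ (2 * L)); [|lra | ccont |].
  2: { intros xi Hxi; rewrite HZ by exact Hxi; ring. }
  rewrite <- CInt_mult_l by ccont. apply CInt_ext; intros xi.
  rewrite <- (two_PI_cancel (G xi)) at 2. ring.
Qed.

Lemma eitaD_Tm_vw s x :
  eitaD a (- s) (Tm_vw m b c f g s) x =
  CInt (fun xi => Cmult (expi (x * xi)) (H s xi)) (- (2 * L)) (2 * L).
Proof.
  unfold eitaD, Defs.mult.
  replace (FT (Tm_vw m b c f g s)) with (fun xi => Cmult (RtoC (2 * PI)) (K s xi))
    by (apply functional_extensionality; intros; symmetry; apply FT_Tm_vw).
  rewrite (multF_two_PI _ (K s)); [reflexivity | | apply (PC_slice 0), PK | intros; now apply ZK].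
  apply Ccont_expi; cont.
Qed.

Let G (T xi : R) : C := CInt (fun s => H s xi) 0 T.

Let CH : Ccont (fun q : R * R => H (fst q) (snd q)) := PC_cont 0 _ (PH 0).

Let PG T n : PC n (fun (_ : R) xi => G T xi).
Proof.
  apply (PC_CInt 0 T n (fun (q : R * R) xi => H (snd q) xi)).
  apply (PC_ext n (fun (q : R * R) xi => H (snd q) (xi + 0))).
  - intros; now rewrite Rplus_0_r.
  - apply (PC_shift (fun q : R * R => snd q) (fun _ => 0) ltac:(cont) ltac:(cont) n H), PH.
Qed.

Let ZG T xi : 2 * L <= Rabs xi -> G T xi = 0%C.
Proof.
  intros Hxi. unfold G. rewrite (CInt_ext _ (fun _ => 0%C)); [apply CInt_zero|].
  intros; now apply ZH.
Qed.

Lemma Fint_eq T x :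
  Fint a b c m f g T x =
  IntR (fun xi => Cmult (expi (x * xi)) (Cmult (0, -1) (G T xi))).
Proof.
  assert (HG := PC_slice 0 _ 0 (PG T 0)).
  assert (HH := CH).
  unfold Fint. fold (CInt (fun s => eitaD a (- s) (Tm_vw m b c f g s) x) 0 T).
  rewrite (CInt_ext _ (fun s => CInt (fun xi => Cmult (expi (x * xi)) (H s xi))
    (- (2 * L)) (2 * L))) by (intros; apply eitaD_Tm_vw).
  rewrite (CInt_Fubini (fun s xi => Cmult (expi (x * xi)) (H s xi))) by ccont.
  rewrite (IntR_compact _ (2 * L)); [|lra | ccont |].
  2: { intros xi Hxi; rewrite ZG by exact Hxi; ring. }
  rewrite (CInt_ext _ (fun xi => Cmult (expi (x * xi)) (G T xi))).
  2: { intros xi. apply CInt_mult_l.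
       assert (HH' : Ccont (fun q : R * R => H (snd q) (fst q))) by ccont.
       apply (Ccont_slice (fun q : R * R => H (snd q) (fst q)) xi HH'). }
  rewrite <- CInt_mult_l by ccont. apply CInt_ext; intros; ring.
Qed.

(** Inversion is used a second time, now for the time integral [G T], which [Fint_eq] has brought
    inside the integral over [xi]. *)
Lemma eitaD_Fint t T x :
  eitaD a t (Fint a b c m f g T) x =
  CInt (fun xi => Cmult (expi (x * xi)) (Cmult (expi (t * a xi)) (Cmult (0, -1) (G T xi))))
    (- (2 * L)) (2 * L).
Proof.
  assert (P : PC 3 (fun (_ : R) xi => Cmult (0, -1) (G T xi))).
  { apply PC_mult; [apply (PC_const_x 3 (fun _ : R => ((0, -1) : C))); ccont | apply PG]. }
  assert (Z : forall xi, 2 * L <= Rabs xi -> Cmult (0, -1) (G T xi) = 0%C).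
  { intros xi Hxi; rewrite ZG by exact Hxi; ring. }
  unfold eitaD, Defs.mult.
  replace (FT (Fint a b c m f g T)) with
    (fun xi => Cmult (RtoC (2 * PI)) (Cmult (0, -1) (G T xi))).
  - apply (multF_two_PI _ (fun xi => Cmult (0, -1) (G T xi))); auto.
    + apply Ccont_expi; cont.
    + exact (PC_slice 3 _ 0 P).
  - apply functional_extensionality; intros xi.
    rewrite <- (inversion_PC (fun (_ : R) xi => Cmult (0, -1) (G T xi)) 0 (2 * L) xi);
      [|lra | exact P | intros; apply Z; lra].
    apply IntR_ext; intros y. f_equal. symmetry. apply Fint_eq.
Qed.

Definition phase (t x s z e : R) : R :=
  x * (z + e) + t * a (z + e) + s * (- a (z + e) + b z + c e).

(** The same propagator acts on [Fint] at times [t] and [M], so only the integral of [H] over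
    [[M, t]] survives; undoing the shear returns to the coordinates [(z, e)]. *)
Lemma duhamel_difference M t x : M <= t ->
  Cminus (u_sol a b c m f g t x) (U_M a b c m f g M t x) =
  Cmult (0, -1) (CInt (fun s => CInt (fun z => CInt (fun e =>
    Cmult (expi (phase t x s z e)) (A z e)) (- L) L) (- L) L) M t).
Proof.
  intros HMt. unfold u_sol, U_M. rewrite Rmin_right by lra. rewrite !eitaD_Fint.
  assert (HG := fun T => PC_slice 0 _ 0 (PG T 0)).
  assert (HGt := HG t). assert (HGM := HG M). cbv beta in HGt, HGM.
  assert (HH := CH).
  assert (HH' : Ccont (fun q : R * R => H (snd q) (fst q))) by ccont.
  assert (Hsl : forall xi, Ccont (fun s : R => H s xi)).
  { intros xi. apply (Ccont_slice (fun q : R * R => H (snd q) (fst q)) xi HH'). }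
  assert (HE : Ccont (fun xi => expi (t * a xi))) by (apply Ccont_expi; cont).
  rewrite <- CInt_minus by ccont.
  transitivity (CInt (fun xi => CInt (fun s => Cmult (0, -1)
    (Cmult (Cmult (expi (x * xi)) (expi (t * a xi))) (H s xi))) M t) (- (2 * L)) (2 * L)).
  { apply CInt_ext; intros xi. specialize (Hsl xi).
    assert (E := CInt_Chasles (fun s : R => H s xi) 0 M t Hsl).
    change (Cplus (G M xi) (CInt (fun s : R => H s xi) M t) = G t xi) in E. rewrite <- E.
    rewrite CInt_mult_l by ccont. rewrite CInt_mult_l by ccont. ring. }
  rewrite (CInt_Fubini (fun xi s => Cmult (0, -1)
    (Cmult (Cmult (expi (x * xi)) (expi (t * a xi))) (H s xi)))) by ccont.
  rewrite <- CInt_mult_l.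
  - apply CInt_ext; intros s.
    assert (HHs := PC_slice 0 H s (PH 0)).
    rewrite CInt_mult_l by ccont. f_equal.
    set (phi := fun xi => Cmult (Cmult (expi (x * xi)) (expi (t * a xi))) (expi (- s * a xi))).
    assert (Hphi : Ccont phi).
    { unfold phi. apply Ccont_mult; [apply Ccont_mult|]; apply Ccont_expi; cont. }
    assert (S := shear phi (B s) L HL Hphi (CB s) ltac:(intros; apply ZB; now left)).
    transitivity (CInt (fun xi => Cmult (phi xi) (CInt (fun e => B s (xi + - e) e) (- L) L))
                    (- (2 * L)) (2 * L)).
    { apply CInt_ext; intros xi. unfold phi, H, K. ring. }
    rewrite <- S. apply CInt_ext; intros z. apply CInt_ext; intros e.
    unfold phi, B, phase.
    replace (x * (z + e) + t * a (z + e) + s * (- a (z + e) + b z + c e)) with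
      (x * (z + e) + t * a (z + e) + - s * a (z + e) + s * b z + s * c e) by ring.
    rewrite !expi_plus. ring.
  - apply (Ccont_CInt_param (fun q : R * R => CInt (fun e =>
      Cmult (expi (phase t x (fst q) (snd q) e)) (A (snd q) e)) (- L) L)).
    apply (Ccont_CInt_param (fun q : (R * R) * R =>
      Cmult (expi (phase t x (fst (fst q)) (snd (fst q)) (snd q))) (A (snd (fst q)) (snd q)))).
    assert (HA := CA). apply Ccont_mult; [|ccont].
    unfold phase. apply Ccont_expi. cont.
Qed.

End Duhamel.

(** * Smooth functions of two variables on an open set *)

Definition pd1 (h : R -> R -> R) (x y : R) : R := Derive (fun x' => h x' y) x.
Definition pd2 (h : R -> R -> R) (x y : R) : R := Derive (fun y' => h x y') y.

Definition open2 (D : R -> R -> Prop) : Prop :=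
  forall x y, D x y -> locally_2d D x y.

(* The partial derivatives are given by the total operator [Derive], so that no choice of
   derivatives has to be glued in [Ck_union]. *)
Fixpoint Ck (n : nat) (D : R -> R -> Prop) (h : R -> R -> R) : Prop :=
  (forall x y, D x y -> continuous (fun p : R * R => h (fst p) (snd p)) (x, y)) /\
  match n with
  | O => True
  | S n => (forall x y, D x y -> ex_derive (fun x' => h x' y) x /\
                                 ex_derive (fun y' => h x y') y) /\
           Ck n D (pd1 h) /\ Ck n D (pd2 h)
  end.

Definition everywhere (_ _ : R) : Prop := True.

Lemma open2_everywhere : open2 everywhere.
Proof. intros x y _; exists (mkposreal 1 Rlt_0_1); now intros. Qed.

Lemma locally_2d_fst (D : R -> R -> Prop) x y :
  locally_2d D x y -> locally x (fun x' => D x' y).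
Proof.
  intros [d Hd]; exists d; intros x' Hx'; apply Hd; [exact Hx'|].
  rewrite Rminus_diag, Rabs_R0; apply cond_pos.
Qed.

Lemma locally_2d_snd (D : R -> R -> Prop) x y :
  locally_2d D x y -> locally y (fun y' => D x y').
Proof.
  intros [d Hd]; exists d; intros y' Hy'; apply Hd; [|exact Hy'].
  rewrite Rminus_diag, Rabs_R0; apply cond_pos.
Qed.

Lemma locally_2d_pair (D : R -> R -> Prop) x y :
  locally_2d D x y -> locally (x, y) (fun p : R * R => D (fst p) (snd p)).
Proof.
  intros [d Hd]; exists d; intros [u v] [Hu Hv]; apply Hd; [exact Hu | exact Hv].
Qed.

(** Openness of [D] lets an equality on [D] pass to the derivatives, which look at a
    neighbourhood. *)
Lemma Ck_ext n D : open2 D -> forall h k,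
  (forall x y, D x y -> h x y = k x y) -> Ck n D h -> Ck n D k.
Proof.
  intros HD; induction n as [|n IH]; intros h k E [Hc Hr]; split.
  1, 3: intros x y Hxy; apply (continuous_ext_loc _ (fun p : R * R => h (fst p) (snd p)));
    [generalize (locally_2d_pair _ _ _ (HD x y Hxy)); apply filter_imp; intros p Hp; now apply E
    | now apply Hc].
  - exact I.
  - destruct Hr as [Hd [H1 H2]].
    assert (L1 : forall x y, D x y -> locally x (fun x' => h x' y = k x' y)).
    { intros x y Hxy. generalize (locally_2d_fst _ _ _ (HD x y Hxy)).
      apply filter_imp; intros; now apply E. }
    assert (L2 : forall x y, D x y -> locally y (fun y' => h x y' = k x y')).
    { intros x y Hxy. generalize (locally_2d_snd _ _ _ (HD x y Hxy)).
      apply filter_imp; intros; now apply E. }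
    split; [|split].
    + intros x y Hxy; destruct (Hd x y Hxy) as [E1 E2]; split.
      * apply (ex_derive_ext_loc (fun x' => h x' y)); auto.
      * apply (ex_derive_ext_loc (fun y' => h x y')); auto.
    + apply (IH (pd1 h)); [|exact H1]. intros x y Hxy.
      apply (Derive_ext_loc (fun x' => h x' y)); auto.
    + apply (IH (pd2 h)); [|exact H2]. intros x y Hxy.
      apply (Derive_ext_loc (fun y' => h x y')); auto.
Qed.

Lemma Ck_cont n D h : Ck n D h ->
  forall x y, D x y -> continuous (fun p : R * R => h (fst p) (snd p)) (x, y).
Proof. destruct n; intros [H _]; exact H. Qed.

Lemma Ck_pred n D : forall h, Ck (S n) D h -> Ck n D h.
Proof.
  induction n as [|n IH]; intros h [Hc [Hd [H1 H2]]]; split; auto.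
Qed.

Lemma Ck_sub n (D D' : R -> R -> Prop) : (forall x y, D' x y -> D x y) ->
  forall h, Ck n D h -> Ck n D' h.
Proof.
  intros HD; induction n as [|n IH]; intros h [Hc Hr]; split; auto.
  destruct Hr as [Hd [H1 H2]]; auto.
Qed.

Lemma Ck_union n (D D' : R -> R -> Prop) : forall h,
  Ck n D h -> Ck n D' h -> Ck n (fun x y => D x y \/ D' x y) h.
Proof.
  induction n as [|n IH]; intros h [Hc Hr] [Hc' Hr']; split.
  1, 3: intros x y [H|H]; auto.
  - exact I.
  - destruct Hr as [Hd [H1 H2]]; destruct Hr' as [Hd' [H1' H2']].
    split; [|split]; auto. intros x y [H|H]; auto.
Qed.

Lemma Ck_const n D k : Ck n D (fun _ _ => k).
Proof.
  revert k; induction n as [|n IH]; intros k; split; auto; try (intros; apply cont_const).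
  assert (E1 : pd1 (fun _ _ => k) = fun _ _ => 0).
  { apply functional_extensionality; intros x; apply functional_extensionality; intros y.
    apply (Derive_const k). }
  assert (E2 : pd2 (fun _ _ => k) = fun _ _ => 0).
  { apply functional_extensionality; intros x; apply functional_extensionality; intros y.
    apply (Derive_const k). }
  rewrite E1, E2. split; [|split]; auto. intros; split; apply ex_derive_const.
Qed.

Lemma Ck_plus n D : open2 D -> forall h k,
  Ck n D h -> Ck n D k -> Ck n D (fun x y => h x y + k x y).
Proof.
  intros HD; induction n as [|n IH]; intros h k [Hc Hr] [Hc' Hr']; split.
  1, 3: intros; apply cont_plus; auto.
  - exact I.
  - destruct Hr as [Hd [H1 H2]]; destruct Hr' as [Hd' [H1' H2']].
    split; [|split].
    + intros x y Hxy; destruct (Hd x y Hxy), (Hd' x y Hxy); split;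
      now apply (ex_derive_plus (V := R_NormedModule)).
    + apply (Ck_ext n D HD (fun x y => pd1 h x y + pd1 k x y)); auto.
      intros x y Hxy; destruct (Hd x y Hxy), (Hd' x y Hxy).
      symmetry; now apply Derive_plus.
    + apply (Ck_ext n D HD (fun x y => pd2 h x y + pd2 k x y)); auto.
      intros x y Hxy; destruct (Hd x y Hxy), (Hd' x y Hxy).
      symmetry; now apply Derive_plus.
Qed.

Lemma Ck_mult n D : open2 D -> forall h k,
  Ck n D h -> Ck n D k -> Ck n D (fun x y => h x y * k x y).
Proof.
  intros HD; induction n as [|n IH]; intros h k Ch Ck'.
  - destruct Ch as [Hc _], Ck' as [Hc' _]; split; [|exact I].
    intros; apply cont_mult; auto.
  - assert (Ph := Ck_pred _ _ _ Ch). assert (Pk := Ck_pred _ _ _ Ck').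
    destruct Ch as [Hc [Hd [H1 H2]]], Ck' as [Hc' [Hd' [H1' H2']]]. split; [|split; [|split]].
    + intros; apply cont_mult; auto.
    + intros x y Hxy; destruct (Hd x y Hxy), (Hd' x y Hxy); split;
      now apply ex_derive_mult.
    + apply (Ck_ext n D HD (fun x y => pd1 h x y * k x y + h x y * pd1 k x y)).
      * intros x y Hxy; destruct (Hd x y Hxy), (Hd' x y Hxy).
        symmetry; now apply (Derive_mult (fun x => h x y) (fun x => k x y)).
      * apply Ck_plus; auto.
    + apply (Ck_ext n D HD (fun x y => pd2 h x y * k x y + h x y * pd2 k x y)).
      * intros x y Hxy; destruct (Hd x y Hxy), (Hd' x y Hxy).
        symmetry; now apply (Derive_mult (fun y => h x y) (fun y => k x y)).
      * apply Ck_plus; auto.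
Qed.

Lemma Ck_opp n D h : open2 D -> Ck n D h -> Ck n D (fun x y => - h x y).
Proof.
  intros HD H. apply (Ck_ext n D HD (fun x y => (-1) * h x y)); [intros; ring|].
  apply Ck_mult; auto. apply Ck_const.
Qed.

Lemma Ck_inv n D : open2 D -> forall q, (forall x y, D x y -> q x y <> 0) ->
  Ck n D q -> Ck n D (fun x y => / q x y).
Proof.
  intros HD; induction n as [|n IH]; intros q Hq Cq.
  - destruct Cq as [Hc _]; split; [|exact I]. intros; apply cont_inv; auto.
  - assert (Pq := IH q Hq (Ck_pred _ _ _ Cq)).
    destruct Cq as [Hc [Hd [H1 H2]]]. split; [|split; [|split]].
    + intros; apply cont_inv; auto.
    + intros x y Hxy; destruct (Hd x y Hxy); split; apply ex_derive_inv; auto.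
    + apply (Ck_ext n D HD (fun x y => - (pd1 q x y * (/ q x y * / q x y)))).
      * intros x y Hxy; destruct (Hd x y Hxy). symmetry.
        unfold pd1 at 1. rewrite (Derive_inv (fun x => q x y)) by auto.
        unfold pd1. field. now apply Hq.
      * apply Ck_opp, Ck_mult; auto. now apply Ck_mult.
    + apply (Ck_ext n D HD (fun x y => - (pd2 q x y * (/ q x y * / q x y)))).
      * intros x y Hxy; destruct (Hd x y Hxy). symmetry.
        unfold pd2 at 1. rewrite (Derive_inv (fun y => q x y)) by auto.
        unfold pd2. field. now apply Hq.
      * apply Ck_opp, Ck_mult; auto. now apply Ck_mult.
Qed.

Lemma Ck_fst n D : forall h, smooth1 h -> Ck n D (fun x _ => h x).
Proof.
  induction n as [|n IH]; intros h Hh; assert (Hc := smooth1_cont h Hh); split; auto;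
  try (intros; now apply (cont_fst h)).
  split; [|split].
  - intros; split; [apply (Hh 1%nat) | apply ex_derive_const].
  - apply (IH (Derive h)). now apply smooth1_Derive.
  - replace (pd2 (fun x _ => h x)) with (fun _ _ : R => 0); [apply Ck_const|].
    apply functional_extensionality; intros x; apply functional_extensionality; intros y.
    symmetry; apply (Derive_const (h x)).
Qed.

Lemma Ck_snd n D : forall h, smooth1 h -> Ck n D (fun _ y => h y).
Proof.
  induction n as [|n IH]; intros h Hh; assert (Hc := smooth1_cont h Hh); split; auto;
  try (intros; now apply (cont_snd h)).
  split; [|split].
  - intros; split; [apply ex_derive_const | apply (Hh 1%nat)].
  - replace (pd1 (fun _ y => h y)) with (fun _ _ : R => 0); [apply Ck_const|].
    apply functional_extensionality; intros x; apply functional_extensionality; intros y.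
    symmetry; apply (Derive_const (h y)).
  - apply (IH (Derive h)). now apply smooth1_Derive.
Qed.

Lemma Ck_smooth2 n D h : smooth2 h -> Ck n D h.
Proof.
  (* The induction needs all iterated derivatives at once; [pderiv] keeps the last one taken at the
     head of the list, so a further derivative is a cons. *)
  intros Hh. assert (G : forall l, Ck n D (pderiv l h)); [|exact (G nil)].
  induction n as [|n IH]; intros l; destruct (Hh l) as [Hd Hc]; split; auto.
  split; [auto|split].
  - exact (IH (true :: l)%list).
  - exact (IH (false :: l)%list).
Qed.

Lemma PC_of_Ck n : forall u v : R -> R -> R,
  Ck n everywhere u -> Ck n everywhere v ->
  PC n (fun y x => ((u x y, v x y) : C)).
Proof.
  assert (Hsw : forall w : R -> R -> R, (forall x y, everywhere x y ->
            continuous (fun p : R * R => w (fst p) (snd p)) (x, y)) ->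
            forall p : R * R, continuous (fun p : R * R => w (snd p) (fst p)) p).
  { intros w Hw p. apply (cont_swap w). intros [x y]; now apply Hw. }
  induction n as [|n IH]; intros u v [Hu Hu'] [Hv Hv'];
  (split; [split; [now apply (Hsw u) | now apply (Hsw v)]|]); [exact I|].
  destruct Hu' as [Du [Hu1 _]], Hv' as [Dv [Hv1 _]].
  exists (fun y x => (pd1 u x y, pd1 v x y)); split; [|now apply IH].
  intros y x; split; apply Derive_correct; [apply (Du x y) | apply (Dv x y)]; exact I.
Qed.

(** * The second-derivative van der Corput estimate *)

(* The weight [th' / (th'^2 + r^2)] interpolates between [1 / th'] far from the
   stationary point and a trivial estimate near it, so that no splitting is needed:
   both error terms are controlled by the integral of [|th''| / (th'^2 + r^2)], that
   is, by the variation of [atan (th' / r) / r]. *)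
Lemma van_der_Corput (th th1 th2 : R -> R) (A A' : R -> C) (k r L : R) :
  0 <= L -> 0 < r -> Rabs k = 1 ->
  (forall u, is_derive th u (th1 u)) -> (forall u, is_derive th1 u (th2 u)) ->
  (forall u, continuous th2 u) -> (forall u, r ^ 2 <= k * th2 u) ->
  (forall u, Cder A u (A' u)) -> Ccont A' -> A (- L) = 0%C -> A L = 0%C ->
  Cmod (CInt (fun u => Cmult (expi (th u)) (A u)) (- L) L)
    <= (2 * PI + 1) / r * RInt (fun u => Cmod (A' u)) (- L) L.
Proof.
  intros HL Hr Hk D0 D1 C2 Hlow DA CA' Z1 Z2.
  set (N := RInt (fun u => Cmod (A' u)) (- L) L).
  assert (CN : forall x, continuous (fun u => Cmod (A' u)) x) by (intros; now apply Ccont_Cmod).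
  assert (HN : 0 <= N) by (apply RInt_ge_0_cont; [lra | exact CN | intros; apply Cmod_ge_0]).
  assert (CA := Cder_cont _ _ DA).
  assert (C0 : forall u, continuous th u).
  { intros u; apply (ex_derive_continuous (V := R_NormedModule)); now exists (th1 u). }
  assert (C1 : forall u, continuous th1 u).
  { intros u; apply (ex_derive_continuous (V := R_NormedModule)); now exists (th2 u). }
  set (D := fun u => th1 u ^ 2 + r ^ 2).
  assert (HD : forall u, 0 < D u).
  { intros u; unfold D; generalize (pow2_ge_0 (th1 u)) (pow_lt r 2 Hr); lra. }
  assert (HDi : forall u, 0 < / D u) by (intros; now apply Rinv_0_lt_compat).
  assert (CDi : forall u, continuous (fun u => / D u) u).
  { intros u; apply cont_inv; [unfold D; cont | generalize (HD u); lra]. }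
  set (w := fun u => th1 u * / D u).
  set (w' := fun u => th2 u * (r ^ 2 - th1 u ^ 2) * (/ D u * / D u)).
  assert (Cw' : forall u, continuous w' u) by (unfold w'; cont).
  assert (Cw : forall u, continuous w u) by (unfold w; cont).
  assert (Dw : forall u, is_derive w u (w' u)).
  { intros u. unfold w, w', D. generalize (HD u) (D1 u); unfold D; intros Hp Hd.
    assert (Ex : ex_derive th1 u) by (now exists (th2 u)).
    auto_derive; [repeat split; auto; simpl in Hp; lra|].
    replace (Derive (fun x : R => th1 x) u) with (th2 u)
      by (symmetry; exact (is_derive_unique _ _ _ Hd)).
    field. simpl in Hp. lra. }
  set (E := fun u => expi (th u)).
  assert (CE : Ccont E) by now apply Ccont_expi.
  (* As [w th1 + r^2 / D = 1], the integrand is the derivative of [- i w E A] plus [err]; the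
     boundary terms vanish with [A]. *)
  set (err := fun u => Cplus
     (Cmult (Cplus (RtoC (r ^ 2 * / D u)) (Cmult Ci (RtoC (w' u)))) (Cmult (E u) (A u)))
     (Cmult (Cmult Ci (RtoC (w u))) (Cmult (E u) (A' u)))).
  assert (CErr : Ccont err) by (unfold err; ccont).
  assert (Eq : CInt (fun u => Cmult (E u) (A u)) (- L) L = CInt err (- L) L).
  { assert (F0 : CInt (fun u => Cminus (Cmult (E u) (A u)) (err u)) (- L) L = 0%C).
    { rewrite (CInt_FTC (fun u => Cmult (Cmult (Copp Ci) (RtoC (w u))) (Cmult (E u) (A u)))).
      - rewrite Z1, Z2. ring.
      - intros u.
        eapply Cder_eq; [|apply Cder_mult; [apply Cder_mult;
          [apply Cder_const | apply Cder_RtoC, Dw] |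
           apply Cder_mult; [apply Cder_expi, D0 | apply DA]]].
        cbv beta. unfold err, E.
        assert (T : Cplus (RtoC (w u * th1 u)) (RtoC (r ^ 2 * / D u)) = 1%C).
        { rewrite <- RtoC_plus. f_equal. unfold w. generalize (HD u); intros Hp.
          replace (th1 u * / D u * th1 u + r ^ 2 * / D u) with (D u * / D u)
            by (unfold D at 1; ring).
          field; lra. }
        rewrite RtoC_mult in T.
        assert (I2 : Cmult Ci Ci = Copp 1) by (apply Ceq; simpl; ring).
        transitivity (Cplus (Cmult (Cmult (Copp (Cmult Ci Ci)) (Cmult (RtoC (w u)) (RtoC (th1 u))))
             (Cmult (expi (th u)) (A u)))
           (Cplus (Cmult (Cmult (Copp Ci) (RtoC (w' u))) (Cmult (expi (th u)) (A u)))
             (Cmult (Cmult (Copp Ci) (RtoC (w u))) (Cmult (expi (th u)) (A' u))))); [ring|].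
        rewrite I2.
        replace (Cmult (RtoC (w u)) (RtoC (th1 u))) with (Cminus 1 (RtoC (r ^ 2 * / D u)))
          by (rewrite <- T; ring).
        ring.
      - ccont. }
    rewrite CInt_minus in F0 by ccont.
    replace (CInt (fun u => Cmult (E u) (A u)) (- L) L) with
      (Cplus (Cminus (CInt (fun u => Cmult (E u) (A u)) (- L) L) (CInt err (- L) L))
             (CInt err (- L) L)) by ring.
    rewrite F0. ring. }
  change (Cmod (CInt (fun u => Cmult (E u) (A u)) (- L) L) <= (2 * PI + 1) / r * N).
  rewrite Eq.
  (* Written as the derivative of [k atan (th1 / r) / r], so that its integral is at most [PI / r]
     whatever the length of the interval. *)
  set (V := fun u => k * (/ r * (th2 u * / r * / (1 + (th1 u / r) ^ 2)))).
  assert (EV : forall u, V u = k * th2 u * / D u).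
  { intros u. unfold V, D. generalize (HD u); unfold D; intros. field.
    split; [|lra]. simpl in *; lra. }
  assert (CV : forall u, continuous V u).
  { intros u. apply (continuous_ext (fun u => k * th2 u * / D u)); [intros; now rewrite EV|].
    cont. }
  assert (IV : RInt V (- L) L = k * / r * (atan (th1 L / r) - atan (th1 (- L) / r))).
  { apply is_RInt_unique. rewrite Rmult_assoc. apply (is_RInt_scal (V := R_NormedModule)).
    replace (/ r * (atan (th1 L / r) - atan (th1 (- L) / r))) with
      (minus (/ r * atan (th1 L / r)) (/ r * atan (th1 (- L) / r)))
      by (unfold minus, plus, opp; simpl; ring).
    apply (is_RInt_derive (V := R_CompleteNormedModule) (fun u => / r * atan (th1 u / r))).
    - intros u _. apply (is_derive_scal (fun u => atan (th1 u / r))).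
      apply (is_derive_comp atan (fun u => th1 u / r)); [apply is_derive_atan_pow|].
      generalize (D1 u); intros Hd.
      assert (Ex : ex_derive th1 u) by (now exists (th2 u)).
      auto_derive; [auto|].
      replace (Derive (fun x : R => th1 x) u) with (th2 u)
        by (symmetry; exact (is_derive_unique _ _ _ Hd)).
      ring.
    - intros u _. apply cont_mult; [apply cont_const|].
      apply cont_mult; [cont|]. apply cont_inv; [unfold Rdiv; cont|].
      generalize (one_sqr_pos (th1 u / r)); lra. }
  eapply Rle_trans.
  { apply (CInt_bound err (fun u => (2 * N) * V u + / r * Cmod (A' u))); [lra | exact CErr | cont |].
    intros u Hu. unfold err.
    assert (HA : Cmod (A u) <= N) by (apply Cmod_le_RInt_der; auto).
    assert (HA0 := Cmod_ge_0 (A u)). assert (HA'0 := Cmod_ge_0 (A' u)).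
    assert (V1 : r ^ 2 * / D u <= V u).
    { rewrite EV. apply Rmult_le_compat_r; [left; apply HDi | apply Hlow]. }
    assert (V2 : Rabs (w' u) <= V u).
    { rewrite EV. unfold w'. rewrite !Rabs_mult.
      assert (K2 : Rabs (th2 u) = k * th2 u).
      { rewrite <- (Rmult_1_l (Rabs (th2 u))), <- Hk, <- Rabs_mult. apply Rabs_pos_eq.
        generalize (Hlow u) (pow2_ge_0 r); lra. }
      rewrite K2. rewrite (Rabs_pos_eq (/ D u)) by (left; apply HDi).
      rewrite Rmult_assoc. apply Rmult_le_compat_l.
      { generalize (Hlow u) (pow2_ge_0 r); lra. }
      (* What remains is [|r^2 - th1^2| <= D], which cancels one of the two factors [/ D]. *)
      rewrite <- (Rmult_1_l (/ D u)) at 3. rewrite <- Rmult_assoc.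
      apply Rmult_le_compat_r; [left; apply HDi|].
      rewrite <- (Rinv_r (D u)) by (generalize (HD u); lra).
      apply Rmult_le_compat_r; [left; apply HDi|].
      apply Rabs_le. unfold D. generalize (pow2_ge_0 (th1 u)) (pow2_ge_0 r); lra. }
    assert (V3 : Rabs (w u) <= / r).
    { unfold w. rewrite Rabs_mult, (Rabs_pos_eq (/ D u)) by (left; apply HDi).
      apply Rmult_le_reg_r with (D u * r); [generalize (HD u); nra|].
      replace (Rabs (th1 u) * / D u * (D u * r)) with (Rabs (th1 u) * r)
        by (field; generalize (HD u); lra).
      replace (/ r * (D u * r)) with (D u) by (field; lra).
      (* By [2 |th1| r <= th1^2 + r^2], with a factor 2 to spare. *)
      unfold D. rewrite <- (pow2_abs (th1 u)). nra. }
    eapply Rle_trans; [apply Cmod_triangle|]. apply Rplus_le_compat.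
    (* Two terms of size [V N] give the [2 PI] of the constant; the [+ 1] comes from the term with
       [A']. *)
    - rewrite !Cmod_mult. unfold E; rewrite Cmod_expi, Rmult_1_l.
      replace (2 * N * V u) with ((V u + V u) * N) by ring.
      apply Rmult_le_compat; [apply Cmod_ge_0 | exact HA0 | | exact HA].
      eapply Rle_trans; [apply Cmod_triangle|].
      rewrite Cmod_mult, Cmod_Ci, !Cmod_R, Rmult_1_l. apply Rplus_le_compat; [|exact V2].
      rewrite Rabs_pos_eq; [exact V1|]. apply Rmult_le_pos; [apply pow2_ge_0 | left; apply HDi].
    - rewrite !Cmod_mult. unfold E; rewrite Cmod_expi, Cmod_Ci, Cmod_R, !Rmult_1_l.
      apply Rmult_le_compat_r; [exact HA'0 | exact V3]. }
  assert (EI : RInt (fun u => 2 * N * V u + / r * Cmod (A' u)) (- L) L =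
             2 * N * RInt V (- L) L + / r * N).
  { apply is_RInt_unique. apply (is_RInt_plus (V := R_NormedModule));
    apply (is_RInt_scal (V := R_NormedModule));
    apply (RInt_correct (V := R_CompleteNormedModule)); now apply ex_RInt_cont. }
  eapply Rle_trans; [apply Req_le; exact EI|]. rewrite IV.
  assert (Hat : k * (atan (th1 L / r) - atan (th1 (- L) / r)) <= PI).
  { eapply Rle_trans; [apply Rle_abs|]. rewrite Rabs_mult, Hk, Rmult_1_l.
    apply Rabs_le. generalize (atan_bound (th1 L / r)) (atan_bound (th1 (- L) / r)); lra. }
  assert (Hri : 0 < / r) by now apply Rinv_0_lt_compat.
  replace ((2 * PI + 1) / r * N) with (2 * N * (/ r * PI) + / r * N) by (field; lra).
  apply Rplus_le_compat_r. apply Rmult_le_compat_l; [lra|].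
  replace (k * / r * (atan (th1 L / r) - atan (th1 (- L) / r))) with
    (/ r * (k * (atan (th1 L / r) - atan (th1 (- L) / r)))) by ring.
  apply Rmult_le_compat_l; lra.
Qed.

(** * Decay of the oscillatory integral *)

Lemma smooth1_Derive_n h k : smooth1 h -> smooth1 (Derive_n h k).
Proof.
  intros H; induction k as [|k IH]; [exact H|]. exact (smooth1_Derive _ IH).
Qed.

(** If [h''] took both signs it would vanish somewhere, by the intermediate value theorem, against
    the lower bound. *)
Lemma constant_sign h d : smooth1 h -> 0 < d ->
  (forall x, d <= Rabs (Derive_n h 2 x)) ->
  exists k, (k = 1 \/ k = - 1) /\ forall x, d <= k * Derive_n h 2 x.
Proof.
  intros Hh Hd Hb.
  set (h2 := Derive_n h 2) in *.
  assert (Hc : continuity h2).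
  { intros x; apply continuity_pt_filterlim.
    apply (smooth1_cont h2 (smooth1_Derive_n h 2 Hh) x). }
  assert (Hn : forall x y, h2 x < 0 -> 0 < h2 y -> False).
  { intros x y Hx Hy.
    destruct (IVT_gen h2 x y 0 Hc) as [z [_ Hz]].
    - rewrite Rmin_left, Rmax_right by lra; lra.
    - specialize (Hb z). rewrite Hz, Rabs_R0 in Hb. lra. }
  destruct (Rlt_dec 0 (h2 0)) as [H0|H0].
  - exists 1; split; [now left|]. intros x. specialize (Hb x).
    destruct (Rle_dec 0 (h2 x)) as [Hx|Hx].
    + rewrite Rabs_pos_eq in Hb; lra.
    + exfalso; apply (Hn x 0); lra.
  - exists (-1); split; [now right|]. intros x.
    assert (Hb0 := Hb 0). specialize (Hb x).
    destruct (Rle_dec (h2 x) 0) as [Hx|Hx].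
    + rewrite Rabs_left1 in Hb; lra.
    + exfalso; apply (Hn 0 x); [|lra]. rewrite Rabs_left1 in Hb0; lra.
Qed.

Lemma is_derive_phase_fst a b c t x s z e : smooth1 a -> smooth1 b ->
  is_derive (fun z => phase a b c t x s z e) z
    (x + t * Derive a (z + e) + s * (- Derive a (z + e) + Derive b z)).
Proof.
  intros Ha Hb. unfold phase.
  assert (Ea : forall y, ex_derive a y) by (intros; exact (Ha 1%nat y)).
  assert (Eb : forall y, ex_derive b y) by (intros; exact (Hb 1%nat y)).
  auto_derive; [repeat split; auto|].
  change (Derive (fun x : R => a x)) with (Derive a).
  change (Derive (fun x : R => b x)) with (Derive b). ring.
Qed.

Lemma is_derive_phase_snd a b c t x s z e : smooth1 a -> smooth1 c ->
  is_derive (fun e => phase a b c t x s z e) e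
    (x + t * Derive a (z + e) + s * (- Derive a (z + e) + Derive c e)).
Proof.
  intros Ha Hb. unfold phase.
  assert (Ea : forall y, ex_derive a y) by (intros; exact (Ha 1%nat y)).
  assert (Eb : forall y, ex_derive c y) by (intros; exact (Hb 1%nat y)).
  auto_derive; [repeat split; auto|].
  change (Derive (fun x : R => a x)) with (Derive a).
  change (Derive (fun x : R => c x)) with (Derive c). ring.
Qed.

Section Decay.
Variables (a b c : R -> R) (S : R -> R -> Prop) (L k d : R).
Hypotheses (Sa : smooth1 a) (Sb : smooth1 b) (Sc : smooth1 c).
Hypotheses (HL : 0 < L) (Hd : 0 < d) (Hk : Rabs k = 1).
Hypothesis S_closed : open2 (fun z e => ~ S z e).
Hypothesis S_bounded : forall z e, S z e -> Rabs z < L /\ Rabs e < L.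

Let q (z e : R) : R := Derive c e + - Derive b z.

Hypothesis q_neq_0 : forall z e, S z e -> q z e <> 0.
Hypothesis a_convex : forall z, d <= k * Derive_n a 2 z.
Hypothesis b_convex : forall z, d <= k * Derive_n b 2 z.

(** Vanishing is asked off one fixed set [S], not off the support of each function, so that the
    class is stable under [ibp] and the integration by parts can be iterated. Complex amplitudes are
    split into components at the end. *)
Definition amplitude (P : R -> R -> R) : Prop :=
  (forall n, Ck n everywhere P) /\ forall z e, ~ S z e -> P z e = 0.

(** Absence of space resonances means that the open sets [q <> 0] and complement of [S] cover the
    plane. The quotient is smooth on the first and 0 on the second. *)
Lemma amplitude_quot P : amplitude P -> amplitude (fun z e => P z e * / q z e).
Proof.
  intros [HP Z]; split; [|intros z e H; rewrite Z by exact H; ring].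
  intros n.
  assert (Cq : forall n D, Ck n D q).
  { intros n' D. apply (Ck_sub n' everywhere); [intros; exact I|].
    apply (Ck_plus n' everywhere open2_everywhere (fun z e => Derive c e) (fun z e => - Derive b z)).
    - apply Ck_snd. now apply smooth1_Derive.
    - apply (Ck_opp n' everywhere (fun z _ => Derive b z) open2_everywhere).
      apply Ck_fst. now apply smooth1_Derive. }
  assert (Oq : open2 (fun z e => q z e <> 0)).
  { intros z e H. apply continuity_2d_pt_neq_0; [|exact H].
    apply continuous_continuity_2d. apply (Ck_cont 0 everywhere); [apply Cq | exact I]. }
  apply (Ck_sub n (fun z e => q z e <> 0 \/ ~ S z e)).
  { intros z e _. destruct (classic (S z e)); [left; auto | now right]. }
  apply Ck_union.
  - apply Ck_mult; [exact Oq | | now apply Ck_inv].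
    apply (Ck_sub n everywhere); [intros; exact I | apply HP].
  - apply (Ck_ext n _ S_closed (fun _ _ => 0)); [|apply Ck_const].
    intros z e H; rewrite Z by exact H; ring.
Qed.

Lemma amplitude_pd1 P : amplitude P -> amplitude (pd1 P).
Proof.
  intros [HP Z]; split; [intros n; apply (HP (Datatypes.S n))|].
  intros z e H. unfold pd1. rewrite <- (Derive_const 0 z).
  apply Derive_ext_loc. generalize (locally_2d_fst _ _ _ (S_closed z e H)).
  apply filter_imp; intros; now apply Z.
Qed.

Lemma amplitude_pd2 P : amplitude P -> amplitude (pd2 P).
Proof.
  intros [HP Z]; split; [intros n; apply (HP (Datatypes.S n))|].
  intros z e H. unfold pd2. rewrite <- (Derive_const 0 e).
  apply Derive_ext_loc. generalize (locally_2d_snd _ _ _ (S_closed z e H)).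
  apply filter_imp; intros; now apply Z.
Qed.

(* The transpose of [(d/de - d/dz) / q]; since the phase is the sum of a function of
   [z + e] and of [s (b z + c e)], applying [d/de - d/dz] to its exponential produces
   the factor [i s q]. *)
Definition ibp (P : R -> R -> R) : R -> R -> R :=
  let Q := fun z e => P z e * / q z e in fun z e => pd2 Q z e + - pd1 Q z e.

Lemma amplitude_ibp P : amplitude P -> amplitude (ibp P).
Proof.
  intros HP. assert (HQ := amplitude_quot P HP).
  destruct (amplitude_pd1 _ HQ) as [C1 Z1]. destruct (amplitude_pd2 _ HQ) as [C2 Z2].
  split.
  - intros n. apply (Ck_plus n everywhere open2_everywhere); [apply C2|].
    apply (Ck_opp n everywhere _ open2_everywhere), C1.
  - intros z e H; unfold ibp. rewrite Z1, Z2 by exact H. ring.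
Qed.

Lemma amplitude_cont P : amplitude P ->
  forall p : R * R, continuous (fun p : R * R => P (fst p) (snd p)) p.
Proof. intros [HP _] [z e]. apply (Ck_cont 0 everywhere _ (HP 0%nat)). exact I. Qed.

Lemma amplitude_edge P z e : amplitude P -> L <= Rabs z \/ L <= Rabs e -> P z e = 0.
Proof. intros [_ Z] H; apply Z; intros HS; destruct (S_bounded z e HS); lra. Qed.

Definition CInt2 (F : R -> R -> C) : C :=
  CInt (fun z => CInt (fun e => F z e) (- L) L) (- L) L.

Lemma Ccont_slice_2 (F : R -> R -> C) z :
  Ccont (fun p : R * R => F (fst p) (snd p)) -> Ccont (F z).
Proof. intros H; apply (Ccont_slice (fun p : R * R => F (fst p) (snd p)) z H). Qed.

Lemma Ccont_CInt_2 (F : R -> R -> C) :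
  Ccont (fun p : R * R => F (fst p) (snd p)) ->
  Ccont (fun z => CInt (fun e => F z e) (- L) L).
Proof. intros H; apply (Ccont_CInt_param (fun p : R * R => F (fst p) (snd p)) _ _ H). Qed.

Lemma CInt2_plus (F G : R -> R -> C) :
  Ccont (fun p : R * R => F (fst p) (snd p)) ->
  Ccont (fun p : R * R => G (fst p) (snd p)) ->
  CInt2 (fun z e => Cplus (F z e) (G z e)) = Cplus (CInt2 F) (CInt2 G).
Proof.
  intros HF HG. unfold CInt2.
  rewrite <- CInt_plus by (now apply Ccont_CInt_2).
  apply CInt_ext; intros z. apply CInt_plus; now apply Ccont_slice_2.
Qed.

Lemma CInt2_minus (F G : R -> R -> C) :
  Ccont (fun p : R * R => F (fst p) (snd p)) ->
  Ccont (fun p : R * R => G (fst p) (snd p)) ->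
  CInt2 (fun z e => Cminus (F z e) (G z e)) = Cminus (CInt2 F) (CInt2 G).
Proof.
  intros HF HG. unfold CInt2.
  rewrite <- CInt_minus by (now apply Ccont_CInt_2).
  apply CInt_ext; intros z. apply CInt_minus; now apply Ccont_slice_2.
Qed.

Lemma CInt2_mult_l w (F : R -> R -> C) :
  Ccont (fun p : R * R => F (fst p) (snd p)) ->
  CInt2 (fun z e => Cmult w (F z e)) = Cmult w (CInt2 F).
Proof.
  intros HF. unfold CInt2.
  rewrite <- CInt_mult_l by (now apply Ccont_CInt_2).
  apply CInt_ext; intros z. apply CInt_mult_l; now apply Ccont_slice_2.
Qed.

Definition osc_int (t x s : R) (A : R -> R -> C) : C :=
  CInt2 (fun z e => Cmult (expi (phase a b c t x s z e)) (A z e)).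

Let Ca : forall y, continuous a y. Proof. now apply smooth1_cont. Qed.
Let Cb : forall y, continuous b y. Proof. now apply smooth1_cont. Qed.
Let Cc : forall y, continuous c y. Proof. now apply smooth1_cont. Qed.
Let Ca1 : forall y, continuous (Derive a) y.
Proof. apply smooth1_cont. now apply smooth1_Derive. Qed.
Let Cb1 : forall y, continuous (Derive b) y.
Proof. apply smooth1_cont. now apply smooth1_Derive. Qed.
Let Cc1 : forall y, continuous (Derive c) y.
Proof. apply smooth1_cont. now apply smooth1_Derive. Qed.

Lemma Ccont_expi_phase t x s :
  Ccont (fun p : R * R => expi (phase a b c t x s (fst p) (snd p))).
Proof. apply Ccont_expi; unfold phase; cont. Qed.

(** With [Q = P / q], the derivatives of [E Q] in [e] and in [z] both have integral 0, and their
    difference is [i s E P + E (ibp P)]; hence an equality of moduli. *)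
Lemma osc_int_ibp t x s P : amplitude P -> 0 <= s ->
  s * Cmod (osc_int t x s (fun z e => RtoC (P z e))) =
  Cmod (osc_int t x s (fun z e => RtoC (ibp P z e))).
Proof.
  intros HP Hs. assert (HQ := amplitude_quot P HP).
  assert (HQ1 := amplitude_pd1 _ HQ). assert (HQ2 := amplitude_pd2 _ HQ).
  assert (HI := amplitude_cont _ (amplitude_ibp P HP)).
  assert (CP := amplitude_cont P HP). assert (CQ := amplitude_cont _ HQ).
  assert (CQ1 := amplitude_cont _ HQ1). assert (CQ2 := amplitude_cont _ HQ2).
  set (Q := fun z e => P z e * / q z e) in *.
  assert (DQ : forall z e, ex_derive (fun z' => Q z' e) z /\ ex_derive (fun e' => Q z e') e).
  { intros z e. destruct HQ as [HQ _]. destruct (HQ 1%nat) as [_ [H _]]. now apply H. }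
  set (E := fun z e => expi (phase a b c t x s z e)).
  assert (CE : Ccont (fun p : R * R => E (fst p) (snd p))) by apply Ccont_expi_phase.
  set (t1 := fun z e => x + t * Derive a (z + e) + s * (- Derive a (z + e) + Derive b z)).
  set (t2 := fun z e => x + t * Derive a (z + e) + s * (- Derive a (z + e) + Derive c e)).
  assert (Ct1 : forall p, continuous (fun p : R * R => t1 (fst p) (snd p)) p)
    by (unfold t1; cont).
  assert (Ct2 : forall p, continuous (fun p : R * R => t2 (fst p) (snd p)) p)
    by (unfold t2; cont).
  set (F1 := fun z e => Cplus (Cmult (Cmult (Cmult Ci (RtoC (t1 z e))) (E z e)) (RtoC (Q z e)))
                          (Cmult (E z e) (RtoC (pd1 Q z e)))).
  set (F2 := fun z e => Cplus (Cmult (Cmult (Cmult Ci (RtoC (t2 z e))) (E z e)) (RtoC (Q z e)))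
                          (Cmult (E z e) (RtoC (pd2 Q z e)))).
  assert (CF1 : Ccont (fun p : R * R => F1 (fst p) (snd p))) by (unfold F1; ccont).
  assert (CF2 : Ccont (fun p : R * R => F2 (fst p) (snd p))) by (unfold F2; ccont).
  assert (HLL : L <= Rabs L) by (rewrite Rabs_pos_eq; lra).
  assert (HLm : L <= Rabs (- L)) by (rewrite Rabs_Ropp; exact HLL).
  assert (I2 : CInt2 F2 = 0%C).
  { unfold CInt2. rewrite (CInt_ext _ (fun _ => 0%C)); [apply CInt_zero|]. intros z.
    rewrite (CInt_FTC (fun e => Cmult (E z e) (RtoC (Q z e)))).
    - rewrite !(amplitude_edge Q) by (auto; now right). ring.
    - intros e. apply (Cder_mult (fun e => E z e) (fun e => RtoC (Q z e))).
      + apply (Cder_expi (fun e => phase a b c t x s z e)). now apply is_derive_phase_snd.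
      + apply (Cder_RtoC (fun e => Q z e)), Derive_correct. exact (proj2 (DQ z e)).
    - now apply Ccont_slice_2. }
  assert (I1 : CInt2 F1 = 0%C).
  (* The order is exchanged so that the derivative in [z] is integrated in [z] first. *)
  { unfold CInt2. rewrite (CInt_Fubini F1) by exact CF1.
    rewrite (CInt_ext _ (fun _ => 0%C)); [apply CInt_zero|]. intros e.
    rewrite (CInt_FTC (fun z => Cmult (E z e) (RtoC (Q z e)))).
    - rewrite !(amplitude_edge Q) by (auto; now left). ring.
    - intros z. apply (Cder_mult (fun z => E z e) (fun z => RtoC (Q z e))).
      + apply (Cder_expi (fun z => phase a b c t x s z e)). now apply is_derive_phase_fst.
      + apply (Cder_RtoC (fun z => Q z e)), Derive_correct. exact (proj1 (DQ z e)).
    - apply (Ccont_slice_2 (fun e z => F1 z e)). ccont. }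
  assert (CEP : Ccont (fun p : R * R => Cmult (E (fst p) (snd p)) (RtoC (P (fst p) (snd p)))))
    by ccont.
  assert (CEI : Ccont (fun p : R * R => Cmult (E (fst p) (snd p)) (RtoC (ibp P (fst p) (snd p)))))
    by ccont.
  assert (Sum : Cplus (Cmult (Cmult Ci (RtoC s)) (osc_int t x s (fun z e => RtoC (P z e))))
                      (osc_int t x s (fun z e => RtoC (ibp P z e))) = 0%C).
  { transitivity (Cminus (CInt2 F2) (CInt2 F1)); [|rewrite I1, I2; ring].
    rewrite <- CInt2_minus by assumption.
    transitivity (CInt2 (fun z e => Cplus
      (Cmult (Cmult Ci (RtoC s)) (Cmult (E z e) (RtoC (P z e))))
      (Cmult (E z e) (RtoC (ibp P z e))))).
    - rewrite (CInt2_plus (fun z e => Cmult (Cmult Ci (RtoC s)) (Cmult (E z e) (RtoC (P z e))))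
        (fun z e => Cmult (E z e) (RtoC (ibp P z e)))); 
        [| apply Ccont_mult; [apply Ccont_const | exact CEP] | exact CEI].
      rewrite (CInt2_mult_l (Cmult Ci (RtoC s)) (fun z e => Cmult (E z e) (RtoC (P z e))) CEP).
      reflexivity.
    - apply CInt_ext; intros z; apply CInt_ext; intros e.
      unfold F1, F2.
      (* A zero of [q] lies off [S], where [P] is 0, so the identity survives the division by 0. *)
      assert (EP : P z e = q z e * Q z e).
      { unfold Q. destruct (Req_dec (q z e) 0) as [Hq|Hq]; [|field; exact Hq].
        rewrite Hq. destruct HP as [_ Z]. rewrite Z; [ring|].
        intros HS; now apply (q_neq_0 z e). }
      (* All terms with [x] and [a] depend on [z + e] alone and cancel. *)
      assert (Et : t2 z e - t1 z e = s * q z e) by (unfold t1, t2, q; ring).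
      change (ibp P z e) with (pd2 Q z e + - pd1 Q z e). rewrite EP.
      replace (t2 z e) with (t1 z e + s * q z e) by lra.
      rewrite !RtoC_plus, !RtoC_mult, RtoC_opp. ring. }
  replace (osc_int t x s (fun z e => RtoC (ibp P z e))) with
    (Copp (Cmult (Cmult Ci (RtoC s)) (osc_int t x s (fun z e => RtoC (P z e))))).
  - rewrite Cmod_opp, !Cmod_mult, Cmod_Ci, Cmod_R, Rabs_pos_eq by exact Hs. ring.
  - rewrite <- (Cplus_0_r (Copp _)), <- Sum. ring.
Qed.

(** Van der Corput's lemma in [z] at each fixed [e], with [r^2 = t d]. Its bound sees the phase only
    through [r], which makes the constant independent of [x] and [s]. *)
Lemma osc_int_dispersion P : amplitude P -> exists C0, 0 <= C0 /\ forall t x s,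
  0 < t -> 0 <= s <= t ->
  Cmod (osc_int t x s (fun z e => RtoC (P z e))) <= C0 / sqrt t.
Proof.
  intros HP. assert (HP1 := amplitude_pd1 P HP).
  assert (CP := amplitude_cont P HP). assert (CP1 := amplitude_cont _ HP1).
  set (I := fun e => RInt (fun z => Cmod (RtoC (pd1 P z e))) (- L) L).
  assert (CI1 : Ccont (fun p : R * R => RtoC (pd1 P (fst p) (snd p)))) by now apply Ccont_RtoC.
  assert (CI : forall e, continuous I e).
  { apply (cont_RInt_param (fun p : R * R => Cmod (RtoC (pd1 P (snd p) (fst p))))).
    intros p. apply (Ccont_Cmod (fun p : R * R => RtoC (pd1 P (snd p) (fst p)))).
    apply (Ccont_comp_2 (fun z e => RtoC (pd1 P z e)) snd fst CI1); cont. }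
  assert (Sl : forall (F : R -> R -> R) e,
    (forall p : R * R, continuous (fun p : R * R => F (fst p) (snd p)) p) ->
    forall z, continuous (fun z => F z e) z).
  { intros F e HF z. apply (continuous_comp (fun z => (z, e)) (fun p : R * R => F (fst p) (snd p)));
    [cont | apply HF]. }
  assert (Hsd : 0 < sqrt d) by now apply sqrt_lt_R0.
  assert (HI0 : 0 <= RInt I (- L) L).
  { apply RInt_ge_0_cont; [lra | exact CI |]. intros e. unfold I.
    apply RInt_ge_0_cont; [lra | | intros; apply Cmod_ge_0].
    intros z; apply (Ccont_Cmod (fun z => RtoC (pd1 P z e))). apply Ccont_RtoC; now apply Sl. }
  assert (HPI := PI_RGT_0).
  exists ((2 * PI + 1) / sqrt d * RInt I (- L) L); split.
  { apply Rmult_le_pos; [|exact HI0]. apply Rmult_le_pos; [lra|].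
    left; now apply Rinv_0_lt_compat. }
  intros t x s Ht Hs.
  assert (Hst : 0 < sqrt t) by now apply sqrt_lt_R0.
  assert (CE := Ccont_expi_phase t x s).
  unfold osc_int, CInt2.
  assert (CEP : Ccont (fun p : R * R =>
    Cmult (expi (phase a b c t x s (fst p) (snd p))) (RtoC (P (fst p) (snd p))))) by ccont.
  rewrite (CInt_Fubini (fun z e => Cmult (expi (phase a b c t x s z e)) (RtoC (P z e)))) by exact CEP.
  set (r := sqrt t * sqrt d).
  assert (Hr : 0 < r) by (unfold r; nra).
  eapply Rle_trans.
  { apply (CInt_bound _ (fun e => (2 * PI + 1) / r * I e)); [lra | | cont |].
    - apply (Ccont_CInt_param (fun p : R * R =>
        Cmult (expi (phase a b c t x s (snd p) (fst p))) (RtoC (P (snd p) (fst p))))).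
      apply (Ccont_comp_2 (fun z e => Cmult (expi (phase a b c t x s z e)) (RtoC (P z e)))
        snd fst CEP); cont.
    - intros e _.
      apply (van_der_Corput (fun z => phase a b c t x s z e)
        (fun z => x + t * Derive a (z + e) + s * (- Derive a (z + e) + Derive b z))
        (fun z => t * Derive_n a 2 (z + e) + s * (- Derive_n a 2 (z + e) + Derive_n b 2 z))
        (fun z => RtoC (P z e)) (fun z => RtoC (pd1 P z e)) k r L); auto; try lra.
      + intros z. now apply is_derive_phase_fst.
      + intros z. assert (Sa1 := smooth1_Derive a Sa). assert (Sb1 := smooth1_Derive b Sb).
        assert (Ea : forall y, ex_derive (Derive a) y) by (intros; exact (Sa1 1%nat y)).
        assert (Eb : forall y, ex_derive (Derive b) y) by (intros; exact (Sb1 1%nat y)).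
        auto_derive; [repeat split; auto|].
        change (Derive (fun x : R => Derive a x)) with (Derive_n a 2).
        change (Derive (fun x : R => Derive b x)) with (Derive_n b 2). ring.
      + assert (Ca2 := smooth1_cont _ (smooth1_Derive_n a 2 Sa)).
        assert (Cb2 := smooth1_cont _ (smooth1_Derive_n b 2 Sb)). cont.
      (* [k] times the second derivative is [(t - s) k a'' + s k b'']; as [0 <= s <= t], this is at
         least [(t - s) d + s d]. *)
      + intros z. generalize (a_convex (z + e)) (b_convex z); intros A1 A2.
        replace (r ^ 2) with (t * d).
        2: { unfold r. rewrite Rpow_mult_distr, !pow2_sqrt by lra. reflexivity. }
        nra.
      + intros z. apply (Cder_RtoC (fun z => P z e)), Derive_correct.
        destruct HP as [HP _]. destruct (HP 1%nat) as [_ [H _]]. exact (proj1 (H z e Logic.I)).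
      + apply Ccont_RtoC. now apply Sl.
      + rewrite (amplitude_edge P); [reflexivity | exact HP | left].
        rewrite Rabs_Ropp, Rabs_pos_eq; lra.
      + rewrite (amplitude_edge P); [reflexivity | exact HP | left].
        rewrite Rabs_pos_eq; lra. }
  apply Req_le.
  transitivity ((2 * PI + 1) / r * RInt I (- L) L).
  - apply is_RInt_unique. apply (is_RInt_scal (V := R_NormedModule)).
    apply (RInt_correct (V := R_CompleteNormedModule)). now apply ex_RInt_cont.
  - unfold r. field. split; lra.
Qed.

Lemma osc_int_decay n : forall P, amplitude P -> exists C0, 0 <= C0 /\ forall t x s,
  0 < t -> 0 <= s <= t ->
  s ^ n * Cmod (osc_int t x s (fun z e => RtoC (P z e))) <= C0 / sqrt t.
Proof.
  induction n as [|n IH]; intros P HP.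
  - destruct (osc_int_dispersion P HP) as [C0 [H0 H]]; exists C0; split; [exact H0|].
    intros t x s Ht Hs. rewrite pow_O, Rmult_1_l. exact (H t x s Ht Hs).
  - destruct (IH (ibp P) (amplitude_ibp P HP)) as [C0 [H0 H]]; exists C0; split; [exact H0|].
    intros t x s Ht Hs. specialize (H t x s Ht Hs).
    rewrite <- (osc_int_ibp t x s P HP (proj1 Hs)) in H. rewrite <- tech_pow_Rmult. lra.
Qed.

Lemma osc_int_decay_C n (A : R -> R -> C) :
  amplitude (fun z e => Re (A z e)) -> amplitude (fun z e => Im (A z e)) ->
  exists C0, 0 <= C0 /\ forall t x s, 0 < t -> 0 <= s <= t ->
  s ^ n * Cmod (osc_int t x s A) <= C0 / sqrt t.
Proof.
  intros HR HI.
  destruct (osc_int_decay n _ HR) as [C1 [P1 H1]].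
  destruct (osc_int_decay n _ HI) as [C2 [P2 H2]].
  assert (CR := amplitude_cont _ HR). assert (CI := amplitude_cont _ HI).
  exists (C1 + C2); split; [lra|]. intros t x s Ht Hs.
  specialize (H1 t x s Ht Hs). specialize (H2 t x s Ht Hs).
  assert (CE := Ccont_expi_phase t x s).
  assert (E : osc_int t x s A = Cplus (osc_int t x s (fun z e => RtoC (Re (A z e))))
                (Cmult Ci (osc_int t x s (fun z e => RtoC (Im (A z e)))))).
  { unfold osc_int.
    rewrite <- CInt2_mult_l by ccont. rewrite <- CInt2_plus by ccont.
    apply CInt_ext; intros z; apply CInt_ext; intros e.
    replace (A z e) with (Cplus (RtoC (Re (A z e))) (Cmult Ci (RtoC (Im (A z e))))) at 1
      by (apply Ceq; simpl; ring).
    ring. }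
  rewrite E.
  assert (Hp : 0 <= s ^ n) by (apply pow_le; lra).
  eapply Rle_trans; [apply Rmult_le_compat_l; [exact Hp | apply Cmod_triangle]|].
  rewrite Cmod_mult, Cmod_Ci. unfold Rdiv in *. lra.
Qed.

End Decay.

(** * Proof of the theorem *)

Definition CkC (n : nat) (D : R -> R -> Prop) (F : R -> R -> C) : Prop :=
  Ck n D (fun x y => Re (F x y)) /\ Ck n D (fun x y => Im (F x y)).

Lemma CkC_mult n D (F G : R -> R -> C) : open2 D ->
  CkC n D F -> CkC n D G -> CkC n D (fun x y => Cmult (F x y) (G x y)).
Proof.
  intros HD [F1 F2] [G1 G2]; split.
  - apply (Ck_ext n D HD (fun x y => Re (F x y) * Re (G x y) + - (Im (F x y) * Im (G x y)))).
    + intros; simpl; unfold Re, Im; ring.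
    + apply Ck_plus; [exact HD | now apply Ck_mult | apply Ck_opp; [exact HD | now apply Ck_mult]].
  - apply (Ck_ext n D HD (fun x y => Re (F x y) * Im (G x y) + Im (F x y) * Re (G x y))).
    + intros; simpl; unfold Re, Im; ring.
    + apply Ck_plus; [exact HD | now apply Ck_mult | now apply Ck_mult].
Qed.

Lemma CkC_symbol n (F G : R -> C) (m : R -> R -> C) :
  Csmooth F -> Csmooth G ->
  smooth2 (fun x y => Re (m x y)) -> smooth2 (fun x y => Im (m x y)) ->
  CkC n everywhere (fun z e => Cmult (Cmult (F z) (G e)) (m z e)).
Proof.
  intros [F1 F2] [G1 G2] M1 M2. apply CkC_mult; [apply open2_everywhere | |].
  - apply CkC_mult; [apply open2_everywhere | split | split].
    + now apply (Ck_fst n everywhere (fun z => Re (F z))).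
    + now apply (Ck_fst n everywhere (fun z => Im (F z))).
    + now apply (Ck_snd n everywhere (fun e => Re (G e))).
    + now apply (Ck_snd n everywhere (fun e => Im (G e))).
  - split; now apply Ck_smooth2.
Qed.

Lemma in_supp_closed (h : R -> R -> C) : open2 (fun x y => ~ in_supp h x y).
Proof.
  intros x y H.
  assert (He : exists eps, 0 < eps /\ forall u v,
            Rabs (u - x) < eps -> Rabs (v - y) < eps -> h u v = 0%C).
  { apply NNPP; intros Hn. apply H. intros eps Heps. apply NNPP; intros Hn'.
    apply Hn; exists eps; split; [exact Heps|]. intros u v Hu Hv. apply NNPP; intros Hh.
    apply Hn'. now exists u, v. }
  destruct He as [eps [Heps Hz]].
  assert (He2 : 0 < eps / 2) by lra.
  exists (mkposreal _ He2); simpl; intros u v Hu Hv Hs.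
  destruct (Hs _ He2) as [u' [v' [Hu' [Hv' Hn]]]]. apply Hn, Hz.
  - replace (u' - x) with ((u' - u) + (u - x)) by ring.
    eapply Rle_lt_trans; [apply Rabs_triang|]. lra.
  - replace (v' - y) with ((v' - v) + (v - y)) by ring.
    eapply Rle_lt_trans; [apply Rabs_triang|]. lra.
Qed.

Lemma in_supp_neq_0 (h : R -> R -> C) x y : h x y <> 0%C -> in_supp h x y.
Proof.
  intros H eps Heps; exists x, y. rewrite !Rminus_diag, Rabs_R0. auto.
Qed.

(** [mu] is [m] in the sheared coordinates, [mu m (z + e) e = m z e]; [eps / 2] is kept for each
    summand of the first coordinate. *)
Lemma in_supp_mu m z e : in_supp m z e -> in_supp (mu m) (z + e) e.
Proof.
  intros H eps Heps. destruct (H (eps / 2) ltac:(lra)) as [x [y [Hx [Hy Hn]]]].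
  exists (x + y), y; repeat split; [| lra |].
  - replace (x + y - (z + e)) with ((x - z) + (y - e)) by ring.
    eapply Rle_lt_trans; [apply Rabs_triang|]. lra.
  - unfold mu. replace (x + y - y) with x by ring. exact Hn.
Qed.

Lemma Derive_Phi_eta a b c xi eta : smooth1 a -> smooth1 b -> smooth1 c ->
  Derive (fun e => Phi a b c xi e) eta = Derive c eta + - Derive b (xi - eta).
Proof.
  intros Ha Hb Hc. apply is_derive_unique. unfold Phi.
  assert (Eb : forall y, ex_derive b y) by (intros; exact (Hb 1%nat y)).
  assert (Ec : forall y, ex_derive c y) by (intros; exact (Hc 1%nat y)).
  auto_derive; [repeat split; auto|].
  change (Derive (fun x : R => b x)) with (Derive b).
  change (Derive (fun x : R => c x)) with (Derive c). unfold Rminus. ring.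
Qed.

(** The term [X * xi] is linear in [xi] and [c] depends on [eta] only. What is left interpolates
    between [a''] and [b'']; at [sigma = s / t] it is the second derivative of the phase divided by
    [t]. *)
Lemma Derive_2_psi a b c X eta sigma xi : smooth1 a -> smooth1 b ->
  Derive_n (fun x => psi a b c X x eta sigma) 2 xi =
  (1 - sigma) * Derive_n a 2 xi + sigma * Derive_n b 2 (xi - eta).
Proof.
  intros Ha Hb.
  change (Derive (Derive (fun x => psi a b c X x eta sigma)) xi =
    (1 - sigma) * Derive (Derive a) xi + sigma * Derive (Derive b) (xi - eta)).
  assert (Ha1 := smooth1_Derive a Ha). assert (Hb1 := smooth1_Derive b Hb).
  assert (Ea : forall y, ex_derive a y) by (intros; exact (Ha 1%nat y)).
  assert (Eb : forall y, ex_derive b y) by (intros; exact (Hb 1%nat y)).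
  assert (Ea1 : forall y, ex_derive (Derive a) y) by (intros; exact (Ha1 1%nat y)).
  assert (Eb1 : forall y, ex_derive (Derive b) y) by (intros; exact (Hb1 1%nat y)).
  rewrite (Derive_ext _ (fun x => (1 - sigma) * Derive a x + sigma * Derive b (x - eta) + X)).
  - apply is_derive_unique. auto_derive; [repeat split; auto|].
    change (Derive (fun x : R => Derive a x)) with (Derive (Derive a)).
    change (Derive (fun x : R => Derive b x)) with (Derive (Derive b)).
    change (Derive (fun x : R => a x)) with (Derive a).
    change (Derive (fun x : R => b x)) with (Derive b). unfold Rminus. ring.
  - intros x. apply is_derive_unique. unfold psi, Phi. auto_derive; [repeat split; auto|].
    change (Derive (fun x : R => a x)) with (Derive a).
    change (Derive (fun x : R => b x)) with (Derive b). unfold Rminus. ring.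
Qed.

(** With opposite signs, the interpolation from [A] to [B] would vanish at [sigma = A / (A - B)], a
    point of [[0, 1]]. *)
Lemma segment_same_sign A B k l :
  (k = 1 \/ k = -1) -> (l = 1 \/ l = -1) -> 0 < k * A -> 0 < l * B ->
  (forall sigma, 0 <= sigma <= 1 -> (1 - sigma) * A + sigma * B <> 0) -> k = l.
Proof.
  intros Hk Hl HA HB H.
  destruct (Req_dec k l) as [E|E]; [exact E|]. exfalso.
  assert (Hs : A - B <> 0) by (destruct Hk, Hl; subst; lra).
  apply (H (A / (A - B))); [|field; exact Hs].
  assert (Hpos : 0 < k * (A - B)) by (destruct Hk, Hl; subst; lra).
  assert (Hk2 : k <> 0) by (destruct Hk; lra).
  (* The factor [k] makes numerator and denominator positive. *)
  replace (A / (A - B)) with ((k * A) / (k * (A - B))) by (field; auto).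
  split.
  - apply Rmult_le_pos; [lra | left; now apply Rinv_0_lt_compat].
  - apply Rmult_le_reg_r with (k * (A - B)); [exact Hpos|].
    unfold Rdiv; rewrite Rmult_assoc, Rinv_l by lra. destruct Hk, Hl; subst; lra.
Qed.

(** The weight [1 + s^2] combines decay of orders [N] and [N + 2]; it will make the integral over
    [s] converge with a bound independent of [t] and [M]. *)
Lemma osc_int_weighted_decay (a b c : R -> R) (m : R -> R -> C) (f g : R -> C) (L : R) :
  0 < L ->
  smooth1 a -> smooth1 b -> smooth1 c ->
  second_deriv_away_from_zero a -> second_deriv_away_from_zero b ->
  smooth2 (fun x y => Re (m x y)) -> smooth2 (fun x y => Im (m x y)) ->
  (forall z e, in_supp m z e -> Rabs z < L /\ Rabs e < L) ->
  (forall xi eta, in_supp (mu m) xi eta -> Derive (fun e => Phi a b c xi e) eta <> 0) ->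
  (forall X xi eta sigma, in_supp (mu m) xi eta -> 0 <= sigma <= 1 ->
     Derive_n (fun x => psi a b c X x eta sigma) 2 xi <> 0) ->
  Csmooth (FT f) -> Csmooth (FT g) ->
  forall N : nat, exists C0, 0 <= C0 /\ forall t x s, 0 < t -> 0 <= s <= t ->
    s ^ N * ((1 + s ^ 2) *
      Cmod (osc_int a b c L t x s (fun z e => Cmult (Cmult (FT f z) (FT g e)) (m z e))))
    <= C0 / sqrt t.
Proof.
  intros HL Ha Hb Hc [da [Hda Ka]] [db [Hdb Kb]] Hm1 Hm2 Hbd Hphi Hpsi Hf Hg N.
  set (A := fun z e => Cmult (Cmult (FT f z) (FT g e)) (m z e)).
  destruct (classic (exists z e, in_supp m z e)) as [[z0 [e0 H0]]|Hempty].
  (* With an empty support there is no point at which to compare the signs of [a''] and [b''], but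
     the integral is 0. *)
  2: { exists 0; split; [lra|]. intros t x s Ht Hs.
       replace (osc_int a b c L t x s A) with (RtoC 0).
       - rewrite Cmod_0. unfold Rdiv. rewrite !Rmult_0_r, Rmult_0_l. lra.
       - symmetry. unfold osc_int, CInt2.
         rewrite (CInt_ext _ (fun _ => 0%C)); [apply CInt_zero|]. intros z.
         rewrite (CInt_ext _ (fun _ => 0%C)); [apply CInt_zero|]. intros e.
         unfold A. replace (m z e) with (RtoC 0); [ring|].
         apply NNPP; intros Hn. apply Hempty; exists z, e. apply in_supp_neq_0. auto. }
  destruct (constant_sign a da Ha Hda Ka) as [k [Hk Pk]].
  destruct (constant_sign b db Hb Hdb Kb) as [l [Hl Pl]].
  assert (Ekl : k = l).
  { apply (segment_same_sign (Derive_n a 2 (z0 + e0)) (Derive_n b 2 z0)); auto.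
    - specialize (Pk (z0 + e0)); lra.
    - specialize (Pl z0); lra.
    - intros sigma Hsig.
      replace z0 with (z0 + e0 - e0) at 2 by ring.
      (* The value 0 of [X] is arbitrary: [X * xi] disappears after two derivatives. *)
      rewrite <- (Derive_2_psi a b c 0) by assumption.
      apply Hpsi; [now apply in_supp_mu | exact Hsig]. }
  subst l.
  set (d := Rmin da db).
  assert (Hd : 0 < d) by (unfold d; now apply Rmin_glb_lt).
  assert (Hk1 : Rabs k = 1).
  { destruct Hk as [Hk|Hk]; rewrite Hk; [apply Rabs_R1 | rewrite Rabs_left; lra]. }
  assert (HA : forall n, CkC n everywhere A).
  { intros n. now apply CkC_symbol. }
  assert (HZ : forall z e, ~ in_supp m z e -> A z e = 0%C).
  { intros z e Hn. unfold A. replace (m z e) with (RtoC 0); [ring|].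
    apply NNPP; intros Hn'. apply Hn, in_supp_neq_0. auto. }
  assert (AR : amplitude (in_supp m) (fun z e => Re (A z e))).
  { split; [intros n; apply (HA n) | intros z e Hn; rewrite HZ by exact Hn; reflexivity]. }
  assert (AI : amplitude (in_supp m) (fun z e => Im (A z e))).
  { split; [intros n; apply (HA n) | intros z e Hn; rewrite HZ by exact Hn; reflexivity]. }
  assert (Hq : forall z e, in_supp m z e -> Derive c e + - Derive b z <> 0).
  { intros z e Hs. replace z with (z + e - e) by ring.
    rewrite <- (Derive_Phi_eta a b c) by assumption. apply Hphi. now apply in_supp_mu. }
  assert (Da : forall z, d <= k * Derive_n a 2 z).
  { intros z. eapply Rle_trans; [apply Rmin_l | apply Pk]. }
  assert (Db : forall z, d <= k * Derive_n b 2 z).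
  { intros z. eapply Rle_trans; [apply Rmin_r | apply Pl]. }
  assert (Dec := fun n => osc_int_decay_C a b c (in_supp m) L k d Ha Hb Hc HL Hd Hk1
    (in_supp_closed m) Hbd Hq Da Db n A AR AI).
  destruct (Dec N) as [C1 [P1 H1]]. destruct (Dec (N + 2)%nat) as [C2 [P2 H2]].
  exists (C1 + C2); split; [lra|]. intros t x s Ht Hs.
  specialize (H1 t x s Ht Hs). specialize (H2 t x s Ht Hs).
  rewrite pow_add in H2. unfold Rdiv in *. rewrite Rmult_plus_distr_r.
  set (I := Cmod (osc_int a b c L t x s A)) in *.
  replace (s ^ N * ((1 + s ^ 2) * I)) with (s ^ N * I + s ^ N * s ^ 2 * I) by ring. lra.
Qed.

Theorem theorem2p3 (a b c : R -> R) (m : R -> R -> C) (f g : R -> C) :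
  smooth1 a -> smooth1 b -> smooth1 c ->
  second_deriv_away_from_zero a ->
  second_deriv_away_from_zero b ->
  second_deriv_away_from_zero c ->
  smooth_compact_symbol m ->
  (forall xi eta, in_supp (mu m) xi eta ->
     Derive (fun e => Phi a b c xi e) eta <> 0) ->
  (forall X xi eta sigma, in_supp (mu m) xi eta -> 0 <= sigma <= 1 ->
     Derive_n (fun x => psi a b c X x eta sigma) 2 xi <> 0) ->
  schwartz f -> schwartz g ->
  forall N : nat, exists C0 : R, forall M : R, 0 < M ->
    exists T0 : R, forall t : R, T0 <= t ->
      forall x : R,
        Cmod (Cminus (u_sol a b c m f g t x) (U_M a b c m f g M t x))
          <= C0 / (M ^ N * sqrt t).
Proof.
  intros Ha Hb Hc Ka Kb _ [Hm1 [Hm2 [R0 HR0]]] Hphi Hpsi Hf Hg N.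
  (* [R0] may be negative, hence [Rabs R0]; the [+ 1] puts the support strictly inside the box. *)
  set (L := Rabs R0 + 1).
  assert (HL : 0 < L) by (unfold L; generalize (Rabs_pos R0); lra).
  assert (Hbd : forall z e, in_supp m z e -> Rabs z < L /\ Rabs e < L).
  { intros z e Hs. destruct (Hs 1 Rlt_0_1) as [x [y [Hx [Hy Hn]]]].
    assert (Hxy : Rabs x <= R0 /\ Rabs y <= R0).
    { split; apply Rnot_lt_le; intros Hlt; apply Hn, HR0; auto. }
    generalize (Rle_abs R0) (Rabs_triang_inv z x) (Rabs_triang_inv e y).
    rewrite (Rabs_minus_sym z x), (Rabs_minus_sym e y). unfold L. lra. }
  assert (Sf := Csmooth_FT f (schwartz_rapid f Hf)).
  assert (Sg := Csmooth_FT g (schwartz_rapid g Hg)).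
  destruct (osc_int_weighted_decay a b c m f g L HL Ha Hb Hc Ka Kb Hm1 Hm2 Hbd Hphi Hpsi Sf Sg N)
    as [C0 [HC0 Hdec]].
  set (A := fun z e => Cmult (Cmult (FT f z) (FT g e)) (m z e)) in *.
  assert (PA : forall n, PC n (fun e z => A z e)).
  { intros n. apply (PC_ext n (fun e z => ((Re (A z e), Im (A z e)) : C))).
    - intros; now apply Ceq.
    - assert (HA : CkC n everywhere A) by now apply CkC_symbol.
      apply (PC_of_Ck n (fun z e => Re (A z e)) (fun z e => Im (A z e))); apply HA. }
  assert (ZA : forall z e, L <= Rabs z \/ L <= Rabs e -> A z e = 0%C).
  { intros z e H. unfold A. replace (m z e) with (RtoC 0); [ring|].
    symmetry; apply HR0. generalize (Rle_abs R0). unfold L in H. lra. }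
  (* [PI] bounds the integral of [1 / (1 + s^2)] over [[M, t]]; the threshold [M] is the time from
     which [Rmin t M = M]. *)
  exists (C0 * PI). intros M HM. exists M. intros t Ht x.
  assert (Hst : 0 < sqrt t) by (apply sqrt_lt_R0; lra).
  assert (HMN : 0 < M ^ N) by now apply pow_lt.
  rewrite (duhamel_difference a b c m f g L Ha Hb Hc (Rlt_le _ _ HL) PA ZA M t x Ht).
  rewrite Cmod_mult.
  replace (Cmod (0, -1)) with 1.
  2: { replace ((0, -1) : C) with (Copp Ci) by (apply Ceq; simpl; ring).
       now rewrite Cmod_opp, Cmod_Ci. }
  rewrite Rmult_1_l.
  set (K := C0 / (M ^ N * sqrt t)).
  assert (HK : 0 <= K).
  { apply Rmult_le_pos; [exact HC0|]. left; apply Rinv_0_lt_compat; nra. }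
  eapply Rle_trans.
  { apply (CInt_bound _ (fun s => K * / (1 + s ^ 2))); [exact Ht | | |].
    - assert (CA : Ccont (fun q : R * R => A (fst q) (snd q))).
      { apply (Ccont_comp_2 (fun e z => A z e) snd fst); [exact (PC_cont 0 _ (PA 0%nat)) | cont | cont]. }
      assert (Ca := smooth1_cont a Ha). assert (Cb := smooth1_cont b Hb).
      assert (Cc := smooth1_cont c Hc).
      apply (Ccont_CInt_param (fun q : R * R => CInt (fun e =>
        Cmult (expi (phase a b c t x (fst q) (snd q) e)) (A (snd q) e)) (- L) L)).
      apply (Ccont_CInt_param (fun q : (R * R) * R =>
        Cmult (expi (phase a b c t x (fst (fst q)) (snd (fst q)) (snd q)))
              (A (snd (fst q)) (snd q)))).
      apply Ccont_mult; [|ccont]. unfold phase. apply Ccont_expi. cont.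
    - intros s; apply cont_mult; [cont | apply cont_inv_1_sqr].
    - intros s Hs. specialize (Hdec t x s ltac:(lra) ltac:(lra)).
      change (Cmod (osc_int a b c L t x s A) <= K * / (1 + s ^ 2)).
      set (I := Cmod (osc_int a b c L t x s A)) in *.
      assert (HI : 0 <= I) by apply Cmod_ge_0.
      assert (Hs2 := one_sqr_pos s).
      assert (HMs : M ^ N <= s ^ N) by (apply pow_incr; lra).
      assert (Hle : M ^ N * ((1 + s ^ 2) * I) <= C0 / sqrt t).
      { eapply Rle_trans; [|exact Hdec]. apply Rmult_le_compat_r; [|exact HMs].
        apply Rmult_le_pos; lra. }
      apply Rmult_le_reg_r with (M ^ N * (1 + s ^ 2)); [now apply Rmult_lt_0_compat|].
      replace (K * / (1 + s ^ 2) * (M ^ N * (1 + s ^ 2))) with (C0 / sqrt t).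
      + replace (I * (M ^ N * (1 + s ^ 2))) with (M ^ N * ((1 + s ^ 2) * I)) by ring. exact Hle.
      + unfold K. field. repeat split; lra. }
  rewrite RInt_inv_1_sqr.
  replace (C0 * PI / (M ^ N * sqrt t)) with (K * PI) by (unfold K; field; split; lra).
  apply Rmult_le_compat_l; [exact HK|].
  generalize (atan_bound t) (atan_bound M); lra.
Qed.
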